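(* Let $m$ be a fully supported Radon measure on $\mathbb{R}$ and let $(\mathcal{E},\mathcal{F})$ be a regular and strongly local Dirichlet form on $L^2(\mathbb{R},m)$ with effective intervals $\{(I_n,\mathtt{s}_n):n\ge1\}$. Then there exists a strictly increasing continuous function $\mathfrak{f}:\mathbb{R}\to\mathbb{R}$ with $\mathfrak{f}(0)=0$ such that $\mathscr{C}_{\mathfrak{f}}=\{\varphi\circ\mathfrak{f}:\varphi\in C_c^\infty(\mathfrak{f}(\mathbb{R}))\}$ is a special standard core of $(\mathcal{E},\mathcal{F})$.
   Context: $\langle a,b\rangle$ denotes an interval with endpoints $-\infty\le a<b\le\infty$, where each endpoint may or may not belong to it; intervals in $\mathbb{R}$ do not contain $\pm\infty$. For $J=\langle a,b\rangle$ fix the point $e\in J$: $e=(a+b)/2$ if both endpoints are finite, $e=a+1$ if only $a$ is finite, $e=b-1$ if only $b$ is finite, $e=0$ if $J=\mathbb{R}$. Let $\mathbf{S}(J)$ be the set of strictly increasing continuous functions $\mathtt{s}:J\to\mathbb{R}$ with $\mathtt{s}(e)=0$ (scale functions); put $\mathtt{s}(a)=\lim_{x\downarrow a}\mathtt{s}(x)$, $\mathtt{s}(b)=\lim_{x\uparrow b}\mathtt{s}(x)$, and let $d\mathtt{s}$ be the induced measure on $J$. Let $\mathbf{S}_\infty(J)$ be the set of $\mathtt{s}\in\mathbf{S}(J)$ adapted to $J$: $a\in J$ iff $a+\mathtt{s}(a)>-\infty$ (both finite), and $b\in J$ iff $b+\mathtt{s}(b)<\infty$. For a function $u$ on $J$,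 $u\ll\mathtt{s}$ means $u=g\circ\mathtt{s}$ with $g$ (locally) absolutely continuous, and $\frac{du}{d\mathtt{s}}:=g'\circ\mathtt{s}$. For $\mathtt{s}\in\mathbf{S}_\infty(J)$ define $\mathcal{F}^{(\mathtt{s})}$ as the set of $u\in L^2(J,m|_J)$ with $u\ll\mathtt{s}$, $\frac{du}{d\mathtt{s}}\in L^2(J,d\mathtt{s})$, with $u(a)=0$ whenever ($a=-\infty$, $\mathtt{s}(-\infty)>-\infty$, $m((-\infty,0])<\infty$) and $u(b)=0$ whenever ($b=\infty$, $\mathtt{s}(\infty)<\infty$, $m([0,\infty))<\infty$), and $\mathcal{E}^{(\mathtt{s})}(u,v)=\frac12\int_J\frac{du}{d\mathtt{s}}\frac{dv}{d\mathtt{s}}\,d\mathtt{s}$. A class of effective intervals is an at most countable family $\{(I_n,\mathtt{s}_n):n\ge1\}$ of mutually disjoint intervals $I_n\subset\mathbb{R}$ with $\mathtt{s}_n\in\mathbf{S}_\infty(I_n)$. It represents the regular strongly local Dirichlet form on $L^2(\mathbb{R},m)$ given by $\mathcal{F}=\{u\in L^2(\mathbb{R},m): u|_{I_n}\in\mathcal{F}^{(\mathtt{s}_n)}\ \forall n,\ \sum_n\mathcal{E}^{(\mathtt{s}_n)}(u|_{I_n},u|_{I_n})<\infty\}$, $\mathcal{E}(u,v)=\sum_n\mathcal{E}^{(\mathtt{s}_n)}(u|_{I_n},v|_{I_n})$. It is a known theorem (Li–Ying) that every regular strongly local Dirichlet form on $L^2(\mathbb{R},m)$ is represented this way by a class of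 effective intervals, unique up to order; these are called its effective intervals. A special standard core of a regular Dirichlet form $(\mathcal{E},\mathcal{F})$ on $L^2(E,m)$ is a set $\mathscr{C}\subset\mathcal{F}\cap C_c(E)$ that is $\mathcal{E}_1$-dense in $\mathcal{F}$ (where $\mathcal{E}_1(u,v)=\mathcal{E}(u,v)+\int uv\,dm$) and uniformly dense in $C_c(E)$, such that: $\mathscr{C}$ is a subalgebra of $C_c(E)$; for every $\varepsilon>0$ there is a function $\phi_\varepsilon:\mathbb{R}\to[-\varepsilon,1+\varepsilon]$ with $\phi_\varepsilon(t)=t$ on $[0,1]$, $0\le\phi_\varepsilon(t')-\phi_\varepsilon(t)\le t'-t$ for $t<t'$, and $\phi_\varepsilon\circ u\in\mathscr{C}$ for all $u\in\mathscr{C}$; and for every compact $K$ and relatively compact open $G\supset K$ there is $u\in\mathscr{C}$ with $u\ge0$, $u=1$ on $K$ and $u=0$ on $E\setminus G$. *)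

(* Defs.v *)
From HB Require Import structures.
From mathcomp Require Import all_boot all_order all_algebra.
From mathcomp Require Import all_classical all_reals all_analysis.
From mathcomp Require Import measurable_realfun.
Import Order.TTheory GRing.Theory Num.Theory.
Import numFieldNormedType.Exports.

Set Implicit Arguments.
Unset Strict Implicit.
Unset Printing Implicit Defensive.

Local Open Scope classical_set_scope.
Local Open Scope ring_scope.

Section measures_and_functions.
Context {R : realType}.
Local Notation RR := (measurableTypeR R).
Implicit Types (m : {measure set RR -> \bar R}) (u v : R -> R).

(* A Borel measure on the line is Radon iff it is finite on compact sets:
   inner and outer regularity are then automatic. *)
Definition radon m := forall K : set R, compact K -> (m K < +oo)%E.

Definition full_support m :=
  forall U : set R, open U -> U !=set0 -> (0 < m U)%E.

(* The support of the measure |u| dm, which depends only on the m-a.e. class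
   of u. *)
Definition msupport m u : set R :=
  [set x | forall U : set R, open U -> U x ->
           ~ \forall y \ae m, U y -> u y = 0].

Definition Cc : set (R -> R) :=
  [set u | continuous u /\ compact (closure [set x | u x != 0])].

(* C_c^oo(U) for U open, each function being extended by 0 outside U. *)
Definition Cc_smooth (U : set R) : set (R -> R) :=
  [set phi | [/\ forall n x, derivable (phi^`(n))%classic x 1,
                 compact (closure [set x | phi x != 0]) &
                 closure [set x | phi x != 0] `<=` U]].

Definition abs_continuous (c d : R) (g : R -> R) :=
  forall eps : R, 0 < eps -> exists2 delta : R, 0 < delta &
  forall (n : nat) (a b : nat -> R),
    (forall i, (i < n)%N -> c <= a i /\ a i <= b i /\ b i <= d) ->
    trivIset `I_n (fun i => [set` `]a i, b i[]) ->
    \sum_(i < n) (b i - a i) < delta ->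
    \sum_(i < n) `|g (b i) - g (a i)| < eps.

Definition locally_abs_continuous (X : set R) (g : R -> R) :=
  forall c d, c <= d -> `[c, d] `<=` X -> abs_continuous c d g.

End measures_and_functions.

(* A form on L^2(R, m) is given by a set F of square integrable Borel functions,
   saturated for m-a.e. equality, and a function E of pairs of functions that
   respects m-a.e. equality on F; the values of E outside F are irrelevant. *)
Section dirichlet_forms.
Context {R : realType}.
Local Notation RR := (measurableTypeR R).
Variables (m : {measure set RR -> \bar R}).
Variables (F : set (R -> R)) (E : (R -> R) -> (R -> R) -> R).

Definition E1 (u v : R -> R) : R := E u v + \int[m]_x (u x * v x).

Record dirichlet_form : Prop := DirichletForm {
  df_L2 : forall u, F u -> u \in Lfun m 2%:E ;
  df_ae : forall u v, F u -> v \in Lfun m 2%:E -> u = v %[ae m] -> F v ;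
  df_E_ae : forall u v w, F u -> F v -> F w -> u = v %[ae m] -> E u w = E v w ;
  df_0 : F (cst 0) ;
  df_lin : forall (a : R) u v, F u -> F v -> F (fun x => a * u x + v x) ;
  df_dense : forall u, u \in Lfun m 2%:E -> forall eps : R, 0 < eps ->
    exists2 v, F v & \int[m]_x ((u x - v x) ^+ 2) < eps ;
  df_E_sym : forall u v, F u -> F v -> E u v = E v u ;
  df_E_lin : forall (a : R) u v w, F u -> F v -> F w ->
    E (fun x => a * u x + v x) w = a * E u w + E v w ;
  df_E_ge0 : forall u, F u -> 0 <= E u u ;
  df_closed : forall u_ : nat -> R -> R, (forall n, F (u_ n)) ->
    (forall eps : R, 0 < eps -> exists N : nat, forall p q : nat,
      (N <= p)%N -> (N <= q)%N -> E1 (u_ p \- u_ q) (u_ p \- u_ q) < eps) ->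
    exists2 u, F u & E1 (u_ n \- u) (u_ n \- u) @[n --> \oo] --> (0 : R) ;
  df_markov : forall u, F u ->
    let u1 := fun x => Num.min (Num.max (u x) 0) 1 in
    F u1 /\ E u1 u1 <= E u u
}.

Definition E1_dense (C : set (R -> R)) :=
  forall u, F u -> forall eps : R, 0 < eps ->
    exists2 v, C v & E1 (u \- v) (u \- v) < eps.

Definition uniformly_dense_Cc (C : set (R -> R)) :=
  forall u, Cc u -> forall eps : R, 0 < eps ->
    exists2 v, C v & forall x, `|u x - v x| < eps.

Definition regular_form := E1_dense (F `&` Cc) /\ uniformly_dense_Cc (F `&` Cc).

Definition strongly_local := forall u v, F u -> F v ->
  compact (msupport m u) -> compact (msupport m v) ->
  (exists c : R, exists U : set R,
    [/\ open U, msupport m u `<=` U & \forall x \ae m, U x -> v x = c]) ->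
  E u v = 0.

Record special_standard_core (C : set (R -> R)) : Prop := SpecialStandardCore {
  core_sub : C `<=` F `&` Cc ;
  core_E1_dense : E1_dense C ;
  core_uniformly_dense : uniformly_dense_Cc C ;
  core_lin : forall (a : R) u v, C u -> C v -> C (fun x => a * u x + v x) ;
  core_mul : forall u v, C u -> C v -> C (u \* v) ;
  core_contraction : forall eps : R, 0 < eps -> exists phi : R -> R,
    [/\ forall t, - eps <= phi t <= 1 + eps,
        forall t, 0 <= t <= 1 -> phi t = t,
        forall t t', t < t' -> 0 <= phi t' - phi t <= t' - t &
        forall u, C u -> C (phi \o u)] ;
  core_urysohn : forall K G : set R,
    compact K -> open G -> compact (closure G) -> K `<=` G ->
    exists u, [/\ C u, forall x, 0 <= u x, forall x, K x -> u x = 1 &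
                  forall x, ~ G x -> u x = 0]
}.

End dirichlet_forms.

Section scale_functions.
Context {R : realType}.
Local Notation RR := (measurableTypeR R).

Definition nondegenerate (J : interval R) :=
  exists x y : R, [/\ x \in J, y \in J & x < y].

Definition base_point (J : interval R) : R :=
  match J with
  | Interval (BSide _ a) (BSide _ b) => (a + b) / 2
  | Interval (BSide _ a) (BInfty _) => a + 1
  | Interval (BInfty _) (BSide _ b) => b - 1
  | Interval (BInfty _) (BInfty _) => 0
  end.

(* Only the values on J of a scale function on J are relevant. *)
Record scale_function (J : interval R) := ScaleFunction {
  scale_val :> R -> R ;
  scale_continuous : {within [set` J], continuous scale_val} ;
  scale_increasing : {in J &, {homo scale_val : x y / x < y}} ;
  scale_base : scale_val (base_point J) = 0
}.

Section scale_function_theory.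
Variables (J : interval R) (s : scale_function J).

Definition scale_left : \bar R :=
  match J.1 with
  | BSide _ a => lim ((s x)%:E @[x --> a^'+])
  | BInfty _ => lim ((s x)%:E @[x --> -oo])
  end.

Definition scale_right : \bar R :=
  match J.2 with
  | BSide _ b => lim ((s x)%:E @[x --> b^'-])
  | BInfty _ => lim ((s x)%:E @[x --> +oo])
  end.

Definition adapted :=
  ((EFin @` [set` J]) (J.1 : \bar R) <->
     (-oo < (J.1 : \bar R) + scale_left)%E) /\
  ((EFin @` [set` J]) (J.2 : \bar R) <->
     ((J.2 : \bar R) + scale_right < +oo)%E).

(* The measure ds, extended by 0 outside J; scale_measure_itv below checks that
   ds (]x, y]) = s y - s x. *)
Definition scale_measure (A : set RR) : \bar R :=
  lebesgue_measure ((s @` (A `&` [set` J])) : set RR).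

Lemma scale_inj : {in [set` J] &, injective s}.
Proof.
move=> x y; rewrite !inE/= => xJ yJ sxy.
have [xy|yx|//] := ltgtP x y.
- by have := scale_increasing s xJ yJ xy; rewrite sxy ltxx.
- by have := scale_increasing s yJ xJ yx; rewrite sxy ltxx.
Qed.

Lemma image_scale_itv (A : set R) :
  is_interval A -> is_interval (s @` (A `&` [set` J])).
Proof.
move=> iA; apply/connected_intervalP.
apply: connected_continuous_connected.
  apply/connected_intervalP => x y [Ax Jx] [Ay Jy] z xzy.
  by split; [exact: (iA x y)|exact: (@interval_is_interval _ J x y)].
by apply: continuous_subspaceW (@scale_continuous _ s) => x [].
Qed.

Lemma image_scale_setD (A B : set R) :
  s @` ((A `\` B) `&` [set` J]) =
  s @` (A `&` [set` J]) `\` s @` (B `&` [set` J]).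
Proof.
apply/seteqP; split => [_ [x [[Ax nBx] Jx] <-]|_ [[x [Ax Jx] <-] nB]].
  split; first by exists x.
  move=> [y [By Jy] /scale_inj yx]; apply: nBx.
  by rewrite -yx// inE.
by exists x => //; split => //; split => // Bx; apply: nB; exists x.
Qed.

Lemma measurable_image_scale (A : set RR) : measurable A ->
  measurable ((s @` (A `&` [set` J])) : set RR).
Proof.
have measI (B : set R) : is_interval B ->
    measurable ((s @` (B `&` [set` J])) : set RR).
  by move=> iB; apply: is_interval_measurable; exact: image_scale_itv.
pose M := [set B : set R | measurable ((s @` (B `&` [set` J])) : set RR)].
suff /(_ A) : <<s (@ocitv R) >> `<=` M by [].
apply: smallest_sub => [|_ [x _ <-]]; last first.
  by apply: measI; exact: interval_is_interval.
split; rewrite /M /=.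
- by rewrite set0I image_set0; exact: measurable0.
- move=> B mB; rewrite image_scale_setD; apply: measurableD => //.
  by apply: measI => ? ?.
- move=> B mB; rewrite setI_bigcupl image_bigcup.
  exact: bigcupT_measurable.
Qed.

Lemma scale_measure0 : scale_measure set0 = 0%E.
Proof. by rewrite /scale_measure set0I image_set0 measure0. Qed.

Lemma scale_measure_ge0 A : (0 <= scale_measure A)%E.
Proof. exact: measure_ge0. Qed.

Lemma scale_measure_sigma_additive : semi_sigma_additive scale_measure.
Proof.
move=> A mA tA mUA; rewrite /scale_measure setI_bigcupl image_bigcup.
apply: measure_semi_sigma_additive.
- by move=> n; exact: measurable_image_scale.
- move=> i j _ _ [_ [[x [Aix Jx] <-] [y [Ajy Jy] /scale_inj yx]]].
  apply: tA => //; exists x; split => //.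
  by rewrite -yx// inE.
- by rewrite -image_bigcup -setI_bigcupl; exact: measurable_image_scale.
Qed.

HB.instance Definition _ := isMeasure.Build _ _ _ scale_measure
  scale_measure0 scale_measure_ge0 scale_measure_sigma_additive.

Lemma scale_measure_itv (x y : R) : x \in J -> y \in J -> x <= y ->
  scale_measure `]x, y] = (s y - s x)%:E.
Proof.
move=> xJ yJ; rewrite le_eqVlt => /predU1P[->|xy].
  by rewrite set_itvoc0 scale_measure0 subrr.
have sxy := scale_increasing s xJ yJ xy.
have -> : scale_measure `]x, y] = lebesgue_measure (`]s x, s y] : set RR).
  rewrite /scale_measure; congr (lebesgue_measure _); apply/seteqP; split.
    move=> _ [z [+ zJ] <-]; rewrite /= in_itv/= => /andP[xz zy].
    rewrite in_itv/= (scale_increasing s xJ zJ xz)/=.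
    move: zy; rewrite le_eqVlt => /predU1P[->//|zy].
    exact/ltW/(scale_increasing s zJ yJ zy).
  move=> t; rewrite /= in_itv/= => /andP[st ts].
  have sub : `[x, y] `<=` [set` J].
    by move=> z; rewrite /= in_itv/=; exact: (@interval_is_interval _ J x y).
  have := @IVT _ s x y t (ltW xy)
    (continuous_subspaceW sub (@scale_continuous _ s)).
  rewrite min_l ?max_r ?(ltW sxy)// (ltW st) ts => /(_ isT)[z zxy szt].
  exists z => //; split; last exact: sub.
  move: zxy; rewrite /= !in_itv/= => /andP[xz ->]; rewrite andbT.
  by rewrite lt_neqAle xz andbT; apply: contraTneq st => ->; rewrite szt ltxx.
by rewrite lebesgue_measure_itv/= lte_fin sxy.
Qed.

(* u << s *)
Definition scale_ac (u : R -> R) := exists2 g : R -> R,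
  locally_abs_continuous (s @` [set` J]) g & {in J, forall x, u x = g (s x)}.

(* du/ds = g' \o s with g = u \o s^-1, which on s(J) is the only g such that
   u = g \o s on J. At the ds-negligible set of points where g is not
   derivable, g' is a junk value. *)
Definition scale_derivative (u : R -> R) : R -> R :=
  fun x => derive1 (u \o pinv [set` J] s) (s x).

Variable m : {measure set RR -> \bar R}.

(* u(a) and u(b) are the limits of u at the infinite endpoints of J. *)
Definition scale_domain : set (R -> R) :=
  [set u | [/\ u \_ [set` J] \in Lfun m 2%:E,
     scale_ac u,
     scale_derivative u \_ [set` J] \in Lfun scale_measure 2%:E,
     (J.1 : \bar R) = -oo%E -> (-oo < scale_left)%E ->
       (m `]-oo, 0%R]%classic < +oo)%E ->
       u x @[x --> -oo] --> (0 : R) &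
     (J.2 : \bar R) = +oo%E -> (scale_right < +oo)%E ->
       (m `[0%R, +oo[%classic < +oo)%E ->
       u x @[x --> +oo] --> (0 : R)]].

Definition scale_form (u v : R -> R) : R :=
  2^-1 * \int[scale_measure]_(x in [set` J])
            (scale_derivative u x * scale_derivative v x).

End scale_function_theory.

(* An at most countable family (I_n, s_n) is indexed by a set D of natural
   numbers; I_n and s_n are irrelevant for n outside D. *)
Definition effective_intervals (D : set nat) (I : nat -> interval R)
    (s : forall n, scale_function (I n)) :=
  [/\ forall n, D n -> nondegenerate (I n),
      trivIset D (fun n => [set` I n]) &
      forall n, D n -> adapted (s n)].

Section represented_form.
Variables (m : {measure set RR -> \bar R}).
Variables (D : set nat) (I : nat -> interval R).
Variables (s : forall n, scale_function (I n)).

(* The functions satisfying the pointwise conditions; the domain of the form is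
   the set of the functions m-a.e. equal to one of these. *)
Definition effective_domain : set (R -> R) :=
  [set u | [/\ u \in Lfun m 2%:E,
     forall n, D n -> scale_domain (s n) m u &
     (\sum_(n <oo | n \in D) (scale_form (s n) u u)%:E < +oo)%E]].

Definition represents (F : set (R -> R)) (E : (R -> R) -> (R -> R) -> R) :=
  (forall u, F u <-> u \in Lfun m 2%:E /\
     exists2 v, effective_domain v & u = v %[ae m]) /\
  (forall u v, effective_domain u -> effective_domain v ->
     (E u v)%:E = (\sum_(n <oo | n \in D) (scale_form (s n) u v)%:E)%E).

End represented_form.

End scale_functions.

Definition scale_core {R : realType} (f : R -> R) : set (R -> R) :=
  [set u | exists2 phi, Cc_smooth (range f) phi & u = phi \o f].

(* Main.v *)
Require Import Defs.
From HB Require Import structures.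
From mathcomp Require Import all_boot all_order all_algebra.
From mathcomp Require Import all_classical all_reals all_analysis.
From mathcomp Require Import measurable_realfun ring lra zify.
Import Order.TTheory GRing.Theory Num.Theory.
Import numFieldNormedType.Exports.

(** The energy of a function is controlled through its increments. By the
    fundamental theorem of calculus for absolutely continuous functions and the
    Cauchy-Schwarz inequality, a continuous u in F satisfies
      (u z - u y)^2 <= (s_n z - s_n y) (N z - N y)   for y <= z in I_n,
    where N x is twice the energy that u carries on the left of x
    ([domain_energy_bound]). Conversely, by Fatou's lemma for difference
    quotients, such a bound by a nondecreasing N with values in [0, C] puts a
    continuous function with compact support in F, with energy at most C / 2
    ([energy_bound_domain]). This criterion involves no derivative, and it
    passes from f to all the functions v with |v y - v x| <= C (f y - f x). In
    particular, if f has such an N, then phi o f is in F for every smooth phi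
    with compact support in f(R).

    It remains to find one strictly increasing f with such an N, for which the
    functions phi o f are dense in F. A continuous u in F with compact support
    may have infinite variation, but running suprema over the cells of a fine
    grid give a function v, uniformly close to u and of no larger energy, with
    |v y - v x| <= f_v y - f_v x for a nondecreasing continuous f_v admitting
    the same N as u ([monotone_approximation]). Countably many functions v_j of this
    kind suffice to approximate all of F ([countable_selection]), and
    f = sum_j 2^(-j-1) f_j, normalized by f 0 = 0, dominates all of them
    ([tame_series]). It is strictly increasing because the v_j separate the
    points of R. Finally each v_j is approximated by functions phi o f, phi
    interpolating v_j at the points of a grid in the variable f x, with a
    Lipschitz constant that does not depend on the mesh
    ([smooth_interpolation]).

    Both approximations are first uniform with bounded energies, and become
    approximations for E1 by a substitute for the Banach-Saks theorem: if
    decreasing midpoint-convex sets B_k shrink uniformly to u and contain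
    functions of bounded energy, then near-minimizers of the energy over B_k
    converge to u for E1 ([near_minimizers_converge]). *)

Set Implicit Arguments.
Unset Strict Implicit.
Unset Printing Implicit Defensive.

Local Open Scope classical_set_scope.
Local Open Scope ring_scope.

(** * Absolute continuity over lists of intervals *)

Section clamp.
Context {R : realType}.
Implicit Types (c d x : R).

Definition clamp c d (x : R) := Num.max c (Num.min x d).

Lemma clamp_in c d x : c <= d -> c <= clamp c d x /\ clamp c d x <= d.
Proof. by rewrite /clamp => cd; rewrite le_max lexx/= ge_max cd ge_min lexx orbT. Qed.

Lemma clamp_id c d x : c <= x -> x <= d -> clamp c d x = x.
Proof. by rewrite /clamp => cx xd; rewrite min_l// max_r. Qed.

Lemma clamp_lip c d x y : x <= y -> 0 <= clamp c d y - clamp c d x <= y - x.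
Proof.
rewrite /clamp /Num.max /Num.min => xy; do ![case: ifP => //];
  move=> *; apply/andP; split; lra.
Qed.

Lemma clamp_le c d x y : x <= y -> clamp c d x <= clamp c d y.
Proof. by move=> /(clamp_lip c d); lra. Qed.

Lemma clamp_continuous c d : continuous (clamp c d).
Proof.
move=> x; apply: (@continuous_max _ _ (cst c) (fun x => Num.min x d)).
  exact: cvg_cst.
by apply: (@continuous_min _ _ id (cst d)); [exact: cvg_id|exact: cvg_cst].
Qed.

End clamp.

Section absolutely_continuous_lists.
Context {R : realType}.
Implicit Types (c d : R) (g G F : R -> R) (L : seq (R * R)).

(** An interval is encoded as the pair (right end, left end), so that the
    increment of g over p is g p.1 - g p.2. *)
Definition nonoverlapping L :=
  all (fun p => p.2 <= p.1) L &&
  pairwise (fun p q => (p.1 <= q.2) || (q.1 <= p.2)) L.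

Definition total_length L := \sum_(p <- L) (p.1 - p.2).
Definition list_variation g L := \sum_(p <- L) `|g p.1 - g p.2|.

(** Absolute continuity on the whole line, tested on finite lists rather than on
    initial segments of sequences: lists are easily concatenated and refined. *)
Definition list_ac g := forall eps : R, 0 < eps ->
  exists2 delta : R, 0 < delta & forall L, nonoverlapping L ->
    total_length L < delta -> list_variation g L < eps.

Definition clamp_list c d L := [seq (clamp c d p.1, clamp c d p.2) | p <- L].

Lemma nonoverlapping_clamp c d L : nonoverlapping L -> nonoverlapping (clamp_list c d L).
Proof.
move=> /andP[La Lp]; apply/andP; split.
  by rewrite all_map; apply: sub_all La => p /=; exact: clamp_le.
rewrite pairwise_map; apply: sub_pairwise Lp => p q /= /orP[h|h].
  by rewrite clamp_le.
by rewrite orbC clamp_le.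
Qed.

Lemma total_length_clamp c d L : nonoverlapping L ->
  total_length (clamp_list c d L) <= total_length L.
Proof.
move=> /andP[/allP La _]; rewrite /total_length big_map/= big_seq [leRHS]big_seq.
by apply: ler_sum => p /La /(clamp_lip c d)/andP[].
Qed.

(** Clamping moves the end points of non-overlapping intervals into [c, d]
    without lengthening the intervals or making them overlap. *)
Lemma abs_continuous_list_ac c d g : c <= d -> abs_continuous c d g ->
  list_ac (g \o clamp c d).
Proof.
move=> cd acg eps /acg[delta d0 H]; exists delta => // L sL.
move=> /(le_lt_trans (total_length_clamp c d sL)).
have -> : list_variation (g \o clamp c d) L = list_variation g (clamp_list c d L).
  by rewrite /list_variation big_map.
have /andP[/allP La /pairwiseP Lp] := nonoverlapping_clamp c d sL.
have Lcd p : p \in clamp_list c d L -> c <= p.2 /\ p.1 <= d.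
  by move=> /mapP[q _ ->/=]; split; have [] := clamp_in q.1 cd; have [] := clamp_in q.2 cd.
move: (clamp_list c d L) La Lp Lcd => {sL}L La Lp Lcd.
pose a i := (nth (c, c) L i).2; pose b i := (nth (c, c) L i).1.
rewrite /total_length /list_variation => Ld.
have := H (size L) a b; rewrite /a /b.
rewrite (big_nth (c, c)) big_mkord in Ld.
rewrite (big_nth (c, c)) big_mkord; apply => //.
- move=> i /(mem_nth (c, c)) iL; have := La _ iL; have [] := Lcd _ iL.
  by move=> ? ? ?; split.
- apply/trivIsetP => i j /= iL jL.
  wlog ij : i j iL jL / (i < j)%N.
    move=> W; case: (ltngtP i j) => // ij _; first by apply: W => //; rewrite neq_ltn ij.
    by rewrite setIC; apply: W => //; rewrite neq_ltn ij.
  move=> _; have /orP Lij := Lp (c, c) i j iL jL ij.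
  rewrite -subset0 => x [] /=; rewrite !in_itv/= => /andP[x1 x2] /andP[x3 x4].
  by case: Lij => H'; move: x1 x2 x3 x4 H'; lra.
Qed.

Lemma nonoverlapping_cons p L : nonoverlapping (p :: L) ->
  [/\ p.2 <= p.1, nonoverlapping L & all (fun q => (p.1 <= q.2) || (q.1 <= p.2)) L].
Proof. by move=> /andP[/= /andP[? ?] /andP[? ?]]; split => //; apply/andP. Qed.

Lemma nonoverlapping_disjoint (p : nat -> R * R) (r : seq nat) : uniq r ->
  {in r, forall i, (p i).2 < (p i).1} ->
  {in r &, forall i j, i != j ->
    `](p i).2, (p i).1[%classic `&` `](p j).2, (p j).1[%classic = set0} ->
  nonoverlapping [seq p i | i <- r].
Proof.
move=> ur pr dr; apply/andP; split; first by apply/allP => _ /mapP[i /pr/ltW + ->].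
rewrite pairwise_map; apply/(pairwiseP 0%N) => i j; rewrite !inE => iL jL ij.
have := mem_nth 0%N iL; have := mem_nth 0%N jL; rewrite /relpre/=.
set k := nth _ _ i; set l := nth _ _ j => lr kr; have pk := pr k kr; have pl := pr l lr.
have kl : k != l by rewrite nth_uniq// ltn_eqF.
have := dr k l kr lr kl; rewrite -subset0 => kl0.
apply/orP; have [|a1] := leP (p k).1 (p l).2; [by left|right].
rewrite leNgt; apply/negP => a2.
(* otherwise the two intervals meet at the middle of ]A, B[ *)
pose A := Num.max (p k).2 (p l).2; pose B := Num.min (p k).1 (p l).1.
have AB : A < B by rewrite /A /B gt_max !lt_min pk pl a1 a2.
have [A1 A2] : (p k).2 <= A /\ (p l).2 <= A by rewrite /A !le_max !lexx orbT.
have [B1 B2] : B <= (p k).1 /\ B <= (p l).1 by rewrite /B !ge_min !lexx orbT.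
apply: (kl0 ((A + B) / 2)); have [m1 m2] := midf_lt AB; split; rewrite /= in_itv/=.
  by rewrite (le_lt_trans A1 m1) (lt_le_trans m2 B1).
by rewrite (le_lt_trans A2 m1) (lt_le_trans m2 B2).
Qed.

Lemma partition_nonoverlapping a b s : itv_partition a b s ->
  [/\ nonoverlapping (zip s (a :: s)), total_length (zip s (a :: s)) = b - a &
   all (fun p => (a <= p.2) && (p.1 <= b)) (zip s (a :: s))].
Proof.
elim: s a => [|x s ih] a.
  by move=> [_ /eqP/= <-]; rewrite /total_length/= big_nil subrr.
move=> pa; have /andP[ax _] : (a < x) && path <%O x s by case: pa.
have := itv_partition_cons pa => px; have xb := itv_partition_le px.
have [/andP[i1 i2] l3 l4] := ih x px.
split.
- rewrite /nonoverlapping/= (ltW ax)/= i1 i2 andbT/=.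
  by apply/allP => p /(allP l4)/andP[-> _].
- by rewrite /total_length/= big_cons -/(total_length _) l3/=; lra.
- rewrite /= lexx xb/=; apply/allP => p /(allP l4)/andP[h ->]; rewrite andbT.
  by rewrite (le_trans (ltW ax)).
Qed.

(** Each interval is cut along a partition that nearly achieves the total
    variation of g on it. This is how a condition on increments over short
    lists becomes a condition on total variations. *)
Lemma refine_list_variation g L (eta : R) : nonoverlapping L -> 0 < eta ->
  (forall p, p \in L -> bounded_variation p.2 p.1 g) ->
  exists L', [/\ nonoverlapping L', total_length L' = total_length L,
   \sum_(p <- L) fine (total_variation p.2 p.1 g) <=
     list_variation g L' + eta *+ size L &
   forall p', p' \in L' -> exists2 p, p \in L & (p.2 <= p'.2) && (p'.1 <= p.1)].
Proof.
move=> + e0; elim: L => [|p L ih] /=.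
  by exists [::]; rewrite !big_nil /list_variation big_nil mulr0n addr0.
move=> /nonoverlapping_cons[pp nL aL] bv.
have [|L' [nL' tL' vL' sL']] := ih nL.
  by move=> q qL; apply: bv; rewrite inE qL orbT.
have bvp : bounded_variation p.2 p.1 g by apply: bv; rewrite inE eqxx.
have fp : total_variation p.2 p.1 g \is a fin_num by apply/bounded_variationP.
have : ((fine (total_variation p.2 p.1 g) - eta)%:E < total_variation p.2 p.1 g)%E.
  by rewrite EFinB fineK// lteBlDr// lteDl// lte_fin.
move=> /ereal_sup_gt[_ [_ [s ps <-] <-]].
rewrite lte_fin variation_zip// => ts.
have [ns lns as_] := partition_nonoverlapping ps.
exists (zip s (p.2 :: s) ++ L'); split.
- case/andP: ns => n1 n2; case/andP: nL' => n3 n4.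
  rewrite /nonoverlapping all_cat n1 n3/= pairwise_cat n2 n4/= andbT.
  apply/allrelP => q r /(allP as_)/andP[q1 q2] /sL'[t tL /andP[t1 t2]].
  have /orP[h|h] := allP aL t tL.
  - by rewrite (le_trans q2 (le_trans h t1)).
  - by rewrite (le_trans t2 (le_trans h q1)) orbT.
- by rewrite /total_length big_cat/= big_cons -!/(total_length _) tL' lns.
- rewrite big_cons /list_variation big_cat/= -!/(list_variation _ _).
  rewrite -/(list_variation g L') mulrS.
  by move: vL' ts; rewrite /list_variation; lra.
- move=> q; rewrite mem_cat => /orP[/(allP as_) q1|/sL'[r rL rq]].
    by exists p => //; rewrite inE eqxx.
  by exists r => //; rewrite inE rL orbT.
Qed.

(** The interval [c, d] is cut into finitely many pieces shorter than the delta
    attached to eps = 1, and g has variation at most 1 on each of them. *)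
Lemma list_ac_bounded_variation c d g : c <= d ->
  list_ac g -> bounded_variation c d g.
Proof.
move=> cd /(_ 1 ltr01)[delta d0 H].
have short a b : a <= b -> b - a < delta -> bounded_variation a b g.
  move=> ab bad; exists 1 => _ [s ps <-].
  have [n1 n2 n3] := partition_nonoverlapping ps.
  by rewrite variation_zip//; apply/ltW/H => //; rewrite n2.
apply/bounded_variationP => //.
have [N Nd] : exists N : nat, d - c <= N%:R * (delta / 2).
  exists (Num.bound ((d - c) / (delta / 2))).
  rewrite -ler_pdivrMr ?divr_gt0//; apply/ltW/archi_boundP.
  by rewrite divr_ge0 ?divr_ge0 ?subr_ge0// ltW.
suff : forall k x, c <= x -> x - c <= k%:R * (delta / 2) ->
    total_variation c x g \is a fin_num by apply; [|exact: Nd].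
elim=> [|k ih] x cx.
  rewrite mul0r => h; have -> : x = c by apply/eqP; rewrite eq_le; lra.
  by rewrite total_variationxx.
rewrite -natr1 => xk; have [xd'|xd'] := ltP (x - c) delta.
  by apply/bounded_variationP => //; exact: short.
have y1 : c <= x - delta / 2 by lra.
rewrite (total_variationD g y1)//; last by lra.
rewrite fin_numD; apply/andP; split; first by apply: ih => //; lra.
by apply/bounded_variationP; [lra|apply: short => //; lra].
Qed.

(** Stopping the variation at c and d makes it a function on the whole line. *)
Definition stopped_tv c d g x := fine (total_variation c (clamp c d x) g).

Lemma stopped_tv_increment c d g x y : c <= d -> list_ac g -> x <= y ->
  stopped_tv c d g y - stopped_tv c d g x =
    fine (total_variation (clamp c d x) (clamp c d y) g) /\
  `|g (clamp c d y) - g (clamp c d x)| <= stopped_tv c d g y - stopped_tv c d g x.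
Proof.
move=> cd acg xy; have [cx xd] := clamp_in x cd; have [cy yd] := clamp_in y cd.
have cxy := clamp_le c d xy.
have f1 : total_variation c (clamp c d x) g \is a fin_num.
  exact/bounded_variationP/list_ac_bounded_variation.
have f2 : total_variation (clamp c d x) (clamp c d y) g \is a fin_num.
  exact/bounded_variationP/list_ac_bounded_variation.
have E : stopped_tv c d g y - stopped_tv c d g x =
    fine (total_variation (clamp c d x) (clamp c d y) g).
  by rewrite /stopped_tv (total_variationD g cx cxy) fineD//; lra.
by split=> //; rewrite E -lee_fin fineK//; exact: total_variation_ge.
Qed.

(** Hence g is the difference of two nondecreasing absolutely continuous
    functions, its variation and its variation minus itself. *)
Lemma list_ac_stopped_tv c d g : c <= d -> list_ac g -> list_ac (stopped_tv c d g).
Proof.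
move=> cd acg eps e0; have e2 : 0 < eps / 2 by rewrite divr_gt0.
have [delta d0 H] := acg _ e2.
exists delta => // L sL tL.
have -> : list_variation (stopped_tv c d g) L =
    \sum_(p <- clamp_list c d L) fine (total_variation p.2 p.1 g).
  rewrite big_map; apply: eq_big_seq => p pL/=.
  case/andP: sL => /allP /(_ p pL) pp _.
  have [-> h] := stopped_tv_increment cd acg pp.
  by rewrite ger0_norm// fine_ge0// total_variation_ge0//; exact: clamp_le.
have sL' := nonoverlapping_clamp c d sL.
have [|p pL|L' [sL'' tL' vL' _]] := @refine_list_variation g _ (eps / 2 / (size L).+1%:R) sL'.
- by rewrite !divr_gt0.
- apply: list_ac_bounded_variation => //.
  by case/andP: sL' => /allP /(_ p pL).
apply: le_lt_trans vL' _.
rewrite [ltRHS]splitr ltr_leD//.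
  by apply: H => //; rewrite tL'; exact: le_lt_trans (total_length_clamp _ _ _) tL.
rewrite size_map -[leLHS]mulr_natr -mulrA ger_pMr ?divr_gt0// mulrC ler_pdivrMr// mul1r.
by rewrite ler_nat.
Qed.

Lemma list_ac_continuous g : list_ac g -> continuous g.
Proof.
move=> acg x; apply/cvgrPdist_lt => e /acg[delta d0 H].
exists delta => // y /= xyd.
have [xy|yx] := leP x y.
- have := H [:: (y, x)]; rewrite /list_variation /total_length !big_seq1 /= distrC.
  apply; first by rewrite /nonoverlapping/= xy.
  by move: xyd; rewrite distrC ger0_norm// subr_ge0.
- have := H [:: (x, y)]; rewrite /list_variation /total_length !big_seq1 /=.
  apply; first by rewrite /nonoverlapping/= ltW.
  by move: xyd; rewrite ger0_norm// subr_ge0 ltW.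
Qed.

End absolutely_continuous_lists.

(** * The derivative of an absolutely continuous function *)

(** Openness excludes the end points, and finite length the infinite ones. *)
Lemma open_finite_interval (R : realType) (V : set R) : open V -> is_interval V ->
  (@lebesgue_measure R V < +oo)%E ->
  exists p : R * R, p.2 <= p.1 /\ V = `]p.2, p.1[%classic.
Proof.
move=> oV iV; have VE : [set` Rhull V] = V by rewrite RhullK// inE.
move: oV; rewrite -{}VE {iV}; case: (Rhull V) => [a b] oab.
have hole z : [set` Interval a b] z -> exists2 e, 0 < e &
    [set` Interval a b] (z - e) /\ [set` Interval a b] (z + e).
  move=> /oab[e /= e0 ball]; exists (e / 2); first by rewrite divr_gt0.
  have e2e : e / 2 < e by rewrite ltr_pdivrMr// ltr_pMr// ltr1n.
  split; apply: ball => /=.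
    by rewrite opprB addrC subrK gtr0_norm// divr_gt0.
  by rewrite opprD addrA subrr add0r normrN gtr0_norm// divr_gt0.
clear oab; rewrite lebesgue_measure_itv/=.
case: ifPn => [|/negP/negP]; last rewrite -leNgt; move=> ab; last first.
  move=> _; exists (0, 0) => /=; split=> //.
  rewrite set_itvoo0 -subset0 => z /= /hole[e e0 []].
  move: ab {hole}; case: a b => [[] a|[]] [[] b|[]]//=;
    rewrite ?in_itv/= ?lee_fin ?leeNy_eq ?leye_eq// => ab /andP[? ?] /andP[? ?]; lra.
case: a b hole ab => [[] a|[]] [[] b|[]]//=; rewrite ?lte_fin => hole ab _.
- have := hole a; rewrite in_itv/= lexx ab => /(_ isT)[e e0]; rewrite in_itv/= => -[/andP[? _] _]; lra.
- have := hole a; rewrite in_itv/= lexx (ltW ab) => /(_ isT)[e e0]; rewrite in_itv/= => -[/andP[? _] _]; lra.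
- by exists (b, a); split => //=; exact: ltW.
- have := hole b; rewrite in_itv/= lexx ab => /(_ isT)[e e0]; rewrite !in_itv/= => -[_ /andP[_ ?]]; lra.
Qed.

Section absolutely_continuous_measure.
Context {R : realType}.
Local Notation mu := (@lebesgue_measure R).
Local Notation RR := (measurableTypeR R).
Variables (F : R -> R) (c d : R).
Hypotheses (ndF : nondecreasing F) (acF : list_ac F) (cd : c <= d).

Let rcF : right_continuous F.
Proof. by move=> x; apply: cvg_at_right_filter; exact: list_ac_continuous. Qed.

#[local] HB.instance Definition _ := isCumulative.Build R _ R F ndF rcF.

Let nu : {measure set RR -> \bar R} := lebesgue_stieltjes_measure F.

Let nu_itv x y : x <= y -> nu `]x, y]%classic = (F y - F x)%:E.
Proof.
move=> xy; rewrite /nu/= /lebesgue_stieltjes_measure /measure_extension/=.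
by rewrite measurable_mu_extE/= ?wlength_itv_bnd//; exact: is_ocitv.
Qed.

Let nu_open (U : set R) (delta e : R) :
  (forall L, nonoverlapping L -> total_length L < delta -> list_variation F L < e) ->
  open U -> (mu U < delta%:E)%E -> (nu U <= e%:E)%E.
Proof.
move=> H oU Ud; pose V := open_disjoint_itv oU.
have mV i : measurable (V i : set RR).
  by apply: is_interval_measurable; exact: open_disjoint_itv_is_interval.
have tV : trivIset setT V by exact: open_disjoint_itv_trivIset.
have UV : U = \bigcup_n V n by exact: open_disjoint_itv_bigcup.
have Od i : (mu (V i) < delta%:E)%E.
  apply: le_lt_trans Ud; apply: le_measure; rewrite ?inE//.
    by rewrite UV; exact: bigcupT_measurable.
  by rewrite UV; exact: bigcup_sup.
have itvO i : exists p : R * R, p.2 <= p.1 /\ V i = `]p.2, p.1[%classic.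
  apply: open_finite_interval; first exact: open_disjoint_itv_open.
  - exact: open_disjoint_itv_is_interval.
  - by apply: lt_trans (Od i) _; rewrite ltry.
have [p /all_and2[p12 Vp]] := choice itvO.
rewrite [X in nu X]UV.
have := @measure_bigcup _ _ _ nu setT V (fun i _ => mV i) tV => ->.
apply: lime_le; first exact: is_cvg_nneseries.
near=> n.
pose L := map p [seq i <- iota 0 n | (p i).2 < (p i).1].
have sL : nonoverlapping L.
  apply: nonoverlapping_disjoint; first by rewrite filter_uniq ?iota_uniq.
    by move=> i; rewrite mem_filter => /andP[].
  by move=> i j _ _ ij; have := (trivIsetP.1 tV) i j I I ij; rewrite !Vp.
have tot (G : nat -> R) : (forall i, (p i).2 = (p i).1 -> G i = 0) ->
    \sum_(0 <= i < n) G i = \sum_(i <- [seq i <- iota 0 n | (p i).2 < (p i).1]) G i.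
  move=> G0; rewrite big_filter /index_iota subn0 [RHS]big_mkcond/=.
  apply: eq_bigr => i _; case: ifPn => // /negP pi.
  by apply: G0; apply/eqP; rewrite eq_le p12 leNgt; apply/negP.
have muO i : mu (V i) = ((p i).1 - (p i).2)%:E.
  rewrite Vp lebesgue_measure_itv/= lte_fin; case: ltgtP (p12 i) => // -> _.
  by rewrite subrr.
have := H L sL; rewrite /total_length /list_variation /L !big_map.
rewrite -(tot (fun i => (p i).1 - (p i).2)); last by move=> i ->; rewrite subrr.
rewrite -(tot (fun i => `|F (p i).1 - F (p i).2|)); last first.
  by move=> i ->; rewrite subrr normr0.
move=> HL; apply: (@le_trans _ _ (\sum_(0 <= i < n) `|F (p i).1 - F (p i).2|)%:E).
  rewrite -sumEFin (eq_bigl xpredT); last by move=> i; rewrite in_setT.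
  apply: lee_sum => i _.
  rewrite ger0_norm ?subr_ge0; last exact: ndF.
  rewrite -nu_itv// Vp; apply: le_measure; rewrite ?inE//.
  by apply: subset_itv; rewrite bnd_simp.
rewrite lee_fin; apply/ltW/HL; rewrite -lte_fin; apply: le_lt_trans Ud.
rewrite -sumEFin (eq_bigr (fun i => mu (V i))); last by move=> i _; rewrite muO.
rewrite UV measure_bigcup//=.
apply: le_trans (nneseries_lim_ge n _) => //.
by rewrite [leRHS](eq_bigl xpredT)// => i; rewrite in_setT.
Unshelve. all: by end_near. Qed.

Let nu_mu (A : set RR) : measurable A -> mu A = 0 -> nu A = 0.
Proof.
move=> mA A0; apply/eqP; rewrite eq_le measure_ge0 andbT.
apply/lee_addgt0Pr => e e0; rewrite add0e.
have [delta d0 H] := acF e0.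
have Aoo : (mu A < +oo)%E by rewrite A0 ltry.
have [U [oU AU Ud]] := lebesgue_regularity_outer mA Aoo d0.
have mU : measurable (U : set RR) by exact: open_measurable.
apply: (@le_trans _ _ (nu U)); first by apply: le_measure; rewrite ?inE.
apply: (nu_open H oU).
have mUA : measurable (U `\` A : set RR) by exact: measurableD.
have <- : mu (A `|` U `\` A) = mu U by rewrite setDUK.
rewrite measureU//; last by rewrite setDIK.
by rewrite [X in (X + _)%E]A0 add0e.
Qed.

(** The Stieltjes measure of F is dominated by the Lebesgue measure: a null set
    is covered by an open set of small length, whose components form
    non-overlapping intervals over which the increments of F add up to a small
    number. The Radon-Nikodym theorem then gives the density. *)
Lemma list_ac_density : exists2 h : R -> R,
  mu.-integrable `]c, d] (EFin \o h) & forall x, c <= x -> x <= d ->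
  F x - F c = \int[mu]_(t in `]c, x]) h t.
Proof.
have mcd : measurable (`]c, d]%classic : set RR) by exact: measurable_itv.
have cdoo : (nu `]c, d]%classic < +oo)%E by rewrite nu_itv// ltry.
pose nu' := mfrestr mcd cdoo.
have dom : nu' `<< mu.
  apply/null_content_dominatesP => A mA A0; rewrite /nu' /mfrestr /mrestr.
  apply: nu_mu; first exact: measurableI.
  by apply/eqP; rewrite -measure_le0 -A0; apply: le_measure; rewrite ?inE//; exact: measurableI.
have [f [f0 ffin intf fE]] := @radon_nikodym_sigma_finite _ _ _ mu nu' dom.
exists (fine \o f).
  rewrite (_ : EFin \o (fine \o f) = f); first exact: (integrableS measurableT).
  by apply/funext => x/=; rewrite fineK.
move=> x cx xd; apply: EFin_inj.
have mcx : measurable (`]c, x]%classic : set RR) by exact: measurable_itv.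
rewrite -nu_itv// /Rintegral.
under [in RHS]eq_integral do rewrite /= fineK//.
rewrite -fE// fineK; last exact: fin_num_measure.
rewrite /nu' /mfrestr /mrestr; congr (nu _).
by apply/esym/setIidPl/subset_itvl; rewrite bnd_simp.
Qed.

End absolutely_continuous_measure.

Section fundamental_theorem.
Context {R : realType}.
Local Notation mu := (@lebesgue_measure R).
Local Notation RR := (measurableTypeR R).
Implicit Types (c d : R) (g : R -> R).

Lemma list_acB (F G : R -> R) : list_ac F -> list_ac G -> list_ac (F \- G).
Proof.
move=> acF acG e e0; have e2 : 0 < e / 2 by rewrite divr_gt0.
have [d1 d10 H1] := acF _ e2; have [d2 d20 H2] := acG _ e2.
exists (Num.min d1 d2) => [|L nL]; first by rewrite lt_min d10.
rewrite lt_min => /andP[/(H1 _ nL) h1 /(H2 _ nL) h2].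
rewrite [ltRHS]splitr; apply: le_lt_trans (ltrD h1 h2).
rewrite /list_variation -big_split/=; apply: ler_sum => p _.
have -> : (F \- G) p.1 - (F \- G) p.2 = (F p.1 - F p.2) - (G p.1 - G p.2).
  by rewrite /=; ring.
exact: ler_normB.
Qed.

Lemma abs_continuous_density c d g : c <= d -> abs_continuous c d g ->
  exists2 k : R -> R, mu.-integrable `]c, d] (EFin \o k) &
    forall x, c <= x -> x <= d -> g x - g c = \int[mu]_(t in `]c, x]) k t.
Proof.
move=> cd acg; set G := g \o clamp c d.
have acG : list_ac G by exact: abs_continuous_list_ac.
set F := stopped_tv c d G.
have acF : list_ac F by exact: list_ac_stopped_tv.
have GE x : G (clamp c d x) = G x.
  by have [cx xd] := clamp_in x cd; rewrite /G/= (clamp_id cx xd).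
have FG x y : x <= y -> `|G y - G x| <= F y - F x.
  by move=> xy; have [_] := stopped_tv_increment cd acG xy; rewrite !GE.
have ndF : nondecreasing F.
  by move=> x y /FG; rewrite -subr_ge0; exact: le_trans.
have ndFG : nondecreasing (F \- G).
  by move=> x y /FG /(le_trans (ler_norm _))/=; lra.
have [h ih hE] := list_ac_density ndF acF cd.
have [l il lE] := list_ac_density ndFG (list_acB acF acG) cd.
exists (h \- l); first exact: (@integrableB _ _ _ mu _ _ (EFin \o h) (EFin \o l)).
move=> x cx xd; rewrite RintegralB//.
- rewrite -hE// -lE//= /G/= !clamp_id//; ring.
- apply: integrableS ih => //; by apply: subset_itvl; rewrite bnd_simp.
- apply: integrableS il => //; by apply: subset_itvl; rewrite bnd_simp.
Qed.

(** By Lebesgue differentiation, the density of g is almost everywhere the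
    derivative of its indefinite integral. *)
Lemma abs_continuous_derivative c d g : c <= d -> abs_continuous c d g ->
  exists k : R -> R, [/\ mu.-integrable `]c, d] (EFin \o k),
    g d - g c = \int[mu]_(t in `]c, d]) k t &
    \forall x \ae mu, `]c, d[%classic x -> derivable g x 1 /\ derive1 g x = k x].
Proof.
move=> cd /(abs_continuous_density cd)[k0 ik0 k0E].
pose k := k0 \_ `]c, d].
have kE x : x <= d -> \int[mu]_(t in `]c, x]) k t = \int[mu]_(t in `]c, x]) k0 t.
  move=> xd; apply: eq_Rintegral => t; rewrite inE/= => tx; rewrite /k patchE mem_set//.
  by move: tx; rewrite /= !in_itv/= => /andP[->/= tx]; exact: le_trans xd.
have ik : mu.-integrable `]c, d] (EFin \o k).
  by apply: eq_integrable ik0 => // x xcd/=; rewrite /k patchE xcd.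
exists k; split => //.
  by rewrite kE// -k0E.
have : locally_integrable [set: R] k by exact: integrable_locally_restrict.
move=> /lebesgue_differentiation.
apply: filterS; first exact: (ae_filter_ringOfSetsType mu).
move=> x xk; rewrite /= in_itv/= => /andP[cx xd].
have [] := @FTC1_lebesgue_pt _ k (BRight c) x d xd ik _ xk; first by rewrite lte_fin.
set K := fun y => _; move=> dK KE.
have gK : \forall y \near x, K y + g c = g y.
  have : \forall y \near x, y \in `]c, d[ by apply: near_in_itvoo; rewrite in_itv/= cx xd.
  apply: filterS => y; rewrite in_itv/= => /andP[cy yd].
  by rewrite /K kE ?ltW// -k0E ?ltW// subrK.
clearbody K; have dKx : is_derive x (1 : R) K (k x).
  by apply: DeriveDef => //; rewrite -derive1E.
have dc := is_derive_cst (g c) x (1 : R).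
have dg : is_derive x (1 : R) g (k x).
  apply: (near_eq_is_derive _ (is_derive_eq (is_deriveD dKx dc) (addr0 _))).
  by apply: filterS gK => y <-.
by have [d1 d2] := dg; split => //; rewrite derive1E.
Qed.

Lemma abs_continuous_cauchy_schwarz c d g : c < d -> abs_continuous c d g ->
  measurable_fun `]c, d[ (derive1 g) ->
  (((g d - g c) ^+ 2)%:E <=
    (d - c)%:E * \int[mu]_(t in `]c, d[) ((derive1 g t) ^+ 2)%:E)%E.
Proof.
move=> cd acg mg; have [k [ik kE ae]] := abs_continuous_derivative (ltW cd) acg.
have mcd : measurable (`]c, d[%classic : set RR) by exact: measurable_itv.
have cd0 : 0 < d - c by rewrite subr_gt0.
have iko : mu.-integrable `]c, d[ (EFin \o k).
  by apply: integrableS ik => //; apply: subset_itvl; rewrite bnd_simp.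
have mk : measurable_fun `]c, d[ k.
  by apply/measurable_EFinP; exact: measurable_int iko.
have -> : (\int[mu]_(t in `]c, d[) (((derive1 g t)) ^+ 2)%:E =
           \int[mu]_(t in `]c, d[) ((k t) ^+ 2)%:E)%E.
  apply: ae_eq_integral => //.
  - by apply/measurable_EFinP; exact: measurable_funX.
  - by apply/measurable_EFinP; exact: measurable_funX.
  - move: ae; apply: filterS; first exact: (ae_filter_ringOfSetsType mu).
    by move=> x /= h /h[_ ->].
have [koo|koo] := ltP (\int[mu]_(t in `]c, d[) ((k t) ^+ 2)%:E)%E +oo%E; last first.
  by move: koo; rewrite leye_eq => /eqP ->; rewrite gt0_muley ?leey// lte_fin.
have ik2 : mu.-integrable `]c, d[ (fun t => ((k t) ^+ 2)%:E).
  apply/integrableP; split; first by apply/measurable_EFinP; exact: measurable_funX.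
  by under eq_integral do rewrite /= ger0_norm ?sqr_ge0//.
(* integrating 2 a k - a ^ 2 <= k ^ 2 gives the bound for the mean slope a *)
pose a := (g d - g c) / (d - c).
have iak : mu.-integrable `]c, d[ (EFin \o (fun t => 2 * a * k t)).
  rewrite (_ : EFin \o _ = (fun t => (2 * a)%:E * (EFin \o k) t)%E).
    exact: integrableZl.
  by apply/funext => t /=; rewrite EFinM.
have ia2 : mu.-integrable `]c, d[ (EFin \o cst (a ^+ 2)).
  apply/integrableP; split; first by apply/measurable_EFinP; exact: measurable_cst.
  rewrite /= integral_cst//= lebesgue_measure_itv/= lte_fin cd.
  by rewrite -EFinD -EFinM ltry.
have ilin : mu.-integrable `]c, d[ (EFin \o (fun t => 2 * a * k t - a ^+ 2)).
  exact: (@integrableB _ _ _ mu _ mcd _ _ iak ia2).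
have := @le_Rintegral _ _ _ mu _ _ _ mcd ilin ik2.
have -> : \int[mu]_(t in `]c, d[) (2 * a * k t - a ^+ 2) = (g d - g c) ^+ 2 / (d - c).
  rewrite RintegralB//.
  have muE : fine (mu `]c, d[%classic) = d - c.
    by rewrite lebesgue_measure_itv/= lte_fin cd.
  rewrite RintegralZl// Rintegral_cst// [fine _]muE.
  rewrite Rintegral_itv_bndo_bndc// -kE /a; field.
  by rewrite gt_eqF.
move=> /(_ _)H; rewrite -(fineK (_ : (\int[mu]_(t in `]c, d[) ((k t) ^+ 2)%:E)%E \is a fin_num)); last exact: integrable_fin_num.
rewrite -EFinM lee_fin mulrC -ler_pdivrMr//; apply: H => t _.
have := sqr_ge0 (k t - a); lra.
Qed.

End fundamental_theorem.

(** * Square integrability of derivatives *)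

Lemma inv_succ_lt (R : realType) (e : R) : 0 < e ->
  exists n, forall k, (n <= k)%N -> k.+1%:R^-1 < e.
Proof.
move=> e0; exists (Num.bound e^-1) => k nk; rewrite invf_plt ?posrE//.
apply: lt_le_trans (archi_boundP _) _; first by rewrite invr_ge0 ltW.
by rewrite ler_nat ltnW.
Qed.

Section difference_quotients.
Context {R : realType}.
Local Notation mu := (@lebesgue_measure R).
Local Notation RR := (measurableTypeR R).
Implicit Types (g M : R -> R).

Definition quotient g (h x : R) := h^-1 * (g (h + x) - g x).

Lemma derive1_quotient g x : derive1 g x = lim (quotient g h x @[h --> 0^']).
Proof. by []. Qed.

Lemma derivable_quotient g x : derivable g x 1 <-> cvg (quotient g h x @[h --> 0^']).
Proof.
rewrite /derivable (_ : (fun h => _) = quotient g ^~ x)//.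
by apply/funext => h; rewrite /quotient/= [h *: 1]mulr1.
Qed.

(** The default value of a limit that does not exist is 0, so that integrals of
    squared derivatives ignore the points where g is not derivable. *)
Lemma derive1_junk g x : ~ derivable g x 1 -> derive1 g x = 0.
Proof.
move=> /derivable_quotient ng; rewrite derive1_quotient.
rewrite /lim /lim_in getPN// => l gl; apply: ng.
by apply/cvg_ex; exists l.
Qed.

Lemma quotient_continuous g (h : R) : continuous g -> continuous (quotient g h).
Proof.
move=> cg x; apply: cvgM; first exact: cvg_cst.
apply: cvgB; last exact: cg.
apply: continuous_comp; last exact: cg.
by apply: cvgD; [exact: cvg_cst|exact: cvg_id].
Qed.

Lemma quotient_measurable g (h : R) : continuous g -> measurable_fun setT (quotient g h).
Proof. by move=> cg; apply: continuous_measurable_fun; exact: quotient_continuous. Qed.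

Lemma quotient_continuousl g (h x : R) : h != 0 -> continuous g ->
  {for h, continuous (quotient g ^~ x)}.
Proof.
move=> h0 cg; apply: cvgM; first exact: cvgV.
apply: cvgB; last exact: cvg_cst.
apply: (@continuous_comp _ _ _ (fun h => h + x) g); last exact: cg.
by apply: cvgD; [exact: cvg_id|exact: cvg_cst].
Qed.

Lemma nbhs_rat (x : R) (A : set R) : nbhs x A -> exists q : rat, A (ratr q).
Proof.
move=> /nbhs_ballP[e /= e0 xA].
have [|q] := @rat_in_itvoo _ x (x + e); first by rewrite ltrDl.
rewrite in_itv/= => /andP[xq qx]; exists q; apply: xA => /=.
by rewrite /ball/= ltr_distlC; lra.
Qed.

Lemma nbhs_small (h r : R) : 0 < `|h| < r -> \forall p \near h, 0 < `|p| < r.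
Proof.
move=> hr; have hr' : `|h| \in `]0, r[ by rewrite in_itv.
have := @norm_continuous _ R^o h _ (near_in_itvoo hr') => H.
by near=> p; have : `|p| \in `]0, r[ by [near: p; exact: H]; rewrite in_itv.
Unshelve. all: by end_near. Qed.

Definition small_rat (k : nat) (q : rat) : Prop := 0 < `|ratr q : R| < k.+1%:R^-1.

(** A Cauchy criterion on rational increments: derivability is expressed by
    countably many conditions on continuous functions, which makes the set of
    points where it holds measurable. *)
Lemma derivable_rat g x : continuous g -> derivable g x 1 <->
  (forall j : nat, exists k : nat, forall p q : rat, small_rat k p -> small_rat k q ->
    `|quotient g (ratr p) x - quotient g (ratr q) x| <= j.+1%:R^-1).
Proof.
move=> cg; rewrite derivable_quotient; split.
- move=> /cvg_ex[l /= gl] j.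
  move/cvgrPdist_lt : gl => /(_ (j.+1%:R^-1 / 2)) /(_ (divr_gt0 _ _))[]//= e /= e0 H.
  have [k /(_ k (leqnn k)) ke] := inv_succ_lt e0.
  exists k => p q /andP[p0 pk] /andP[q0 qk].
  have Hp : `|l - quotient g (ratr p) x| < j.+1%:R^-1 / 2.
    by apply: H; [rewrite /= sub0r normrN; exact: lt_trans pk ke|rewrite -normr_gt0].
  have Hq : `|l - quotient g (ratr q) x| < j.+1%:R^-1 / 2.
    by apply: H; [rewrite /= sub0r normrN; exact: lt_trans qk ke|rewrite -normr_gt0].
  rewrite distrC in Hp; rewrite distrC in Hq.
  rewrite [X in `|X|](_ : _ = (quotient g (ratr p) x - l) - (quotient g (ratr q) x - l)); last by ring.
  by rewrite (le_trans (ler_normB _ _))// [leRHS]splitr lerD// ltW.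
- move=> H; apply: cauchy_cvg; apply: cauchy_exP => e e0.
  have e2 : 0 < e / 2 by rewrite divr_gt0.
  have [j /(_ j (leqnn j)) je] := inv_succ_lt e2.
  have [k Hk] := H j.
  have k0 : 0 < k.+1%:R^-1 :> R by rewrite invr_gt0.
  have [q qk] : exists q : rat, small_rat k q.
    apply: (@nbhs_rat (k.+1%:R^-1 / 2) (fun y => 0 < `|y| < k.+1%:R^-1)).
    apply: nbhs_small; rewrite gtr0_norm ?divr_gt0//.
    by rewrite ltr_pdivrMr// ltr_pMr// ltr1n.
  exists (quotient g (ratr q) x); exists k.+1%:R^-1 => //= h.
  rewrite /= ?sub0r ?normrN => hk h0; rewrite /ball/=.
  have [p [pk ph]] : exists p : rat, small_rat k p /\
      `|quotient g h x - quotient g (ratr p) x| < e / 2.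
    apply: (@nbhs_rat h (fun y => 0 < `|y| < k.+1%:R^-1 /\
      `|quotient g h x - quotient g y x| < e / 2)).
    apply: filterI; first by apply: nbhs_small; rewrite normr_gt0 h0.
    have /cvgrPdist_lt := @quotient_continuousl g h x h0 cg.
    by apply; rewrite divr_gt0.
  rewrite [X in `|X|](_ : _ = (quotient g (ratr q) x - quotient g (ratr p) x) -
    (quotient g h x - quotient g (ratr p) x)); last by ring.
  apply: le_lt_trans (ler_normB _ _) _.
  rewrite [ltRHS]splitr ler_ltD//; apply: le_trans (ltW je).
  exact: Hk.
Qed.

Lemma measurable_derivable g : continuous g ->
  measurable ([set x | derivable g x 1] : set RR).
Proof.
move=> cg.
have -> : [set x | derivable g x 1] = \bigcap_j \bigcup_k \bigcap_n
  [set x | forall p q : rat, unpickle n = Some (p, q) ->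
    small_rat k p -> small_rat k q ->
    `|quotient g (ratr p) x - quotient g (ratr q) x| <= j.+1%:R^-1].
  apply/seteqP; split => x /=.
    move=> /(derivable_rat _ cg) H j _; have [k Hk] := H j.
    by exists k => // n _ p q _; exact: Hk.
  move=> H; apply/(derivable_rat _ cg) => j; have [k _ Hk] := H j I.
  by exists k => p q; apply: (Hk (pickle (p, q)) I); rewrite pickleK.
apply: bigcapT_measurable => j; apply: bigcupT_measurable => k.
apply: bigcapT_measurable => n.
case E : (unpickle n : option (rat * rat)) => [[p q]|]; last first.
  by rewrite [X in measurable X](_ : _ = setT)//; apply/seteqP; split.
have [[pk qk]|npq] := pselect (small_rat k p /\ small_rat k q); last first.
  rewrite [X in measurable X](_ : _ = setT)//; apply/seteqP; split => // x _ p' q'.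
  by move=> [<- <-] ? ?; exfalso; apply: npq.
rewrite [X in measurable X](_ : _ = setT `&` [set x |
    `|quotient g (ratr p) x - quotient g (ratr q) x| <= j.+1%:R^-1]).
  apply: measurable_fun_le => //; apply: measurableT_comp => //.
  by apply: measurable_funB; exact: quotient_measurable.
apply/seteqP; split => [x /= H|x /= [_ H] p' q' [<- <-]//].
by split=> //; exact: H.
Qed.

Lemma cvg_quotient_inv g x : derivable g x 1 ->
  quotient g n.+1%:R^-1 x @[n --> \oo] --> derive1 g x.
Proof.
move=> /derivable_quotient; rewrite derive1_quotient => gx.
apply: (cvg_comp (fun n => n.+1%:R^-1) (quotient g ^~ x) _ gx).
move=> A /= [e /= e0 eA]; have : n.+1%:R^-1 @[n --> \oo] --> (0 : R) by exact: cvg_harmonic.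
move=> /cvgrPdist_lt /(_ _ e0); apply: filterS => n ne.
by apply: eA => //=; rewrite invr_eq0 pnatr_eq0.
Qed.

Lemma measurable_derive1 g : continuous g -> measurable_fun (setT : set RR) (derive1 g).
Proof.
move=> cg; pose D := [set x | derivable g x 1].
have mD := measurable_derivable cg.
apply: (@measurable_fun_cvg _ _ _ setT (fun n => quotient g n.+1%:R^-1 \_ D)).
  move=> n; have mq : measurable_fun (D : set RR) (quotient g n.+1%:R^-1).
    by apply: measurable_funTS; exact: quotient_measurable.
  exact: (measurable_restrictT _ mD).1 mq.
move=> x _; rewrite /patch; have [xD|xD] := boolP (x \in D).
  by apply: cvg_quotient_inv; rewrite inE in xD.
by rewrite derive1_junk; [exact: cvg_cst|move=> H; move/negP: xD; apply; rewrite inE].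
Qed.

Lemma energy_increment_continuous g M (B : R) : nondecreasing M ->
  (forall x, 0 <= M x <= B) ->
  (forall x y, x <= y -> (g y - g x) ^+ 2 <= (y - x) * (M y - M x)) ->
  continuous g.
Proof.
move=> ndM MB gM x; apply/cvgrPdist_lt => e e0.
have B0 : 0 <= B by have /andP[] := MB 0; exact: le_trans.
have d0 : 0 < e ^+ 2 / (B + 1) by rewrite divr_gt0 ?exprn_gt0// ltr_wpDl.
have key a b : a <= b -> b - a < e ^+ 2 / (B + 1) -> `|g b - g a| < e.
  move=> ab; rewrite ltr_pdivlMr ?ltr_wpDl// => abd.
  rewrite -(ger0_norm (ltW e0)) -ltr_sqr ?nnegrE// -normrX -normrX.
  rewrite [ltLHS]ger0_norm ?sqr_ge0// [ltRHS]ger0_norm ?sqr_ge0//.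
  apply: le_lt_trans (gM _ _ ab) (le_lt_trans _ abd).
  apply: ler_wpM2l; first by rewrite subr_ge0.
  have := MB a; have := MB b; lra.
exists (e ^+ 2 / (B + 1)) => // y /= xyd; have [xy|yx] := leP x y.
  by rewrite distrC; apply: key => //; move: xyd; rewrite distrC ger0_norm// subr_ge0.
by apply: key; [exact: ltW|move: xyd; rewrite ger0_norm// subr_ge0 ltW].
Qed.

Lemma lebesgue_shift (h : R) (A : set RR) : measurable A ->
  pushforward mu (fun x : RR => (h + x : RR)) A = mu A.
Proof.
move=> mA; apply/esym; move: A mA.
have mh : measurable_fun (setT : set RR) (fun x : RR => (h + x : RR)).
  by apply: measurable_funD; [exact: measurable_cst|exact: measurable_id].
apply: (@lebesgue_measure_unique R
  (measure_function_pushforward__canonical__measure_function_Measure mu mh)) => A.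
move=> [[a b] _ <-] /=.
change (mu `]a, b]%classic = mu ((fun x : RR => (h + x : RR)) @^-1` `]a, b]%classic)).
have -> : (fun x : RR => (h + x : RR)) @^-1` `]a, b]%classic = `]a - h, b - h]%classic.
  by apply/seteqP; split => x /=; rewrite !in_itv/=; lra.
rewrite !lebesgue_measure_itv/= !lte_fin ltrD2r; case: ifP => // _.
by rewrite -!EFinD; congr (_ %:E); ring.
Qed.

Lemma integral_shift (h : R) (D : set RR) (f : R -> \bar R) : measurable D ->
  measurable_fun D f -> (forall x, D x -> (0 <= f x)%E) ->
  (\int[mu]_(x in (fun x => (h + x)%R) @^-1` D) f (h + x)%R = \int[mu]_(x in D) f x)%E.
Proof.
move=> mD mf f0.
have mh : measurable_fun (setT : set RR) (fun x : RR => (h + x : RR)).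
  by apply: measurable_funD; [exact: measurable_cst|exact: measurable_id].
have := @ge0_integral_pushforward _ _ _ _ _ _ mh mu D f mD mf.
rewrite /= => <-; last by move=> x; rewrite inE => /f0.
apply: eq_measure_integral => A mA _; exact: lebesgue_shift.
Qed.

(** After translation, the interval of integration of the left-hand side exceeds
    the other one by a piece of length h on the right. *)
Lemma integral_increment M (B c d h : R) : nondecreasing M ->
  (forall x, 0 <= M x <= B) -> 0 < h -> c < d ->
  (\int[mu]_(x in `]c, d[) (M (h + x))%:E <=
   \int[mu]_(x in `]c, d[) (M x)%:E + (h * B)%:E)%E.
Proof.
move=> ndM MB h0 cd.
have mM (D : set RR) : measurable D -> measurable_fun D (fun x => (M x)%:E).
  move=> mD; apply/measurable_EFinP; exact: nondecreasing_measurable.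
have M0 x : (0 <= (M x)%:E)%E by rewrite lee_fin; have /andP[] := MB x.
rewrite [leLHS](_ : _ = (\int[mu]_(x in `](h + c)%R, (h + d)%R[) (M x)%:E)%E); last first.
  rewrite -(@integral_shift h `]h + c, h + d[%classic) => //.
    congr (integral _ _ _); apply/seteqP; split => x /=; rewrite !in_itv/=; lra.
  exact: mM.
apply: (@le_trans _ _ (\int[mu]_(x in `]c, (h + d)%R[) (M x)%:E)%E).
  apply: ge0_subset_integral => //; first exact: mM.
  by move=> x /=; rewrite !in_itv/= => /andP[hx ->]; rewrite andbT (le_lt_trans _ hx)// lerDr ltW.
have -> : `]c, h + d[%classic = `]c, d[ `|` `[d, h + d[ :> set R.
  by rewrite -itv_bndbnd_setU// bnd_simp// ltW// ltrDr.
rewrite ge0_integral_setU//=; last 2 first.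
- by apply: mM; exact: measurableU.
- apply/disj_setPS => x [] /=; rewrite !in_itv/= => /andP[_ xd] /andP[dx _].
  by move: (lt_le_trans xd dx); rewrite ltxx.
rewrite leeD2l//.
apply: (@le_trans _ _ (\int[mu]_(x in `[d, (h + d)%R[) (cst B%:E) x)%E).
  apply: ge0_le_integral => //=.
  - exact: mM.
  - by move=> x _; rewrite lee_fin; have := MB x; lra.
rewrite integral_cst//= lebesgue_measure_itv/= lte_fin ltrDr h0.
by rewrite -EFinD -EFinM lee_fin addrK mulrC.
Qed.

(** Fatou's lemma for the squared difference quotients of step h = 1 / (n + 1):
    such a square is at most (M (h + x) - M x) / h, the integral of which is at
    most B by [integral_increment]. *)
Lemma integral_derive1_le g M (B c d : R) : nondecreasing M ->
  (forall x, 0 <= M x <= B) ->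
  (forall x y, x <= y -> (g y - g x) ^+ 2 <= (y - x) * (M y - M x)) ->
  c < d -> (\int[mu]_(x in `]c, d[) ((derive1 g x) ^+ 2)%:E <= B%:E)%E.
Proof.
move=> ndM MB gM cd.
have cg := energy_increment_continuous ndM MB gM.
have mcd : measurable (`]c, d[%classic : set RR) by exact: measurable_itv.
have mM (D : set RR) : measurable D -> measurable_fun D M.
  by move=> mD; exact: nondecreasing_measurable.
have mMh (h : R) : measurable_fun (`]c, d[%classic : set RR) (fun x => M (h + x)).
  by apply: nondecreasing_measurable => // x y xy; apply: ndM; rewrite lerD2l.
have mg := measurable_derive1 cg.
have B0 : 0 <= B by have := MB 0; lra.
have BM x : M x <= B by have := MB x; lra.
have M0 x : 0 <= M x by have := MB x; lra.
pose phi n (x : RR) := ((quotient g n.+1%:R^-1 x) ^+ 2)%:E.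
have phi0 n x : (0 <= phi n x)%E by rewrite lee_fin sqr_ge0.
have mphi n : measurable_fun (`]c, d[%classic : set RR) (phi n).
  apply/measurable_EFinP; apply: measurable_funX; apply: measurable_funTS.
  exact: quotient_measurable.
have intphi n : (\int[mu]_(x in `]c, d[) phi n x <= B%:E)%E.
  pose h : R := n.+1%:R^-1; have h0 : 0 < h by rewrite invr_gt0.
  have hi0 : 0 <= h^-1 by rewrite invr_ge0 ltW.
  have M'0 x : (0 <= (h^-1 * M x)%:E)%E by rewrite lee_fin mulr_ge0.
  have mM' : measurable_fun (`]c, d[%classic : set RR) (fun x => (h^-1 * M x)%:E).
    by apply/measurable_EFinP; apply: measurable_funM; [exact: measurable_cst|exact: mM].
  have Mfin : (\int[mu]_(x in `]c, d[) (h^-1 * M x)%:E)%E \is a fin_num.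
    rewrite ge0_fin_numE; last exact: integral_ge0.
    apply: (@le_lt_trans _ _ (\int[mu]_(x in `]c, d[) (cst (h^-1 * B)%:E) x)%E).
      apply: ge0_le_integral => //=.
      by move=> x _; rewrite lee_fin ler_wpM2l.
    rewrite integral_cst//= lebesgue_measure_itv/=.
    by case: ifP => _; rewrite ?mule0 ?ltry// -EFinD -EFinM ltry.
  rewrite -(leeD2rE _ _ Mfin) -ge0_integralD//=.
  apply: (@le_trans _ _ (\int[mu]_(x in `]c, d[) (h^-1%:E * (M (h + x))%:E))%E).
    apply: ge0_le_integral => //=.
    - by move=> x _; exact: adde_ge0.
    - exact: emeasurable_funD.
    - by apply: measurable_funeM; apply/measurable_EFinP; exact: mMh.
    - move=> x _; rewrite /phi -EFinD -EFinM lee_fin -lerBrDr -mulrBr.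
      rewrite /quotient -/h exprMn expr2 -mulrA ler_wpM2l// mulrC ler_pdivrMr//.
      apply: le_trans (gM _ _ _) _; first by rewrite lerDr ltW.
      by rewrite addrK mulrC.
  rewrite ge0_integralZl//=; first last.
  - by move=> x _; rewrite lee_fin.
  - by apply/measurable_EFinP; exact: mMh.
  rewrite [X in (_ <= _ + X)%E](_ : _ = h^-1%:E * \int[mu]_(x in `]c, d[) (M x)%:E)%E; last first.
    rewrite -ge0_integralZl//=.
    - by apply/measurable_EFinP; exact: mM.
    - by move=> x _; rewrite lee_fin.
  have -> : (B%:E = h^-1%:E * (h * B)%:E)%E by rewrite -EFinM mulrA mulVf ?mul1r// gt_eqF.
  rewrite -ge0_muleDr; last 2 first.
  - by rewrite lee_fin mulr_ge0// ltW.
  - by apply: integral_ge0 => x _; rewrite lee_fin.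
  apply: lee_wpmul2l; first by rewrite lee_fin.
  by rewrite addeC; apply: (@integral_increment M B c d h) => //.
have cvgphi x : derivable g x 1 -> phi n x @[n --> \oo] --> ((derive1 g x) ^+ 2)%:E.
  move=> gx; apply: cvg_EFin; first by near=> n.
  apply: (@cvg_comp _ _ _ (fun n => quotient g n.+1%:R^-1 x) (fun y : R => y ^+ 2)).
    exact: cvg_quotient_inv.
  exact: exprn_continuous.
have phi_inf0 x : (0 <= limn_einf (phi ^~ x))%E.
  rewrite limn_einf_lim; apply: lime_ge; first exact: is_cvg_einfs.
  by near=> n; apply/ereal_infP => _ [k _ <-].
(* where g is not derivable the left-hand side is 0 by [derive1_junk] *)
apply: (@le_trans _ _ (\int[mu]_(x in `]c, d[) limn_einf (phi ^~ x))%E).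
  apply: ge0_le_integral => //=.
  - by move=> x _; rewrite lee_fin sqr_ge0.
  - by apply/measurable_EFinP; apply: measurable_funX; exact: measurable_funTS.
  - rewrite (_ : (fun x => _) = (fun x => - limn_esup (fun n => - phi n x))%E).
      apply: measurableT_comp => //; apply: measurable_fun_limn_esup => n.
      exact: measurableT_comp.
    apply/funext => x; rewrite -limn_einfN; congr limn_einf.
    by apply/funext => n /=; rewrite opprK.
  - move=> x _; have [/cvgphi gx|gx] := pselect (derivable g x 1).
      by rewrite is_cvg_limn_einfE; [rewrite (cvg_lim _ gx)|apply/cvg_ex; exists ((derive1 g x) ^+ 2)%:E].
    by rewrite derive1_junk// expr0n.
apply: le_trans; first by apply: fatou => // n x _; rewrite lee_fin sqr_ge0.
rewrite limn_einf_lim; apply: lime_le; first exact: is_cvg_einfs.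
near=> n; apply: ge_ereal_inf.
by exists (\int[mu]_(x in `]c, d[) phi n x)%E; [exists n => /=|exact: intphi].
Unshelve. all: by end_near. Qed.

End difference_quotients.

(** * Increments over non-overlapping intervals *)

Section increments.
Context {R : realType}.
Implicit Types (M N : R -> R) (L : seq (R * R)).

(** A bound of squared increments by a product of nonnegative increments is
    preserved when adjacent intervals are concatenated. *)
Lemma cauchy_schwarz2 (A B a b al be : R) : 0 <= a -> 0 <= b -> 0 <= al -> 0 <= be ->
  A ^+ 2 <= a * al -> B ^+ 2 <= b * be -> (A + B) ^+ 2 <= (a + b) * (al + be).
Proof.
move=> a0 b0 al0 be0 hA hB.
have key : 2 * (A * B) <= a * be + b * al.
  have [AB0|AB0] := leP (A * B) 0.
    have h1 := mulr_ge0 a0 be0; have h2 := mulr_ge0 b0 al0; lra.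
  rewrite -(@ler_pXn2r _ 2)// ?nnegrE; last 2 first.
  - by rewrite mulr_ge0// ltW.
  - by rewrite addr_ge0// mulr_ge0.
  have h : (A * B) ^+ 2 <= (a * be) * (b * al).
    rewrite exprMn (_ : a * be * (b * al) = (a * al) * (b * be)); last by ring.
    by apply: ler_pM => //; exact: sqr_ge0.
  have := sqr_ge0 (a * be - b * al).
  move: h; rewrite !expr2; nra.
move: key hA hB; rewrite !expr2; nra.
Qed.

Lemma cauchy_schwarz_seq (T : eqType) (L : seq T) (G a b : T -> R) :
  (forall p, p \in L -> [/\ 0 <= a p, 0 <= b p & G p ^+ 2 <= a p * b p]) ->
  (\sum_(p <- L) G p) ^+ 2 <= (\sum_(p <- L) a p) * (\sum_(p <- L) b p).
Proof.
elim: L => [|p L ih] H; first by rewrite !big_nil expr0n mulr0.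
rewrite !big_cons; have [ap bp Gp] := H p (mem_head _ _).
have H' q : q \in L -> [/\ 0 <= a q, 0 <= b q & G q ^+ 2 <= a q * b q].
  by move=> qL; apply: H; rewrite inE qL orbT.
apply: cauchy_schwarz2 => //; last exact: ih.
- by rewrite big_seq sumr_ge0// => q /H'[].
- by rewrite big_seq sumr_ge0// => q /H'[].
Qed.

(** By induction on the number of intervals: those on the right of the first one
    and those on its left are treated separately. *)
Lemma nonoverlapping_increments M (c d : R) L : {homo M : x y / x <= y} -> c <= d ->
  nonoverlapping L -> (forall p, p \in L -> c <= p.2 /\ p.1 <= d) ->
  \sum_(p <- L) (M p.1 - M p.2) <= M d - M c.
Proof.
move=> ndM; move: {2}(size L) (leqnn (size L)) => k.
elim: k L c d => [|k ih] [|p L] c d // sL cd.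
- by rewrite big_nil subr_ge0 ndM.
- by rewrite big_nil subr_ge0 ndM.
move=> /nonoverlapping_cons[pp nL /allP aL] H; rewrite big_cons.
have [cp pd] := H p (mem_head _ _).
have HL q : q \in L -> [/\ c <= q.2, q.1 <= d & q.2 <= q.1].
  move=> qL; have [] := H q; first by rewrite inE qL orbT.
  by case/andP: nL => /allP /(_ q qL).
have nf (P : pred (R * R)) : nonoverlapping [seq q <- L | P q].
  case/andP: nL => n1 n2; rewrite /nonoverlapping pairwise_filter ?andbT//.
  by apply/allP => q; rewrite mem_filter => /andP[_ /(allP n1)].
pose P1 (q : R * R) := p.1 <= q.2.
have hr : \sum_(q <- [seq q <- L | P1 q]) (M q.1 - M q.2) <= M d - M p.1.
  apply: ih => //; first by rewrite size_filter (leq_trans (count_size _ _)).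
  by move=> q; rewrite mem_filter => /andP[? /HL[]].
have hl : \sum_(q <- [seq q <- L | ~~ P1 q]) (M q.1 - M q.2) <= M p.2 - M c.
  apply: ih => //; first by rewrite size_filter (leq_trans (count_size _ _)).
  move=> q; rewrite mem_filter => /andP[/= nq qL]; have [? ? ?] := HL q qL.
  by split=> //; move: (aL q qL) nq; rewrite /P1; case: (p.1 <= q.2).
rewrite (bigID P1)/= -[X in _ + (X + _)]big_filter -[X in _ + (_ + X)]big_filter.
move: hl hr; lra.
Qed.

Lemma disjoint_intervals_ordered (A B : set R) : is_interval A -> is_interval B ->
  A `&` B = set0 ->
  (forall x y, A x -> B y -> x < y) \/ (forall x y, A x -> B y -> y < x).
Proof.
move=> iA iB; rewrite -subset0 => AB.
have [[x0 Ax0]|nA] := pselect (A !=set0); last by left=> x y Ax; exfalso; apply: nA; exists x.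
have [[y0 By0]|nB] := pselect (B !=set0); last by left=> x y _ By; exfalso; apply: nB; exists y.
have key (A' B' : set R) u v : is_interval A' -> is_interval B' ->
    (forall x, A' x -> B' x -> False) -> A' u -> B' v -> u < v ->
    forall x y, A' x -> B' y -> x < y.
  move=> iA' iB' AB' Au Bv uv x y Ax By; rewrite ltNge; apply/negP => yx.
  have [yu|uy] := leP y u.
    by apply: (AB' u Au); apply: (iB' y v) => //; rewrite yu ltW.
  by apply: (AB' y) => //; apply: (iA' u x) => //; rewrite ltW.
have [xy|yx|xy] := ltgtP x0 y0.
- by left; apply: (key A B x0 y0) => // x Ax Bx; exact: (AB x).
- right=> x y Ax By; apply: (key B A y0 x0) => // z Bz Az; exact: (AB z).
- by exfalso; apply: (AB x0); split => //; rewrite xy.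
Qed.

(** By the Cauchy-Schwarz inequality for sums, the square of the sum of the
    increments of g is at most the total length times M d - M c. *)
Lemma abs_continuous_energy (c d : R) (g M : R -> R) :
  (forall x y, c <= x -> x <= y -> y <= d -> M x <= M y) ->
  (forall x y, c <= x -> x <= y -> y <= d -> (g y - g x) ^+ 2 <= (y - x) * (M y - M x)) ->
  c <= d -> abs_continuous c d g.
Proof.
move=> ndM gM cd eps e0; pose K := M d - M c + 1.
have K0 : 0 < K by rewrite /K; have := ndM c d (lexx _) cd (lexx _); lra.
exists (eps ^+ 2 / K); first by rewrite divr_gt0// exprn_gt0.
move=> n a b ab tab; rewrite ltr_pdivlMr// => sab.
pose M' := M \o clamp c d.
have ndM' : {homo M' : x y / x <= y}.
  by move=> x y xy; apply: ndM; [have [] := clamp_in x cd|exact: clamp_le|have [] := clamp_in y cd].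
pose L := [seq (b i, a i) | i <- iota 0 n & a i < b i].
have sumL (G : nat -> R) (H : R * R -> R) : (forall i, H (b i, a i) = G i) ->
    (forall i, b i = a i -> G i = 0) -> \sum_(i < n) G i = \sum_(p <- L) H p.
  move=> HG G0; rewrite /L big_map big_filter -(big_mkord xpredT) /index_iota subn0.
  rewrite [RHS]big_mkcond/= big_seq [RHS]big_seq; apply: eq_bigr => i.
  rewrite mem_iota add0n => /andP[_ ni]; have [_ [aib _]] := ab i ni.
  case: ifPn => [_|]; first by rewrite HG.
  by rewrite -leNgt => bia; apply: G0; apply/eqP; rewrite eq_le bia.
have nL : nonoverlapping L.
  apply: (@nonoverlapping_disjoint _ (fun i => (b i, a i))).
  - by rewrite filter_uniq ?iota_uniq.
  - by move=> i; rewrite mem_filter => /andP[].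
  - move=> i j; rewrite !mem_filter !mem_iota !add0n => /andP[_ /andP[_ ni]] /andP[_ /andP[_ nj]].
    exact: (trivIsetP.1 tab).
have Lcd p : p \in L -> [/\ c <= p.2, p.2 <= p.1 & p.1 <= d].
  move=> /mapP[i + ->]/=; rewrite mem_filter mem_iota add0n => /andP[_ /andP[_ ni]].
  by have [? []] := ab i ni.
have tM : \sum_(p <- L) (M' p.1 - M' p.2) <= M d - M c.
  have -> : M d - M c = M' d - M' c by rewrite /M'/= !clamp_id.
  by apply: nonoverlapping_increments => // p /Lcd[].
rewrite (sumL (fun i => `|g (b i) - g (a i)|) (fun p => `|g p.1 - g p.2|))//; last by move=> i ->; rewrite subrr normr0.
rewrite (sumL (fun i => b i - a i) (fun p => p.1 - p.2))// in sab; last by move=> i ->; rewrite subrr.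
rewrite -(@ltr_pXn2r _ 2)// ?nnegrE ?sumr_ge0//; last exact: ltW.
apply: le_lt_trans sab.
apply: le_trans (@cauchy_schwarz_seq _ L _ (fun p => p.1 - p.2) (fun p => M' p.1 - M' p.2) _) _.
  move=> p /Lcd[cp pp pd]; rewrite !subr_ge0 pp ndM'//; split=> //.
  have cp1 := le_trans cp pp; have p2d := le_trans pp pd.
  by rewrite real_normK ?num_real// /M'/= !clamp_id//; exact: gM.
apply: ler_wpM2l; last by rewrite /K; lra.
by rewrite big_seq sumr_ge0// => p /Lcd[_ pp _]; rewrite subr_ge0.
Qed.

End increments.

(** * Change of variables along a scale function *)

Section scale_change_of_variables.
Context {R : realType}.
Local Notation mu := (@lebesgue_measure R).
Local Notation RR := (measurableTypeR R).
Variables (J : interval R) (s : scale_function J).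

Lemma scale_le x y : x \in J -> y \in J -> x <= y -> s x <= s y.
Proof.
by move=> xJ yJ; rewrite le_eqVlt => /predU1P[->//|xy]; exact/ltW/(scale_increasing s).
Qed.

Lemma scale_lt x y : x \in J -> y \in J -> (s x < s y) = (x < y).
Proof.
move=> xJ yJ; apply/idP/idP; last exact: scale_increasing.
by apply: contraTT; rewrite -!leNgt; exact: scale_le.
Qed.

Lemma itv_sub (x y : R) : x \in J -> y \in J -> `[x, y] `<=` [set` J].
Proof.
by move=> xJ yJ z; rewrite /= in_itv/=; exact: (@interval_is_interval _ J x y).
Qed.

Lemma scale_image_cc x y : x \in J -> y \in J -> x <= y ->
  s @` `[x, y] = `[s x, s y]%classic.
Proof.
move=> xJ yJ xy; have sxy := scale_le xJ yJ xy; apply/seteqP; split.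
  move=> _ [z zxy <-]; have zJ := itv_sub xJ yJ zxy.
  by move: zxy; rewrite /= !in_itv/= => /andP[xz zy]; rewrite !scale_le.
move=> t; rewrite /= in_itv/= => /andP[st ts].
have := @IVT _ s x y t xy
  (continuous_subspaceW (itv_sub xJ yJ) (@Defs.scale_continuous _ _ s)).
by rewrite min_l ?max_r// st ts => /(_ isT)[z zxy szt]; exists z.
Qed.

Lemma scale_image_oo x y : x \in J -> y \in J -> x < y ->
  s @` `]x, y[ = `]s x, s y[%classic.
Proof.
move=> xJ yJ xy; have sub := itv_sub xJ yJ; apply/seteqP; split.
  move=> _ [z zxy <-]; have zJ : z \in J by apply: sub; apply: subset_itv_oo_cc zxy.
  by move: zxy; rewrite /= !in_itv/= !scale_lt.
move=> t /= txy; have : `[s x, s y]%classic t by exact: subset_itv_oo_cc txy.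
rewrite -scale_image_cc ?ltW// => -[z zxy szt]; exists z => //.
have zJ : z \in J by exact: sub.
by move: txy; rewrite /= !in_itv/= -szt !scale_lt.
Qed.

Lemma pinv_scale x : x \in J -> pinv [set` J] s (s x) = x.
Proof.
move=> xJ; apply: (@pinvKV _ _ _ [set` J] s); last by rewrite inE.
exact: scale_inj.
Qed.

Lemma clamp_itv y z x : y \in J -> z \in J -> y <= z -> clamp y z x \in J.
Proof.
move=> yJ zJ yz; apply: (itv_sub yJ zJ); rewrite /= in_itv/=.
by have [-> ->] := clamp_in x yz.
Qed.

Lemma scale_clamp_continuous y z : y \in J -> z \in J -> y <= z ->
  continuous (s \o clamp y z).
Proof.
move=> yJ zJ yz x.
have cJ : [set` J] (clamp y z x) by exact: clamp_itv.
have : s x' @[x' --> within [set` J] (nbhs (clamp y z x))] --> s (clamp y z x).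
  by have /subspace_continuousP := @Defs.scale_continuous _ _ s; exact.
move=> sc; apply: (@cvg_comp _ _ _ (clamp y z) s _ _ _ _ sc).
move=> A /= [e /= e0 eA].
have : \forall t \near x, ball (clamp y z x) e (clamp y z t).
  by apply: (@clamp_continuous R y z x); exact: nbhsx_ballx.
by apply: filterS => t ht; apply: eA => //; exact: clamp_itv.
Qed.

Lemma scale_clamp_nondecreasing y z : y \in J -> z \in J -> y <= z ->
  nondecreasing (s \o clamp y z).
Proof.
by move=> yJ zJ yz x x' xx'; apply: scale_le; [exact: clamp_itv..|exact: clamp_le].
Qed.

(** The measure ds is the image of the Lebesgue measure under the inverse of s. *)
Lemma scale_integral_oo y z (phi : R -> \bar R) : y \in J -> z \in J -> y < z ->
  measurable_fun `]s y, s z[ phi -> (forall t, (0 <= phi t)%E) ->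
  (\int[scale_measure s]_(x in `]y, z[) phi (s x) =
   \int[mu]_(t in `]s y, s z[) phi t)%E.
Proof.
move=> yJ zJ yz mphi phi0.
pose S : RR -> RR := s \o clamp y z.
have mS : measurable_fun (setT : set RR) S.
  by apply: nondecreasing_measurable => //; apply: scale_clamp_nondecreasing => //; exact: ltW.
have Sin x : `]y, z[%classic x -> S x = s x.
  by rewrite /= in_itv/= => /andP[yx xz]; rewrite /S/= clamp_id// ltW.
have preS : S @^-1` `]s y, s z[%classic = `]y, z[%classic.
  apply/seteqP; split => x /=; last first.
    move=> xyz; have := Sin x xyz => ->; have : (s @` `]y, z[) (s x) by exists x.
    by rewrite scale_image_oo.
  rewrite !in_itv/= /S/= !scale_lt//; [|exact: clamp_itv (ltW yz)..].
  by rewrite /clamp lt_max ltxx/= lt_min yz andbT gt_max yz gt_min ltxx orbF.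
transitivity (\int[scale_measure s]_(x in S @^-1` `]s y, s z[) (phi \o S) x)%E.
  by rewrite preS; apply: eq_integral => x; rewrite inE => /Sin/= ->.
rewrite -(@ge0_integral_pushforward _ _ _ _ _ _ mS (scale_measure s)) => //.
apply: eq_measure_integral => A mA AS; rewrite /pushforward /scale_measure /=.
congr (lebesgue_measure _); apply/seteqP; split.
  move=> _ [x [/= Ax xJ] <-]; have : `]y, z[%classic x by rewrite -preS; exact: AS.
  by move=> /Sin <-.
move=> t At; have := AS t At; rewrite -scale_image_oo// => -[x xyz sxt].
exists x => //; split; first by rewrite /= Sin// sxt.
by apply: (itv_sub yJ zJ); exact: subset_itv_oo_cc xyz.
Qed.

Lemma scale_measure_subsingleton (A : set RR) : measurable A -> is_subset1 A ->
  scale_measure s A = 0%E.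
Proof.
move=> mA sA; have [[x Ax]|nA] := pselect (A !=set0); last first.
  have -> : A = set0 by apply/seteqP; split => // x Ax; apply: nA; exists x.
  exact: scale_measure0.
apply/eqP; rewrite -measure_le0 -(lebesgue_measure_set1 (s x)) /scale_measure.
apply: le_measure; rewrite ?inE//; first exact: measurable_image_scale.
by move=> _ [y [Ay _] <-]; rewrite (sA _ _ Ax Ay).
Qed.

End scale_change_of_variables.

Section interval_exhaustion.
Context {R : realType}.
Local Notation RR := (measurableTypeR R).

Fixpoint running_min (x0 : R) (e : nat -> R) k :=
  if k is k'.+1 then Num.min (running_min x0 e k') (e k') else x0.

Fixpoint running_max (x0 : R) (e : nat -> R) k :=
  if k is k'.+1 then Num.max (running_max x0 e k') (e k') else x0.

(** The bounds are running minima and maxima of an enumeration of the rational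
    points of J; only the end points of J are left out. *)
Lemma nondegenerate_exhaustion (J : interval R) : Defs.nondegenerate J ->
  exists y z : nat -> R, [/\ forall k, [/\ y k \in J, z k \in J & y k < z k],
    nondecreasing_seq (fun k => `]y k, z k[%classic),
    \bigcup_k `]y k, z k[%classic `<=` [set` J] &
    exists B1 B2 : set RR, [/\ measurable B1, measurable B2,
      is_subset1 B1, is_subset1 B2 &
      [set` J] `\` \bigcup_k `]y k, z k[%classic = B1 `|` B2]].
Proof.
move=> [x1 [x2 [x1J x2J x12]]].
pose e n := if unpickle n is Some q then if (ratr q : R) \in J then ratr q else x1 else x1.
have eJ n : e n \in J by rewrite /e; case: unpickle => // q; case: ifPn.
have eq_ (q : rat) : (ratr q : R) \in J -> exists n, e n = ratr q.
  by move=> qJ; exists (pickle q); rewrite /e pickleK qJ.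
pose y := running_min x1 e; pose z := running_max x2 e.
have yJ k : y k \in J.
  by elim: k => // k ih; rewrite /y/= /Num.min; case: ifP.
have zJ k : z k \in J.
  by elim: k => // k ih; rewrite /z/= /Num.max; case: ifP.
have yx1 k : y k <= x1 by elim: k => // k ih; rewrite /y/= ge_min ih.
have zx2 k : x2 <= z k by elim: k => // k ih; rewrite /z/= le_max ih.
have yS k : y k.+1 <= y k by rewrite /y/= ge_min lexx.
have zS k : z k <= z k.+1 by rewrite /z/= le_max lexx.
have ye k : y k.+1 <= e k by rewrite /y/= ge_min lexx orbT.
have ze k : e k <= z k.+1 by rewrite /z/= le_max lexx orbT.
have yni m n : (m <= n)%N -> y n <= y m.
  by move=> mn; rewrite -(subnK mn); elim: (n - m)%N => // i ih; rewrite addSn (le_trans (yS _)).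
have znd m n : (m <= n)%N -> z m <= z n.
  by move=> mn; rewrite -(subnK mn); elim: (n - m)%N => // i ih; rewrite addSn (le_trans ih).
have sub : \bigcup_k `]y k, z k[%classic `<=` [set` J].
  move=> x [k _] xyz; apply: (itv_sub (yJ k) (zJ k)).
  exact: subset_itv_oo_cc xyz.
exists y, z; split => //.
- move=> k; split => //; apply: le_lt_trans (yx1 k) _; exact: lt_le_trans (zx2 k).
- move=> m n mn; apply/subsetPset; apply: subset_itv; rewrite bnd_simp; [exact: yni|exact: znd].
pose B1 : set RR := [set x | x \in J /\ forall x', x' \in J -> x <= x'].
pose B2 : set RR := [set x | x \in J /\ forall x', x' \in J -> x' <= x].
have mB (B : set RR) : is_subset1 B -> measurable B.
  move=> sB; have [[x Bx]|nB] := pselect (B !=set0).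
    suff -> : B = [set x] by exact: measurable_set1.
    by apply/seteqP; split => [t /(sB _ _ Bx)->|_ ->].
  by rewrite (_ : B = set0)//; apply/seteqP; split => // x Bx; apply: nB; exists x.
have s1 : is_subset1 B1.
  by move=> a b [aJ ha] [bJ hb]; apply/eqP; rewrite eq_le ha// hb.
have s2 : is_subset1 B2.
  by move=> a b [aJ ha] [bJ hb]; apply/eqP; rewrite eq_le hb// ha.
exists B1, B2; split => //; [exact: mB|exact: mB|].
apply/seteqP; split => x /=.
- move=> [xJ nx]; have [[x' x'J x'x]|n1] := pselect (exists2 x', x' \in J & x' < x); last first.
    left; split => // x' x'J; rewrite leNgt; apply/negP => x'x.
    by apply: n1; exists x'.
  have [[x'' x''J xx'']|n2] := pselect (exists2 x', x' \in J & x < x'); last first.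
    right; split => // t tJ; rewrite leNgt; apply/negP => xt.
    by apply: n2; exists t.
  exfalso; apply: nx.
  have [q1] := rat_in_itvoo x'x; rewrite in_itv/= => /andP[q11 q12].
  have [q2] := rat_in_itvoo xx''; rewrite in_itv/= => /andP[q21 q22].
  have [n1 en1] : exists n, e n = ratr q1.
    by apply: eq_; apply: (itv_sub x'J xJ); rewrite /= in_itv/= !ltW.
  have [n2 en2] : exists n, e n = ratr q2.
    by apply: eq_; apply: (itv_sub xJ x''J); rewrite /= in_itv/= !ltW.
  exists (maxn n1 n2).+1 => //; rewrite /= in_itv/=; apply/andP; split.
    apply: le_lt_trans q12; rewrite -en1; apply: le_trans (ye n1); apply: yni.
    by rewrite ltnS leq_maxl.
  apply: lt_le_trans q21 _; rewrite -en2; apply: le_trans (ze n2) _; apply: znd.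
  by rewrite ltnS leq_maxr.
- have nlow k : [set` `]y k, z k[] x -> ~ (B1 `|` B2) x.
    rewrite /= in_itv/= => /andP[yx xz] [[_ /(_ _ (yJ k))]|[_ /(_ _ (zJ k))]].
      by rewrite leNgt yx.
    by rewrite leNgt xz.
  move=> xB; split; last by move=> [k _ /nlow].
  by case: xB => [[]|[]].
Qed.

Lemma measurable_fun_subset1 (B : set RR) (f : RR -> R) : is_subset1 B ->
  measurable_fun B f.
Proof.
move=> sB; have [[x Bx]|nB] := pselect (B !=set0).
  suff -> : B = [set x] by exact: measurable_fun_set1.
  by apply/seteqP; split => [t /(sB _ _ Bx)->|_ ->].
rewrite (_ : B = set0); first exact: measurable_fun_set0.
by apply/seteqP; split => // x Bx; apply: nB; exists x.
Qed.

Variables (J : interval R) (s : scale_function J).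
Hypothesis ndJ : Defs.nondegenerate J.

Lemma measurable_fun_itv_exhaustion (f : RR -> R) :
  (forall y z, y \in J -> z \in J -> y < z -> measurable_fun `]y, z[ f) ->
  measurable_fun [set` J] f.
Proof.
move=> H; have [y [z [yz _ sub [B1 [B2 [mB1 mB2 s1 s2 JE]]]]]] := nondegenerate_exhaustion ndJ.
have mA : measurable (\bigcup_k `]y k, z k[%classic : set RR).
  by apply: bigcupT_measurable => k; exact: measurable_itv.
rewrite -(setDUK sub) JE; apply/measurable_funU => //; first exact: measurableU.
split; last by apply/measurable_funU => //; split; exact: measurable_fun_subset1.
apply/measurable_fun_bigcup => [k|k].
  exact: measurable_itv.
by have [? ? ?] := yz k; apply: H.
Qed.

Lemma integral_itv_exhaustion (f : RR -> \bar R) (K : \bar R) :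
  measurable_fun [set` J] f -> (forall x, (0 <= f x)%E) ->
  (forall y z, y \in J -> z \in J -> y < z ->
    (\int[scale_measure s]_(x in `]y, z[) f x <= K)%E) ->
  (\int[scale_measure s]_(x in [set` J]) f x <= K)%E.
Proof.
move=> mf f0 H; have [y [z [yz nd sub [B1 [B2 [mB1 mB2 s1 s2 JE]]]]]] := nondegenerate_exhaustion ndJ.
have mA : measurable (\bigcup_k `]y k, z k[%classic : set RR).
  by apply: bigcupT_measurable => k; exact: measurable_itv.
have null : scale_measure s (B1 `|` B2) = 0%E.
  apply/eqP; rewrite -measure_le0; apply: le_trans (measureU2 _ mB1 mB2) _.
  have n1 := scale_measure_subsingleton s mB1 s1.
  have n2 := scale_measure_subsingleton s mB2 s2.
  by rewrite [X in (X + _)%E]n1 [X in (_ + X)%E]n2 adde0.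
rewrite (@ge0_negligible_integral _ _ _ _ _ (B1 `|` B2))//; last exact: measurableU.
rewrite -JE setDD setIidr//.
have mfk k : measurable_fun (`]y k, z k[%classic : set RR) f.
  by apply: measurable_funS mf => //; apply: subset_trans sub => x xk; exists k.
have cvgk := @ge0_nondecreasing_set_cvg_integral _ _ _ (fun k => `]y k, z k[%classic : set RR)
  f (scale_measure s) nd (fun k => measurable_itv _) mfk (fun _ x _ => f0 x).
rewrite -(cvg_lim _ cvgk)//; apply: lime_le; first by apply/cvg_ex; eexists; exact: cvgk.
by near=> k; have [yJ zJ yzk] := yz k; exact: H.
Unshelve. all: by end_near. Qed.

End interval_exhaustion.

(** * Functions whose increments are controlled along a scale *)

Section scale_energy.
Context {R : realType}.
Local Notation mu := (@lebesgue_measure R).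
Local Notation RR := (measurableTypeR R).

Lemma derive1_clamp (g : R -> R) (c d t : R) : t \in `]c, d[ ->
  derive1 (g \o clamp c d) t = derive1 g t.
Proof.
move=> tcd; rewrite !derive1E; apply: near_eq_derive.
have : \forall x \near t, x \in `]c, d[ by exact: near_in_itvoo.
by apply: filterS => x; rewrite in_itv/= => /andP[cx xd]; rewrite clamp_id// ltW.
Qed.

Lemma Lfun2_sqr (m : {measure set RR -> \bar R}) (f : RR -> R) :
  measurable_fun setT f -> (\int[m]_x ((f x) ^+ 2)%:E < +oo)%E ->
  f \in Lfun m 2%:E.
Proof.
move=> mf f2; rewrite inE; apply/andP; split; rewrite inE//=.
rewrite /finite_norm unlock /= poweR_lty//.
apply: le_lt_trans f2; rewrite le_eqVlt; apply/orP; left; apply/eqP.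
apply: eq_integral => x _; rewrite /= powR_mulrn ?normr_ge0//.
by rewrite real_normK ?num_real.
Qed.

Variables (J : interval R) (s : scale_function J).
Hypothesis ndJ : Defs.nondegenerate J.

Variables (v N : R -> R).
Hypothesis ndN : {homo N : x y / x <= y}.
Hypothesis vN : forall y z, y \in J -> z \in J -> y <= z ->
  (v z - v y) ^+ 2 <= (s z - s y) * (N z - N y).

Local Notation g := (v \o pinv [set` J] s).

(* N read in the scale variable, stopped at s y and s z *)
Let M y z t := N (pinv [set` J] s (clamp (s y) (s z) t)) - N y.

Let pin y z t : y \in J -> z \in J -> y <= z ->
  exists x, [/\ x \in J, y <= x, x <= z, clamp (s y) (s z) t = s x &
    pinv [set` J] s (clamp (s y) (s z) t) = x].
Proof.
move=> yJ zJ yz; have [c1 c2] := clamp_in t (scale_le s yJ zJ yz).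
have : `[s y, s z]%classic (clamp (s y) (s z) t) by rewrite /= in_itv/= c1.
rewrite -scale_image_cc// => -[x]; rewrite /= in_itv/= => /andP[yx xz] sx.
have xJ : x \in J by apply: (itv_sub yJ zJ); rewrite /= in_itv/= yx.
by exists x; split => //; rewrite -sx pinv_scale.
Qed.

Let ndM y z : y \in J -> z \in J -> y <= z -> nondecreasing (M y z).
Proof.
move=> yJ zJ yz t t' tt'; rewrite /M lerD2r.
have [x [xJ yx xz E1 ->]] := pin t yJ zJ yz; have [x' [x'J yx' x'z E2 ->]] := pin t' yJ zJ yz.
apply: ndN; have := clamp_le (s y) (s z) tt'; rewrite E1 E2.
by rewrite leNgt scale_lt// -leNgt.
Qed.

Let MB y z t : y \in J -> z \in J -> y <= z -> 0 <= M y z t <= N z - N y.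
Proof.
move=> yJ zJ yz; have [x [xJ yx xz E1 E2]] := pin t yJ zJ yz.
by rewrite /M E2 subr_ge0 lerD2r !ndN.
Qed.

Let gM y z t t' : y \in J -> z \in J -> y <= z -> t <= t' ->
  ((g \o clamp (s y) (s z)) t' - (g \o clamp (s y) (s z)) t) ^+ 2 <=
  (t' - t) * (M y z t' - M y z t).
Proof.
move=> yJ zJ yz tt'; rewrite /M /=.
have := clamp_lip (s y) (s z) tt'; have := clamp_le (s y) (s z) tt'.
have [x [xJ yx xz E1 ->]] := pin t yJ zJ yz; have [x' [x'J yx' x'z E2 ->]] := pin t' yJ zJ yz.
rewrite E1 E2 leNgt scale_lt// -leNgt => xx' sxx'.
apply: le_trans (vN xJ x'J xx') _; rewrite opprB addrA subrK.
by apply: ler_wpM2r; [rewrite subr_ge0 ndN|case/andP: sxx'].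
Qed.

Lemma scale_ac_energy : scale_ac s v.
Proof.
exists g; last by move=> x xJ /=; rewrite pinv_scale.
move=> c d cd sub.
have [y yJ syc] : (s @` [set` J]) c by apply: sub; rewrite /= in_itv/= lexx.
have [z zJ szd] : (s @` [set` J]) d by apply: sub; rewrite /= in_itv/= lexx andbT.
rewrite -{c}syc -{d}szd in cd sub *.
have yz : y <= z by rewrite leNgt -(scale_lt s)// -leNgt.
have id t : s y <= t -> t <= s z -> g t = (g \o clamp (s y) (s z)) t.
  by move=> ? ?; rewrite /= clamp_id.
apply: (@abs_continuous_energy _ _ _ _ (M y z)) => //.
  by move=> a b _ ab _; exact: ndM.
move=> a b ya ab bz; rewrite !id//; first exact: gM.
- exact: le_trans ab bz.
- exact: le_trans ya ab.
Qed.

Lemma scale_derivative_clamp y z x : y \in J -> z \in J -> x \in `]y, z[ ->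
  scale_derivative s v x = derive1 (g \o clamp (s y) (s z)) (s (clamp y z x)).
Proof.
move=> yJ zJ /[dup] xyz; rewrite in_itv/= => /andP[yx xz].
rewrite (clamp_id (ltW yx) (ltW xz)) derive1_clamp//.
have xJ : x \in J by apply: (itv_sub yJ zJ); exact: subset_itv_oo_cc xyz.
by rewrite in_itv/= !scale_lt// yx.
Qed.

Let cg y z : y \in J -> z \in J -> y <= z -> continuous (g \o clamp (s y) (s z)).
Proof.
move=> yJ zJ yz; apply: (energy_increment_continuous (ndM yJ zJ yz)).
  by move=> t; exact: MB.
by move=> t t'; exact: gM.
Qed.

Lemma scale_derivative_measurable : measurable_fun [set` J] (scale_derivative s v).
Proof.
apply: measurable_fun_itv_exhaustion => // y z yJ zJ yz.
apply: (eq_measurable_fun (derive1 (g \o clamp (s y) (s z)) \o (s \o clamp y z))).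
  by move=> x; rewrite inE => xyz; rewrite (scale_derivative_clamp yJ zJ).
apply: measurable_funTS; apply: (@measurableT_comp _ _ _ RR RR).
  by apply: measurable_derive1; exact: cg (ltW yz).
by apply: nondecreasing_measurable => //; exact: scale_clamp_nondecreasing (ltW yz).
Qed.

(** In the variable s x the inequality satisfied by v becomes the hypothesis of
    [integral_derive1_le], and the bound does not depend on the subinterval. *)
Lemma scale_derivative_energy (K : R) :
  (forall y z, y \in J -> z \in J -> y < z -> N z - N y <= K) ->
  (\int[scale_measure s]_(x in [set` J]) ((scale_derivative s v x) ^+ 2)%:E <= K%:E)%E.
Proof.
move=> NK; apply: integral_itv_exhaustion => //.
- apply/measurable_EFinP; apply: measurable_funX; exact: scale_derivative_measurable.
- by move=> x; rewrite lee_fin sqr_ge0.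
move=> y z yJ zJ yz.
pose phi t := ((derive1 (g \o clamp (s y) (s z)) t) ^+ 2)%:E.
have mphi : measurable_fun (`]s y, s z[%classic : set RR) phi.
  apply/measurable_EFinP; apply: measurable_funX; apply: measurable_funTS.
  by apply: measurable_derive1; exact: cg (ltW yz).
rewrite (_ : integral _ _ _ = \int[scale_measure s]_(x in `]y, z[) phi (s x))%E; last first.
  apply: eq_integral => x; rewrite inE => xyz; rewrite (scale_derivative_clamp yJ zJ)//.
  by move: xyz; rewrite /= in_itv/= => /andP[yx xz]; rewrite clamp_id// ltW.
rewrite scale_integral_oo//; last by move=> t; rewrite lee_fin sqr_ge0.
apply: (@le_trans _ _ (N z - N y)%:E); last by rewrite lee_fin NK.
apply: (integral_derive1_le (ndM yJ zJ (ltW yz))).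
- by move=> t; exact: MB (ltW yz).
- by move=> t t'; exact: gM (ltW yz).
- by rewrite scale_lt.
Qed.

End scale_energy.

(** * Membership in the domain of the form *)

Section compactly_supported.
Context {R : realType}.
Local Notation RR := (measurableTypeR R).

Lemma Cc_support (u : R -> R) : Cc u -> exists2 A : R, 0 < A &
  forall x, A <= `|x| -> u x = 0.
Proof.
move=> [_ /compact_bounded[M [_ HM]]].
exists (`|M| + 2); first by rewrite ltr_wpDl.
move=> x xM; apply/eqP; apply: contraT => ux.
have : `|x| <= `|M| + 1.
  apply: (HM (`|M| + 1)); first by rewrite (le_lt_trans (ler_norm _))// ltrDl.
  exact: subset_closure.
by move=> h; exfalso; move: xM h; lra.
Qed.

Lemma Cc_intro (u : R -> R) (A : R) : continuous u -> (forall x, A <= `|x| -> u x = 0) ->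
  Cc u.
Proof.
move=> cu uA; split=> //; apply: (@subclosed_compact _ _ `[- A, A]).
- exact: closed_closure.
- exact: segment_compact.
- apply: (@subset_trans _ (closure `[- A, A]%classic)).
    apply: closure_subset => x /= ux; rewrite in_itv/= -ler_norml leNgt; apply/negP => Ax.
    by move: ux; rewrite uA ?eqxx// ltW.
  have /closure_id <- // : closed (`[- A, A]%classic : set R) by exact: itv_closed.
Qed.

Lemma Cc_bounded (u : R -> R) : Cc u -> exists2 B : R, 0 < B & forall x, `|u x| <= B.
Proof.
move=> Cu; have [cu _] := Cu; have [A A0 uA] := Cc_support Cu.
have cu' : {within `[- A, A], continuous (fun x => `|u x|)}.
  apply: continuous_subspaceT => x; apply: (@continuous_comp _ _ _ u (fun y : R => `|y|)); first exact: cu.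
  exact: (@norm_continuous _ R^o).
have AA : - A <= A by rewrite ge0_cp// ltW.
have [c _ Hc] := EVT_max AA cu'.
exists (`|u c| + 1); first by rewrite ltr_wpDl.
move=> x; have [xA|Ax] := leP `|x| A.
  by apply: (@le_trans _ _ `|u c|); [apply: Hc; rewrite in_itv/= -ler_norml|rewrite lerDl].
by rewrite uA ?normr0 ?addr_ge0// ltW.
Qed.

Lemma Cc_Lfun2 (m : {measure set RR -> \bar R}) (u : R -> R) (S : set RR) :
  radon m -> Cc u -> measurable S -> u \_ S \in Lfun m 2%:E.
Proof.
move=> rm Cu mS; have [cu _] := Cu.
have [A A0 uA] := Cc_support Cu; have [B B0 uB] := Cc_bounded Cu.
have mu_ : measurable_fun (setT : set RR) u by exact: continuous_measurable_fun.
have muS : measurable_fun (setT : set RR) (u \_ S).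
  by apply: (measurable_restrictT _ mS).1; exact: measurable_funTS.
apply: Lfun2_sqr => //.
have mA : measurable (`[- A, A]%classic : set RR) by exact: measurable_itv.
have mAoo : (m `[(- A)%R, A]%classic < +oo)%E by apply: rm; exact: segment_compact.
have -> : (\int[m]_x ((u \_ S) x ^+ 2)%:E = \int[m]_(x in `[(- A)%R, A]) ((u \_ S) x ^+ 2)%:E)%E.
  rewrite [RHS]integral_mkcond; apply: eq_integral => x _.
  rewrite !patchE; case: (boolP (x \in (`[(- A)%R, A]%classic : set R))) => //.
  rewrite notin_setE /= in_itv/= -ler_norml => /negP; rewrite -ltNge => Ax.
  by rewrite (uA x (ltW Ax)) if_same expr0n.
apply: (@le_lt_trans _ _ (\int[m]_(x in `[(- A)%R, A]) (cst (B ^+ 2)%:E) x)%E).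
  apply: ge0_le_integral => //=.
  - by move=> x _; rewrite lee_fin sqr_ge0.
  - by apply/measurable_EFinP; apply: measurable_funX; exact: measurable_funTS.
  - move=> x _; rewrite lee_fin -real_normK ?num_real// lerXn2r ?nnegrE ?(ltW B0)//.
    by rewrite patchE; case: ifP => _ //; rewrite normr0 ltW.
by rewrite integral_cst// lte_mul_pinfty// lee_fin sqr_ge0.
Qed.

End compactly_supported.

Section energy_bound_def.
Context {R : realType}.
Local Notation RR := (measurableTypeR R).
Variables (D : set nat) (I : nat -> interval R) (s : forall n, scale_function (I n)).

(** The increments of N play the role of the integrals of (df/ds)^2, without any
    derivative. One N serves all the intervals, so that its total increase
    bounds the sum of their contributions. *)
Definition energy_bound (f N : R -> R) :=
  {homo N : x y / x <= y} /\
  forall n y z, D n -> y \in I n -> z \in I n -> y <= z ->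
    (f z - f y) ^+ 2 <= (s n z - s n y) * (N z - N y).

(** Disjoint intervals are ordered, so the oscillations of N over them add up to
    at most its total increase. *)
Lemma interval_increments (N : R -> R) (C : R) (k : nat) :
  effective_intervals D s -> {homo N : x y / x <= y} -> (forall x, 0 <= N x <= C) ->
  exists2 K : nat -> R,
    forall n y z, D n -> y \in I n -> z \in I n -> N z - N y <= K n &
    \sum_(0 <= n < k | n \in D) K n <= C.
Proof.
move=> [ndI tI _] ndN NC.
pose hi n := sup (N @` [set` I n]); pose lo n := inf (N @` [set` I n]).
have bd n : has_ubound (N @` [set` I n]) /\ has_lbound (N @` [set` I n]).
  by split; [exists C|exists 0] => _ [x _ <-]; have /andP[] := NC x.
have ne n : D n -> N @` [set` I n] !=set0.
  by move=> /ndI[x [y [xI _ _]]]; exists (N x), x.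
have hiU n x : D n -> x \in I n -> N x <= hi n.
  by move=> Dn xI; apply: ub_le_sup; [exact: (bd n).1|exists x].
have loL n x : D n -> x \in I n -> lo n <= N x.
  by move=> Dn xI; apply: ge_inf; [exact: (bd n).2|exists x].
exists (fun n => hi n - lo n).
  by move=> n y z Dn yI zI; apply: lerB; [exact: hiU|exact: loL].
pose L := [seq (hi n, lo n) | n <- [seq n <- index_iota 0 k | n \in D]].
have -> : \sum_(0 <= n < k | n \in D) (hi n - lo n) = \sum_(p <- L) (p.1 - p.2).
  by rewrite /L big_map big_filter.
have LD p : p \in L -> exists2 n, D n & p = (hi n, lo n).
  by move=> /mapP[n + ->]; rewrite mem_filter => /andP[/set_mem Dn _]; exists n.
have lohi n : D n -> lo n <= hi n.
  by move=> Dn; have [x [y [xI _ _]]] := ndI n Dn; apply: le_trans (loL n x Dn xI) (hiU n x Dn xI).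
have C0 : 0 <= C by have /andP[] := NC 0; exact: le_trans.
have LC p : p \in L -> 0 <= p.2 /\ p.1 <= C.
  move=> /LD[n Dn ->] /=; split.
    by apply: lb_le_inf; [exact: ne|move=> _ [x _ <-]; have /andP[] := NC x].
  by apply: ge_sup; [exact: ne|move=> _ [x _ <-]; have /andP[] := NC x].
suff nL : nonoverlapping L.
  have := @nonoverlapping_increments R (fun x => x) 0 C L (fun x y xy => xy) C0 nL LC.
  by rewrite subr0.
apply/andP; split; first by apply/allP => _ /LD[n Dn ->] /=; exact: lohi.
rewrite pairwise_map; apply/(pairwiseP 0%N) => i j; rewrite !inE => iL jL ij.
have := mem_nth 0%N iL; have := mem_nth 0%N jL.
rewrite !mem_filter /relpre/=.
set a := nth _ _ i; set b := nth _ _ j => /andP[/set_mem Db _] /andP[/set_mem Da _].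
have ab : a != b by rewrite nth_uniq ?filter_uniq ?iota_uniq// ltn_eqF.
have ab0 := (trivIsetP.1 tI) a b Da Db ab.
have key p q : D p -> D q -> (forall x y, x \in I p -> y \in I q -> x < y) -> hi p <= lo q.
  move=> Dp Dq pq; apply: ge_sup; [exact: ne|move=> _ [x xI <-]].
  apply: lb_le_inf; [exact: ne|move=> _ [y yI <-]].
  by apply: ndN; exact/ltW/pq.
have [h|h] := disjoint_intervals_ordered (@interval_is_interval _ (I a))
  (@interval_is_interval _ (I b)) ab0; apply/orP; [left|right]; apply: key => // x y xI yI; exact: h.
Qed.

Variables (m : {measure set RR -> \bar R}) (F : set (R -> R)) (E : (R -> R) -> (R -> R) -> R).
Hypotheses (rm : radon m) (eI : effective_intervals D s) (rep : represents m D s F E).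

(** The interval I n contributes to 2 E v v at most the oscillation of N over
    it, and these oscillations add up to at most C. *)
Lemma energy_bound_domain (v N : R -> R) (C : R) : Cc v -> energy_bound v N ->
  (forall x, 0 <= N x <= C) -> F v /\ E v v <= C / 2.
Proof.
move=> Cv [ndN vN] NC; have [A A0 vA] := Cc_support Cv; have [cv _] := Cv.
have v2 : v \in Lfun m 2%:E.
  by have := Cc_Lfun2 rm Cv (@measurableT _ RR); rewrite patch_setT.
have [ndI _ _] := eI.
have acv n : D n -> scale_ac (s n) v.
  by move=> Dn; apply: (scale_ac_energy ndN) => y z; exact: vN.
have mI n : measurable ([set` I n] : set RR) by exact: measurable_itv.
have mdv n : D n -> measurable_fun ([set` I n] : set RR) (scale_derivative (s n) v).
  by move=> Dn; apply: (scale_derivative_measurable (ndI n Dn) ndN) => y z; exact: vN.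
have dvK n K : D n -> (forall y z, y \in I n -> z \in I n -> y < z -> N z - N y <= K) ->
    (\int[scale_measure (s n)]_(x in [set` I n]) ((scale_derivative (s n) v x) ^+ 2)%:E <= K%:E)%E.
  by move=> Dn; apply: (scale_derivative_energy (ndI n Dn) ndN) => y z; exact: vN.
have dvC n : D n -> (\int[scale_measure (s n)]_(x in [set` I n])
    ((scale_derivative (s n) v x) ^+ 2)%:E <= C%:E)%E.
  by move=> Dn; apply: dvK => // y z _ _ _; have := NC y; have := NC z; lra.
have formE n : D n -> ((scale_form (s n) v v)%:E = 2^-1%:E *
    \int[scale_measure (s n)]_(x in [set` I n]) ((scale_derivative (s n) v x) ^+ 2)%:E)%E.
  move=> Dn; rewrite /scale_form /Rintegral EFinM fineK; first by [].
  rewrite ge0_fin_numE; last by apply: integral_ge0 => x _; rewrite lee_fin -expr2 sqr_ge0.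
  by apply: le_lt_trans (dvC n Dn) _; rewrite ltry.
have form_ge0 n : D n -> (0 <= (scale_form (s n) v v)%:E)%E.
  move=> Dn; rewrite formE// mule_ge0// ?lee_fin ?invr_ge0//.
  by apply: integral_ge0 => x _; rewrite lee_fin sqr_ge0.
have sumC : (\sum_(n <oo | n \in D) (scale_form (s n) v v)%:E <= (C / 2)%:E)%E.
  apply: lime_le.
    by apply: is_cvg_nneseries_cond => n _ /set_mem; exact: form_ge0.
  near=> k; have [K HK sK] := interval_increments k eI ndN NC.
  apply: (@le_trans _ _ (\sum_(0 <= n < k | n \in D) (2^-1 * K n)%:E)%E).
    apply: lee_sum => n /set_mem Dn; rewrite formE// EFinM lee_wpmul2l ?lee_fin ?invr_ge0//.
    by apply: dvK => // y z yI zI _; exact: HK.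
  by rewrite sumEFin lee_fin -mulr_sumr mulrC ler_wpM2r ?invr_ge0.
have dom : effective_domain m D s v.
  split => //; last by apply: le_lt_trans sumC _; rewrite ltry.
  move=> n Dn; split.
  - exact: Cc_Lfun2.
  - exact: acv.
  - apply: Lfun2_sqr; first by apply: (measurable_restrictT _ (mI n)).1; exact: mdv.
    rewrite (_ : integral _ _ _ = \int[scale_measure (s n)]_(x in [set` I n])
      ((scale_derivative (s n) v x) ^+ 2)%:E)%E; last first.
      rewrite [RHS]integral_mkcond; apply: eq_integral => x _; rewrite !patchE.
      by case: ifP => // _; rewrite expr0n.
    by apply: le_lt_trans (dvC n Dn) _; rewrite ltry.
  - move=> _ _ _; apply: cvg_near_cst; exists (- A); split; first exact: num_real.
    move=> x xA; apply: vA; rewrite ler_normr; apply/orP; right.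
    by rewrite lerNr; exact: ltW.
  - move=> _ _ _; apply: cvg_near_cst; exists A; split; first exact: num_real.
    move=> x xA; apply: vA; rewrite ler_normr; apply/orP; left.
    exact: ltW.
split; first by apply/rep.1; split => //; exists v => //; exact: ae_eq_refl.
by rewrite -lee_fin rep.2.
Unshelve. all: by end_near. Qed.

End energy_bound_def.

(** * Energy bounds for the functions of the domain *)

Section scale_fundamental_theorem.
Context {R : realType}.
Local Notation mu := (@lebesgue_measure R).
Local Notation RR := (measurableTypeR R).

Lemma eq_abs_continuous (c d : R) (g g0 : R -> R) :
  (forall t, c <= t -> t <= d -> g t = g0 t) ->
  abs_continuous c d g0 -> abs_continuous c d g.
Proof.
move=> gg0 acg eps /acg[delta d0 H]; exists delta => // n a b ab tab sab.
rewrite (eq_bigr (fun i : 'I_n => `|g0 (b i) - g0 (a i)|)); first exact: H.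
move=> i _; have [ca [aib bd]] := ab i (ltn_ord i).
by rewrite !gg0//; [exact: le_trans bd|exact: le_trans aib].
Qed.

Variables (J : interval R) (s : scale_function J) (m : {measure set RR -> \bar R}).
Variable v : R -> R.
Hypothesis acv : scale_ac s v.
Local Notation g := (v \o pinv [set` J] s).

Lemma scale_ac_pinv y z : y \in J -> z \in J -> y <= z -> abs_continuous (s y) (s z) g.
Proof.
move=> yJ zJ yz; have [g0 ac0 vg0] := acv.
have sub : `[s y, s z] `<=` s @` [set` J].
  by rewrite -scale_image_cc//; apply: image_subset; exact: itv_sub.
apply: (@eq_abs_continuous _ _ _ g0); last by apply: ac0 => //; exact: scale_le.
move=> t yt tz; have [x xJ <-] : (s @` [set` J]) t by apply: sub; rewrite /= in_itv/= yt.
by rewrite /= pinv_scale// vg0.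
Qed.

Lemma scale_ac_clamp_continuous y z : y \in J -> z \in J -> y <= z ->
  continuous (v \o clamp y z).
Proof.
move=> yJ zJ yz.
have -> : v \o clamp y z = (g \o clamp (s y) (s z)) \o (s \o clamp y z).
  apply/funext => x /=; have cJ := clamp_itv x yJ zJ yz; have [c1 c2] := clamp_in x yz.
  have e1 := scale_le s yJ cJ c1; have e2 := scale_le s cJ zJ c2.
  by rewrite [clamp (s y) _ _]clamp_id// pinv_scale.
move=> x; apply: continuous_comp; first exact: scale_clamp_continuous.
apply: list_ac_continuous; apply: abs_continuous_list_ac; first exact: scale_le.
exact: scale_ac_pinv.
Qed.

Lemma scale_cauchy_schwarz y z : y \in J -> z \in J -> y < z ->
  (((v z - v y) ^+ 2)%:E <= (s z - s y)%:E *
    \int[scale_measure s]_(x in `]y, z[) ((scale_derivative s v x) ^+ 2)%:E)%E.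
Proof.
move=> yJ zJ yz; have syz : s y < s z by rewrite scale_lt.
have acg := scale_ac_pinv yJ zJ (ltW yz).
have mg : measurable_fun (`]s y, s z[%classic : set RR) (derive1 g).
  apply: (eq_measurable_fun (derive1 (g \o clamp (s y) (s z)))).
    by move=> t; rewrite inE => tyz; rewrite derive1_clamp.
  apply: measurable_funTS; apply: measurable_derive1; apply: list_ac_continuous.
  by apply: abs_continuous_list_ac => //; exact: ltW.
have := abs_continuous_cauchy_schwarz syz acg mg.
rewrite /= !pinv_scale// => /le_trans; apply.
rewrite -(@scale_integral_oo _ J s y z (fun t => ((derive1 g t) ^+ 2)%:E))//.
- by apply/measurable_EFinP; exact: measurable_funX.
- by move=> t; rewrite lee_fin sqr_ge0.
Qed.

Hypothesis fs : full_support m.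

(** Both functions are continuous along J, and a nonempty open set is not
    negligible. *)
Lemma scale_ac_eq (u : R -> R) : Defs.nondegenerate J -> continuous u ->
  u = v %[ae m] -> {in J, u =1 v}.
Proof.
move=> [x1 [x2 [x1J x2J x12]]] cu [A [mA mA0 uvA]] x xJ; apply/eqP; apply: contraT => uvx.
have [y [z [yJ zJ yz /andP[yx xz]]]] : exists y z, [/\ y \in J, z \in J, y < z & y <= x <= z].
  have [xx1|xx1|xx1] := ltgtP x x1.
  - by exists x, x1; rewrite lexx ltW.
  - by exists x1, x; rewrite lexx ltW.
  - by exists x1, x2; rewrite xx1 lexx ltW.
pose w t := u (clamp y z t) - v (clamp y z t).
have cw : continuous w.
  move=> t; apply: cvgB; last exact: (scale_ac_clamp_continuous yJ zJ (ltW yz)).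
  by apply: (@continuous_comp _ _ _ (clamp y z) u); [exact: clamp_continuous|exact: cu].
have wx : w x != 0 by rewrite /w clamp_id// subr_eq0.
pose U := [set t | w t != 0] `&` `]y, z[%classic.
have oU : open U.
  apply: openI; last exact: interval_open.
  rewrite openE => t /= wt; exact: (@cvgr_neq0 _ R^o _ (nbhs t) _ w (w t) (cw t) wt).
have U0 : U !=set0.
  have /nbhs_ballP[e /= e0 we] : \forall t \near x, w t != 0.
    by exact: (@cvgr_neq0 _ R^o _ (nbhs x) _ w (w x) (cw x) wx).
  pose a := Num.max y (x - e); pose b := Num.min z (x + e).
  have ab : a < b.
    rewrite /a /b gt_max !lt_min yz/=; clear -yx xz e0; apply/and3P; split; lra.
  have [m1 m2] := midf_lt ab; move: m1 m2; rewrite gt_max lt_min.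
  move=> /andP[ym xem] /andP[mz mxe].
  exists ((a + b) / 2); split; last by rewrite /= in_itv/= ym.
  by apply: we; rewrite /ball/= ltr_distlC; lra.
have := fs oU U0; rewrite lt_neqAle eq_sym => /andP[/eqP mU0 _]; exfalso; apply: mU0.
apply/eqP; rewrite -measure_le0 -mA0; apply: le_measure; rewrite ?inE//.
  exact: open_measurable.
move=> t [wt]; rewrite /= in_itv/= => /andP[yt tz]; apply: uvA => /= uvt.
by move: wt; rewrite /= /w clamp_id ?ltW// uvt// subrr eqxx.
Qed.

End scale_fundamental_theorem.

Section domain_energy_bound.
Context {R : realType}.
Local Notation RR := (measurableTypeR R).
Variables (D : set nat) (I : nat -> interval R) (s : forall n, scale_function (I n)).
Variables (m : {measure set RR -> \bar R}) (F : set (R -> R)) (E : (R -> R) -> (R -> R) -> R).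
Hypotheses (fs : full_support m) (dF : dirichlet_form m F E).
Hypotheses (eI : effective_intervals D s) (rep : represents m D s F E).

(** For a representative v of u satisfying the pointwise conditions, N x is the
    sum over n of the integrals of (dv/ds_n)^2 over the part of I n on the left
    of x. The bound is the Cauchy-Schwarz inequality, and v = u on each I n. *)
Lemma domain_energy_bound (u : R -> R) : F u -> continuous u ->
  exists N, energy_bound D s u N /\ forall x, 0 <= N x <= 2 * E u u.
Proof.
move=> Fu cu; have [u2 [v vdom uv]] := (rep.1 u).1 Fu.
have [v2 vscale vsum] := vdom.
have Fv : F v by apply/rep.1; split => //; exists v => //; exact: ae_eq_refl.
have Euv : E u u = E v v.
  rewrite (df_E_ae dF Fu Fv Fu uv) (df_E_sym dF Fv Fu).
  by rewrite (df_E_ae dF Fu Fv Fv uv).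
have [ndI _ _] := eI.
have vu n x : D n -> x \in I n -> v x = u x.
  move=> Dn xI; have [_ acv _ _ _] := vscale n Dn.
  by rewrite (scale_ac_eq acv fs (ndI n Dn) cu uv).
pose phi n (x : RR) := ((scale_derivative (s n) v x) ^+ 2)%:E.
have phi0 n x : (0 <= phi n x)%E by rewrite lee_fin sqr_ge0.
have mI n : measurable ([set` I n] : set RR) by exact: measurable_itv.
have mphi n : D n -> measurable_fun ([set` I n] : set RR) (phi n).
  move=> Dn; have [_ _ dv _ _] := vscale n Dn.
  have : measurable_fun (setT : set RR) (scale_derivative (s n) v \_ [set` I n]).
    by move: dv; rewrite inE => /andP[]; rewrite inE.
  move=> /(measurable_restrictT _ (mI n)).2 mdv.
  by apply/measurable_EFinP; exact: measurable_funX.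
pose T n (A : set RR) := (\int[scale_measure (s n)]_(x in [set` I n] `&` A) phi n x)%E.
have T0 n A : (0 <= T n A)%E by exact: integral_ge0.
have mA n (A : set RR) : D n -> measurable A -> measurable_fun ([set` I n] `&` A) (phi n).
  by move=> Dn mA; apply: measurable_funS (mphi n Dn).
have Tle n (A B : set RR) : D n -> measurable A -> measurable B -> A `<=` B ->
    (T n A <= T n B)%E.
  move=> Dn mA' mB AB; apply: ge0_subset_integral => //.
  - exact: measurableI.
  - exact: measurableI.
  - exact: mA.
  - by apply: setIS.
pose S A := (\sum_(n <oo | n \in D) T n A)%E.
have ST : (S setT = (2 * E u u)%:E)%E.
  have Tform n : D n -> (T n setT = 2%:E * (scale_form (s n) v v)%:E)%E.
    move=> Dn; have [_ _ dv _ _] := vscale n Dn.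
    have ifin : (\int[scale_measure (s n)]_(x in [set` I n]) phi n x < +oo)%E.
      have := Lfun2_integrable_sqr dv => /integrableP[_]; apply: le_lt_trans.
      rewrite [leLHS]integral_mkcond le_eqVlt; apply/orP; left; apply/eqP.
      apply: eq_integral => x _ /=; rewrite !patchE.
      by case: ifP => _; rewrite ?expr0n ger0_norm ?sqr_ge0.
    rewrite /T setIT /scale_form /Rintegral EFinM fineK.
      by rewrite muleA -EFinM divff ?mul1e.
    rewrite ge0_fin_numE//; last by apply: integral_ge0 => x _; rewrite lee_fin -expr2 sqr_ge0.
  rewrite /S Euv EFinM rep.2// -nneseriesZl//; last first.
    move=> n _; rewrite lee_fin mulr_ge0 ?invr_ge0//.
    by apply: Rintegral_ge0 => x _; rewrite -expr2 sqr_ge0.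
  by apply: eq_eseriesr => n /set_mem Dn; exact: Tform.
have Sle (A B : set RR) : measurable A -> measurable B -> A `<=` B -> (S A <= S B)%E.
  by move=> mA' mB AB; apply: lee_nneseries => // n /set_mem Dn; exact: Tle.
have Sfin A : measurable A -> S A \is a fin_num.
  move=> mA'; rewrite ge0_fin_numE; last exact: nneseries_ge0.
  by apply: le_lt_trans (Sle _ _ mA' measurableT (@subsetT _ _)) _; rewrite ST ltry.
have mN x : measurable (`]-oo, x]%classic : set RR) by exact: measurable_itv.
pose N x := fine (S `]-oo, x]%classic).
have SN x : S `]-oo, x]%classic = (N x)%:E by rewrite fineK// Sfin.
exists N; split; last first.
  move=> x; apply/andP; split; first by apply: fine_ge0; exact: nneseries_ge0.
  by rewrite -lee_fin -SN -ST; exact: Sle.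
split.
  by move=> x y xy; rewrite -lee_fin -!SN; apply: Sle => //; apply: subset_itvl; rewrite bnd_simp.
move=> n y z Dn yI zI; rewrite le_eqVlt => /predU1P[->|yz].
  by rewrite !subrr expr0n mulr0.
have [_ acv _ _ _] := vscale n Dn.
have key : (T n `]y, z]%classic <= (N z - N y)%:E)%E.
  have mo : measurable (`]y, z]%classic : set RR) by exact: measurable_itv.
  have Sadd : (S `]-oo, z]%classic = S `]-oo, y]%classic + S `]y, z]%classic)%E.
    rewrite /S -nneseriesD//; apply: eq_eseriesr => k /set_mem Dk.
    rewrite /T -ge0_integral_setU//=.
    - rewrite -setIUr; congr (integral _ (_ `&` _) _).
      by rewrite -itv_bndbnd_setU// bnd_simp ltW.
    - exact: measurableI.
    - exact: measurableI.
    - by rewrite -setIUr; apply: mA => //; exact: measurableU.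
    - apply/disj_setPS => x [] [_ /=] + [_ /=]; rewrite !in_itv/= => xy /andP[yx _].
      by move: (le_lt_trans xy yx); rewrite ltxx.
  rewrite EFinB -!SN Sadd addeAC subee ?Sfin// add0e.
  apply: le_trans (nneseries_lim_ge n.+1 _); last by move=> k _ _; exact: T0.
  rewrite big_mkcond big_nat_recr//= mem_set// leeDr//.
  by apply: sume_ge0 => k _; case: ifP.
have sle : 0 <= s n z - s n y by rewrite subr_ge0 scale_le// ltW.
have moo : measurable (`]y, z[%classic : set RR) by exact: measurable_itv.
have := scale_cauchy_schwarz acv yI zI yz; rewrite (vu n z Dn zI) (vu n y Dn yI) => cs.
rewrite -lee_fin; apply: le_trans cs _; rewrite EFinM lee_wpmul2l ?lee_fin//.
apply: le_trans key; rewrite (_ : integral _ _ _ = T n `]y, z[%classic); last first.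
  rewrite /T (_ : [set` I n] `&` _ = `]y, z[%classic)//; apply/setIidPr => x xyz.
  by apply: (itv_sub yI zI); exact: subset_itv_oo_cc xyz.
by apply: Tle => //; apply: subset_itvl; rewrite bnd_simp.
Qed.

End domain_energy_bound.

(** * Smooth functions *)

Section smooth_functions.
Context {R : realType}.
Implicit Types (f g : R -> R) (Q : set (R -> R)).

(** An inductive wrapper, so that a goal about smoothness is not unfolded into
    the derivability of the iterated derivatives. *)
Variant smooth f : Prop :=
  Smooth of (forall n x, derivable (f^`(n))%classic x 1).

Definition differentiation_closed Q :=
  forall f, Q f -> exists2 f', Q f' & forall x, is_derive x (1 : R) f (f' x).

(** Smoothness is the largest property stable under differentiation; a class
    containing f and a derivative of each of its members dispenses with
    computing iterated derivatives. *)
Lemma smooth_coind Q f : differentiation_closed Q -> Q f -> smooth f.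
Proof.
move=> cQ Qf; constructor=> n; suff : Q (f^`(n))%classic by move=> /cQ[f' _ H] x; have [] := H x.
elim: n => // n /cQ[f' Qf' H].
rewrite derive1nS (_ : (f^`(n))^`()%classic = f')//.
by apply/funext => x; rewrite derive1E; have [] := H x.
Qed.

Lemma smooth_derivable f x : smooth f -> derivable f x 1.
Proof. by move=> [/(_ 0%N x)]. Qed.

Lemma smooth_is_derive f x : smooth f -> is_derive x (1 : R) f (derive1 f x).
Proof. by move=> sf; rewrite derive1E; apply/derivableP/smooth_derivable. Qed.

Lemma smooth_derive1 f : smooth f -> smooth (derive1 f).
Proof. by move=> [sf]; constructor=> n x; have := sf n.+1 x; rewrite derive1Sn. Qed.

Lemma smooth_continuous f : smooth f -> continuous f.
Proof.
by move=> sf x; apply/differentiable_continuous/derivable1_diffP/smooth_derivable.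
Qed.

Lemma smooth_primitive f g : smooth g -> (forall x, is_derive x (1 : R) f (g x)) -> smooth f.
Proof.
move=> sg fg; apply: (@smooth_coind [set h | smooth h \/ h = f]); last by right.
move=> h [sh|->]; last by exists g => //; left.
exists (derive1 h); first by left; exact: smooth_derive1.
by move=> x; exact: smooth_is_derive.
Qed.

(** By the Leibniz and chain rules this class is stable under differentiation,
    which the class of products or of composites alone is not. *)
Inductive smooth_closure : (R -> R) -> Prop :=
| closure_base f : smooth f -> smooth_closure f
| closure_add f g : smooth_closure f -> smooth_closure g -> smooth_closure (f \+ g)
| closure_mul f g : smooth_closure f -> smooth_closure g -> smooth_closure (f \* g)
| closure_comp f g : smooth f -> smooth g -> smooth_closure (f \o g).

Lemma smooth_closure_smooth f : smooth_closure f -> smooth f.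
Proof.
apply: (@smooth_coind [set f | smooth_closure f]) => {}f /=; elim=> {f}.
- move=> f sf; exists (derive1 f); first by apply: closure_base; exact: smooth_derive1.
  by move=> x; exact: smooth_is_derive.
- move=> f g cf [f' cf' ff'] cg [g' cg' gg'].
  by exists (f' \+ g'); [exact: closure_add|move=> x; exact: is_deriveD].
- move=> f g cf [f' cf' ff'] cg [g' cg' gg'].
  exists (f \* g' \+ g \* f'); first by apply: closure_add; exact: closure_mul.
  by move=> x; exact: is_deriveM.
- move=> f g sf sg; exists ((derive1 f \o g) \* derive1 g).
    apply: closure_mul; first by apply: closure_comp => //; exact: smooth_derive1.
    by apply: closure_base; exact: smooth_derive1.
  by move=> x; apply: is_derive1_comp; exact: smooth_is_derive.
Qed.

Lemma smoothD f g : smooth f -> smooth g -> smooth (f \+ g).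
Proof. by move=> sf sg; apply/smooth_closure_smooth/closure_add; exact: closure_base. Qed.

Lemma smoothM f g : smooth f -> smooth g -> smooth (f \* g).
Proof. by move=> sf sg; apply/smooth_closure_smooth/closure_mul; exact: closure_base. Qed.

Lemma smooth_comp f g : smooth f -> smooth g -> smooth (f \o g).
Proof. by move=> sf sg; apply/smooth_closure_smooth/closure_comp. Qed.

Lemma smooth_cst (c : R) : smooth (cst c).
Proof.
apply: (@smooth_coind [set f | exists c, f = cst c]); last by exists c.
by move=> _ [c' ->]; exists (cst 0); [exists 0|move=> x; exact: is_derive_cst].
Qed.

Lemma smooth_id : smooth (fun x => x).
Proof.
by apply: (@smooth_primitive _ (cst 1) (@smooth_cst 1)) => x; exact: is_derive_id.
Qed.

Lemma smooth_affine (a b : R) : smooth (fun x => a * x + b).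
Proof.
apply: (@smoothD (fun x => a * x) (cst b)); last exact: smooth_cst.
by apply: (@smoothM (cst a) (fun x => x)); [exact: smooth_cst|exact: smooth_id].
Qed.

Lemma smooth_sum (n : nat) (h : nat -> R -> R) : (forall i, smooth (h i)) ->
  smooth (fun x => \sum_(i < n) h i x).
Proof.
move=> sh; elim: n => [|n ih].
  rewrite (_ : (fun _ => _) = cst 0); first exact: smooth_cst.
  by apply/funext => x; rewrite big_ord0.
rewrite (_ : (fun _ => _) = (fun x => \sum_(i < n) h i x) \+ h n).
  exact: smoothD.
by apply/funext => x; rewrite big_ord_recr.
Qed.

Lemma derive_bounds f f' (a b x y : R) : (forall t, is_derive t (1 : R) f (f' t)) ->
  (forall t, x <= t -> t <= y -> a <= f' t <= b) -> x <= y ->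
  a * (y - x) <= f y - f x <= b * (y - x).
Proof.
move=> df f'ab xy.
have cf : {within `[x, y], continuous f}.
  apply: continuous_subspaceT => t; apply/differentiable_continuous/derivable1_diffP.
  by have [] := df t.
have [c + ->] := MVT_segment xy (fun t _ => df t) cf.
rewrite in_itv/= => /andP[xc cy]; have /andP[h1 h2] := f'ab c xc cy.
by rewrite !ler_wpM2r ?subr_ge0.
Qed.

End smooth_functions.

Section flat_function.
Context {R : realType}.

(** The derivatives of exp (- 1 / x), extended by 0 to x <= 0, all have this
    form, with various polynomials p. *)
Definition flat_function (p : {poly R}) (x : R) : R :=
  if 0 < x then p.[x^-1] * expR (- x^-1) else 0.

Lemma expR_ge_pow (n : nat) (y : R) : 0 <= y -> (y / n.+1%:R) ^+ n.+1 <= expR y.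
Proof.
move=> y0; have n0 : 0 < n.+1%:R :> R by [].
have -> : expR y = expR (y / n.+1%:R) ^+ n.+1.
  by rewrite -expRM_natl mulrC divfK// gt_eqF.
apply: lerXn2r; rewrite ?nnegrE ?divr_ge0 ?expR_ge0//.
by apply: le_trans (expR_ge1Dx _); rewrite lerDr.
Qed.

Lemma poly_bound (p : {poly R}) : exists2 B : R, 0 <= B & forall y, 1 <= y ->
  `|p.[y]| <= B * y ^+ (size p).
Proof.
exists (\sum_(i < size p) `|p`_i|); first exact: sumr_ge0.
move=> y y1; rewrite horner_coef mulr_suml; apply: le_trans (ler_norm_sum _ _ _) _.
apply: ler_sum => i _; rewrite normrM ler_wpM2l// normrX ger0_norm ?(le_trans _ y1)//.
by apply: ler_weXn2l => //; exact: ltnW.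
Qed.

(** The exponential dominates all powers; vanishing to second order at 0 gives
    the derivative 0 there. *)
Lemma flat_function_small (p : {poly R}) : exists2 C : R, 0 <= C &
  forall x, 0 < x -> x <= 1 -> `|flat_function p x| <= C * x ^+ 2.
Proof.
have [B B0 HB] := poly_bound p; pose n := (size p).+1.
exists (B * n.+1%:R ^+ n.+1); first by rewrite mulr_ge0// exprn_ge0.
move=> x x0 x1; rewrite /flat_function x0 normrM.
have y1 : 1 <= x^-1 by rewrite invf_ge1.
have y0 : 0 < x^-1 by rewrite invr_gt0.
have e1 := expR_ge_pow n (ltW y0).
have n0 : 0 < n.+1%:R :> R by [].
rewrite [`|expR _|]ger0_norm ?expR_ge0// expRN.
apply: (@le_trans _ _ (B * x^-1 ^+ size p * (x^-1 / n.+1%:R) ^- n.+1)).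
  apply: ler_pM; rewrite ?normr_ge0 ?invr_ge0 ?expR_ge0//; [exact: HB|].
  by rewrite lef_pV2// posrE ?expR_gt0// exprn_gt0// divr_gt0.
have -> : (x^-1 / n.+1%:R) ^- n.+1 = x ^+ n.+1 * n.+1%:R ^+ n.+1.
  by rewrite -invfM exprVn invrK exprMn.
have -> : x ^+ n.+1 = x ^+ size p * x ^+ 2 by rewrite -exprD addn2.
rewrite exprVn le_eqVlt; apply/orP; left; apply/eqP.
have xp : x ^+ size p != 0 by rewrite expf_neq0// gt_eqF.
by field.
Qed.

Lemma flat_function_derive (p : {poly R}) (x : R) :
  is_derive x (1 : R) (flat_function p) (flat_function ((p - p^`()) * 'X ^+ 2) x).
Proof.
have [x0|x0|->] := ltgtP x 0.
- have -> : flat_function ((p - p^`()) * 'X ^+ 2) x = 0 by rewrite /flat_function ltNge ltW.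
  have d0 := is_derive_cst (0 : R) x (1 : R).
  apply: (near_eq_is_derive _ d0).
  near=> y; rewrite /flat_function ltNge ltW//.
  by near: y; exact: lt_nbhsl.
- have -> : flat_function ((p - p^`()) * 'X ^+ 2) x =
     (p^`().[x^-1] * (- x ^- 2)) * expR (- x^-1) + p.[x^-1] * (expR (- x^-1) * x ^- 2).
    rewrite /flat_function x0 hornerM hornerXn hornerD hornerN -exprVn; ring.
  have dV : is_derive x (1 : R) (fun y => y^-1) (- x ^- 2).
    have := @is_deriveV _ (fun y => y) x 1 1; rewrite gt_eqF// => /(_ isT (is_derive_id _ _)).
    by rewrite [_ *: _]mulr1.
  have dP : is_derive x (1 : R) (fun y => p.[y^-1]) (p^`().[x^-1] * (- x ^- 2)).
    exact: (@is_derive1_comp _ (horner p) (fun y => y^-1) x _ _ (is_derive_poly p x^-1) dV).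
  have dE : is_derive x (1 : R) (fun y => expR (- y^-1)) (expR (- x^-1) * x ^- 2).
    have dN : is_derive x (1 : R) (fun y => - y^-1) (x ^- 2).
      by have := is_deriveN dV; rewrite opprK.
    exact: (@is_derive1_comp _ expR (fun y => - y^-1) x _ _ (is_derive_expR _) dN).
  have dPE : is_derive x (1 : R) (fun y => p.[y^-1] * expR (- y^-1))
     (p^`().[x^-1] * (- x ^- 2) * expR (- x^-1) + p.[x^-1] * (expR (- x^-1) * x ^- 2)).
    apply: (is_derive_eq (is_deriveM dP dE)).
    change (p.[x^-1] * (expR (- x^-1) * x ^- 2) + expR (- x^-1) * (p^`().[x^-1] * (- x ^- 2)) =
      p^`().[x^-1] * (- x ^- 2) * expR (- x^-1) + p.[x^-1] * (expR (- x^-1) * x ^- 2)).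
    by rewrite addrC [X in X + _]mulrC.
  apply: (near_eq_is_derive _ dPE).
  near=> y; rewrite /flat_function ifT//.
  by near: y; exact: lt_nbhsr.
- have [C C0 HC] := flat_function_small p.
  have f0 q : flat_function q 0 = 0 by rewrite /flat_function ltxx.
  have cv : (fun h : R => h^-1 *: ((flat_function p \o shift 0) (h *: (1 : R)) -
      flat_function p 0)) @ 0^' --> (0 : R).
    apply/cvgrPdist_lt => e e0; near=> h.
    have h0 : h != 0 by near: h; exact: nbhs_dnbhs_neq.
    have he : `|h| < e / (C + 1).
      near: h; apply: dnbhs0_lt; rewrite divr_gt0// ltr_wpDl//.
    have h1 : `|h| < 1 by near: h; exact: dnbhs0_lt.
    rewrite sub0r normrN /= f0 subr0 addr0 [h *: 1]mulr1 normrM normfV.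
    rewrite ltr_pdivrMl ?normr_gt0//.
    have [hpos|hneg] := ltP 0 h; last first.
      by rewrite /flat_function [0 < h]ltNge hneg/= normr0 mulr_gt0// normr_gt0.
    have habs : `|h| = h by exact: gtr0_norm.
    rewrite habs in h1 he *.
    apply: le_lt_trans (HC _ hpos (ltW h1)) _.
    rewrite expr2 mulrCA ltr_pM2l//.
    move: he; rewrite ltr_pdivlMr ?ltr_wpDl// mulrC; apply: le_lt_trans.
    by rewrite mulrDl mul1r lerDl ltW.
  rewrite f0; apply: DeriveDef; last exact: cvg_lim.
  by apply/cvg_ex; exists 0.
Unshelve. all: by end_near. Qed.

Lemma flat_function_smooth (p : {poly R}) : smooth (flat_function p).
Proof.
apply: (@smooth_coind _ [set f | exists p, f = flat_function p]); last by exists p.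
move=> _ [q ->]; exists (flat_function ((q - q^`()) * 'X ^+ 2)).
  by exists ((q - q^`()) * 'X ^+ 2).
by move=> x; exact: flat_function_derive.
Qed.

End flat_function.

(** * Smooth steps and truncations *)

Section smooth_step.
Context {R : realType}.
Local Notation mu := (@lebesgue_measure R).

Lemma smooth_has_primitive (b : R -> R) (a : R) : smooth b ->
  (forall x, x <= a -> b x = 0) ->
  exists P : R -> R, [/\ smooth P, forall x, is_derive x (1 : R) P (b x) &
    forall x, x <= a -> P x = 0].
Proof.
move=> sb b0; have cb := smooth_continuous sb.
pose P x := \int[mu]_(t in `[a - 1, x]) b t.
have P0 x : x <= a -> P x = 0.
  move=> xa; rewrite /P (@eq_Rintegral _ _ _ _ _ (cst 0)).
    by rewrite Rintegral_cst//= mul0r.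
  move=> t; rewrite inE /= in_itv/= => /andP[_ tx]; rewrite b0//.
  exact: le_trans xa.
have dP x : is_derive x (1 : R) P (b x).
  have [ax|xa] := ltP (a - 1) x; last first.
    have d0 := is_derive_cst (0 : R) x (1 : R).
    rewrite b0; last by rewrite (le_trans xa)// gerBl.
    apply: (near_eq_is_derive _ d0); near=> y; rewrite P0//; apply: ltW.
    by near: y; apply: lt_nbhsl; rewrite (le_lt_trans xa)// ltrBlDr ltrDl.
  have ib : mu.-integrable `[a - 1, x + 1] (EFin \o b).
    apply: continuous_compact_integrable; first exact: segment_compact.
    by apply: continuous_subspaceT => t; exact: cb.
  have xx1 : x < x + 1 by rewrite ltrDl.
  have [dPx PE] := @continuous_FTC1_closed _ b (a - 1) x (x + 1) xx1 ib ax (cb x).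
  by apply: DeriveDef; [exact: dPx|rewrite -derive1E; exact: PE].
exists P; split => //; exact: smooth_primitive sb dP.
Unshelve. all: by end_near. Qed.

(** The normalized primitive of exp (- 1 / x) exp (- 1 / (1 - x)), a bump
    supported in [0, 1] with values in [0, 1]. *)
Lemma smooth_step : exists (S : R -> R) (A : R), [/\ smooth S, 0 < A,
  forall x, x <= 0 -> S x = 0, forall x, 1 <= x -> S x = 1 &
  forall x y, x <= y -> 0 <= S y - S x <= A * (y - x)].
Proof.
pose e : R -> R := flat_function 1.
have se : smooth e by exact: flat_function_smooth.
have eE x : e x = if 0 < x then expR (- x^-1) else 0.
  by rewrite /e /flat_function hornerC mul1r.
have e0 x : x <= 0 -> e x = 0 by move=> x0; rewrite eE ltNge x0.
have epos x : 0 < x -> 0 < e x by move=> x0; rewrite eE x0 expR_gt0.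
have ege x : 0 <= e x.
  by have [x0|x0] := ltP 0 x; [exact/ltW/epos|rewrite e0].
have e1 x : e x <= 1.
  rewrite eE; case: ifPn => // x0.
  by rewrite -[leRHS]expR0 ler_expR oppr_le0 invr_ge0 ltW.
pose b x := e x * e (- 1 * x + 1).
have sb : smooth b.
  by apply: smoothM => //; apply: (@smooth_comp _ e); [exact: se|exact: smooth_affine].
have b0 x : x <= 0 -> b x = 0 by move=> x0; rewrite /b e0 ?mul0r.
have b1 x : 1 <= x -> b x = 0 by move=> x1; rewrite /b [X in _ * X]e0 ?mulr0//; lra.
have bge x : 0 <= b x by rewrite mulr_ge0.
have ble x : b x <= 1 by rewrite mulr_ile1.
have [P [sP dP P0]] := smooth_has_primitive sb b0.
have bnd x y : x <= y -> 0 * (y - x) <= P y - P x <= 1 * (y - x).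
  by move=> xy; apply: (derive_bounds dP) => // t _ _; rewrite bge ble.
have P1 : 0 < P 1.
  rewrite lt_neqAle eq_sym; apply/andP; split; last first.
    by have := bnd 0 1 ler01; rewrite (P0 0)// mul0r subr0 => /andP[].
  apply/eqP => P10.
  have Pz t : 0 <= t -> t <= 1 -> P t = 0.
    move=> t0 t1; have := bnd 0 t t0; have := bnd t 1 t1; rewrite (P0 0)// P10; lra.
  have h12 : 0 < 2^-1 :> R by rewrite invr_gt0.
  have dz : is_derive (2^-1 : R) (1 : R) P 0.
    have d0 := is_derive_cst (0 : R) (2^-1 : R) (1 : R).
    apply: (near_eq_is_derive _ d0).
    have : \forall y \near (2^-1 : R), y \in `]0, 1[.
      by apply: near_in_itvoo; rewrite in_itv/= h12 invf_lt1// ltr1n.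
    by apply: filterS => y; rewrite in_itv/= => /andP[y0 y1]; rewrite Pz// ltW.
  have [_ bz] := dP (2^-1 : R); have [_] := dz; rewrite bz => b20.
  have : 0 < b (2^-1 : R) by rewrite /b mulr_gt0// epos//; lra.
  by rewrite b20 ltxx.
exists (fun x => (P 1)^-1 * P x), (P 1)^-1; split.
- exact: (@smoothM _ (cst (P 1)^-1) P (@smooth_cst _ _) sP).
- by rewrite invr_gt0.
- by move=> x x0; rewrite (P0 x x0) mulr0.
- move=> x x1; rewrite (_ : P x = P 1) ?mulVf ?gt_eqF//.
  have : 0 * (x - 1) <= P x - P 1 <= 0 * (x - 1).
    by apply: (derive_bounds dP) => // t t1 _; rewrite b1// lexx.
  by rewrite mul0r; lra.
- move=> x y xy; have := bnd x y xy; rewrite mul0r mul1r => /andP[h1 h2].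
  rewrite -mulrBr mulr_ge0 ?invr_ge0 ?(ltW P1)//=.
  by rewrite ler_pM2l// invr_gt0.
Qed.

(** A primitive of a smooth function with values in [0, 1], equal to 1 on [0, 1]
    and to 0 outside [- eps, 1 + eps]. *)
Lemma smooth_contraction (eps : R) : 0 < eps -> exists phi : R -> R,
  [/\ smooth phi, forall t, - eps <= phi t <= 1 + eps,
      forall t, 0 <= t <= 1 -> phi t = t &
      forall t t', t < t' -> 0 <= phi t' - phi t <= t' - t].
Proof.
move=> eps0; have [S [A [sS A0 S0 S1 Sinc]]] := smooth_step.
have S01 x : 0 <= S x <= 1.
  have [x0|x0] := leP x 0; first by rewrite S0// lexx ler01.
  have [x1|x1] := leP 1 x; first by rewrite S1// lexx ler01.
  have := Sinc 0 x (ltW x0); have := Sinc x 1 (ltW x1); rewrite (S0 0)// (S1 1)//; lra.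
(* eta is the derivative of the function sought: 1 on [0, 1], and 0 outside
   [- eps, 1 + eps] *)
pose eta x := S (eps^-1 * x + 1) * S (- eps^-1 * x + (1 + eps^-1)).
have seta : smooth eta.
  apply: (@smoothM _ (S \o (fun x => eps^-1 * x + 1)) (S \o (fun x => - eps^-1 * x + (1 + eps^-1)))).
    by apply: smooth_comp => //; exact: smooth_affine.
  by apply: smooth_comp => //; exact: smooth_affine.
have ei : 0 < eps^-1 by rewrite invr_gt0.
have ee : eps^-1 * eps = 1 by rewrite mulVf// gt_eqF.
have eta0 x : x <= - eps -> eta x = 0.
  move=> xe; rewrite /eta S0 ?mul0r//.
  by rewrite -lerBrDr sub0r -ee -mulrN ler_pM2l.
have eta1 x : 1 + eps <= x -> eta x = 0.
  move=> xe; rewrite /eta [X in _ * X]S0 ?mulr0//.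
  have : eps^-1 * (1 + eps) <= eps^-1 * x by rewrite ler_pM2l.
  by rewrite mulrDr ee mulr1; lra.
have eta01 x : 0 <= x -> x <= 1 -> eta x = 1.
  move=> x0 x1; rewrite /eta !S1 ?mulr1//.
    have : eps^-1 * x <= eps^-1 * 1 by rewrite ler_pM2l.
    by rewrite mulr1; lra.
  by rewrite lerDr mulr_ge0// ltW.
have etab x : 0 <= eta x <= 1.
  have /andP[a1 a2] := S01 (eps^-1 * x + 1).
  have /andP[b1 b2] := S01 (- eps^-1 * x + (1 + eps^-1)).
  by rewrite mulr_ge0//= mulr_ile1.
have [P [sP dP P0]] := smooth_has_primitive seta eta0.
have bnd x y : x <= y -> 0 * (y - x) <= P y - P x <= 1 * (y - x).
  by move=> xy; apply: (derive_bounds dP) => // t _ _; exact: etab.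
have Pm x y : x <= y -> 0 <= P y - P x <= y - x.
  by move=> /bnd; rewrite mul0r mul1r.
have Pe : P (- eps) = 0 by rewrite P0.
exists (fun x => P x + - P 0); split.
- by apply: (@smoothD _ P (cst (- P 0))) => //; exact: smooth_cst.
- move=> t; have h0 := Pm (- eps) 0 (ltac:(lra)).
  have h1 : P 1 - P 0 <= 1 by have := Pm 0 1 ler01; rewrite subr0 => /andP[].
  have h2 := Pm 1 (1 + eps) (ltac:(lra)).
  have h3 : P t <= P (1 + eps).
    have [t1|t1] := leP t (1 + eps); first by have := Pm t (1 + eps) t1; lra.
    have : 0 * (t - (1 + eps)) <= P t - P (1 + eps) <= 0 * (t - (1 + eps)).
      apply: (derive_bounds dP); last exact: ltW.
      by move=> x x1 _; rewrite eta1// lexx.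
    by rewrite mul0r; lra.
  have h4 : 0 <= P t.
    have [t1|t1] := leP t (- eps); first by rewrite P0.
    by have := Pm (- eps) t (ltW t1); rewrite Pe; lra.
  by move: h0 h1 h2; rewrite Pe; lra.
- move=> t /andP[t0 t1].
  have : 1 * (t - 0) <= P t - P 0 <= 1 * (t - 0).
    apply: (derive_bounds dP) => // x x0 xt.
    by rewrite eta01// ?lexx//; exact: le_trans t1.
  by rewrite subr0 mul1r; lra.
- by move=> t t' /ltW /Pm; rewrite opprD addrACA subrr addr0.
Qed.

End smooth_step.

Section smooth_compact_support.
Context {R : realType}.
Implicit Types (phi : R -> R) (U K : set R).

Lemma Cc_smooth_intro U phi K : smooth phi -> compact K -> K `<=` U ->
  (forall x, ~ K x -> phi x = 0) -> Cc_smooth U phi.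
Proof.
move=> sphi cK KU phi0.
have clK : closure [set x | phi x != 0] `<=` K.
  have /closure_id -> : closed K by exact: compact_closed (@Rhausdorff R) cK.
  apply: closure_subset => x /= px; apply: contrapT => nK.
  by move: px; rewrite phi0// eqxx.
split; [by case: sphi| |exact: subset_trans KU].
by apply: (subclosed_compact _ cK clK); exact: closed_closure.
Qed.

Lemma Cc_smooth_elim U phi : Cc_smooth U phi ->
  exists K, [/\ smooth phi, compact K, K `<=` U & forall x, ~ K x -> phi x = 0].
Proof.
move=> [sphi cphi phiU]; exists (closure [set x | phi x != 0]); split => //.
move=> x nx; apply/eqP; apply: contraT => px; exfalso; apply: nx.
exact: subset_closure.
Qed.

Lemma Cc_smooth_lin U (a : R) phi psi : Cc_smooth U phi -> Cc_smooth U psi ->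
  Cc_smooth U (fun x => a * phi x + psi x).
Proof.
move=> /Cc_smooth_elim[K [sphi cK KU phi0]] /Cc_smooth_elim[L [spsi cL LU psi0]].
apply: (@Cc_smooth_intro _ _ (K `|` L)).
- apply: (@smoothD _ (fun x => a * phi x) psi) => //.
  by apply: (@smoothM _ (cst a) phi) => //; exact: smooth_cst.
- exact: compactU.
- by move=> x [/KU|/LU].
- move=> x nKL; rewrite phi0 ?psi0 ?mulr0 ?addr0// => h; apply: nKL; [right|left]; exact: h.
Qed.

Lemma Cc_smooth_mul U phi psi : Cc_smooth U phi -> Cc_smooth U psi ->
  Cc_smooth U (phi \* psi).
Proof.
move=> /Cc_smooth_elim[K [sphi cK KU phi0]] /Cc_smooth_elim[L [spsi cL LU psi0]].
apply: (@Cc_smooth_intro _ _ K) => //; first exact: smoothM.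
by move=> x nK; rewrite /= phi0// mul0r.
Qed.

Lemma Cc_smooth_comp U phi psi : smooth psi -> psi 0 = 0 -> Cc_smooth U phi ->
  Cc_smooth U (psi \o phi).
Proof.
move=> spsi psi0 /Cc_smooth_elim[K [sphi cK KU phi0]].
apply: (@Cc_smooth_intro _ _ K) => //; first exact: smooth_comp.
by move=> x nK; rewrite /= phi0.
Qed.

(** The derivative is continuous and vanishes outside a compact set, hence is
    bounded. *)
Lemma Cc_smooth_lipschitz U phi : Cc_smooth U phi -> exists2 C : R, 0 < C &
  forall x y, x <= y -> `|phi y - phi x| <= C * (y - x).
Proof.
move=> /Cc_smooth_elim[K [sphi cK KU phi0]].
have cd : continuous (derive1 phi) by apply: smooth_continuous; exact: smooth_derive1.
have [M [_ HM]] := compact_bounded cK.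
pose A := `|M| + 1.
have KA x : K x -> `|x| <= A.
  by apply: (HM A); rewrite /A (le_lt_trans (ler_norm _))// ltrDl.
have A0 : 0 < A by rewrite /A ltr_wpDl.
have AA : - A <= A by lra.
have cn : {within `[- A, A], continuous (fun x => `|derive1 phi x|)}.
  apply: continuous_subspaceT => x.
  apply: (@continuous_comp _ _ _ (derive1 phi) (fun y : R => `|y|)); first exact: cd.
  exact: (@norm_continuous _ R^o).
have [c _ Hc] := EVT_max AA cn.
pose C := `|derive1 phi c| + 1.
have dout x : A < `|x| -> derive1 phi x = 0.
  move=> Ax; rewrite derive1E.
  have d0 := is_derive_cst (0 : R) x (1 : R).
  suff : is_derive x (1 : R) phi 0 by case.
  apply: (near_eq_is_derive _ d0).
  have Anear : \forall y \near `|x|, A < y by exact: lt_nbhsr.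
  have := @norm_continuous _ R^o x _ Anear => Hn.
  near=> y; have Ay : A < `|y| by near: y; exact: Hn.
  by rewrite phi0// => /KA; rewrite leNgt Ay.
have dC x : `|derive1 phi x| <= C.
  have [xA|Ax] := leP `|x| A; last by rewrite dout// normr0 addr_ge0.
  by apply: le_trans (Hc x _) _; rewrite ?in_itv/= -?ler_norml// lerDl.
exists C; first by rewrite /C ltr_wpDl.
move=> x y xy.
have : - C * (y - x) <= phi y - phi x <= C * (y - x).
  apply: (derive_bounds (fun t => smooth_is_derive t sphi)) => // t _ _.
  by rewrite -ler_norml.
by rewrite mulNr -ler_norml.
Unshelve. all: by end_near. Qed.

End smooth_compact_support.

(** * Uniform continuity and Urysohn functions *)

Section uniform_modulus.
Context {R : realType}.

(** A radius that works around each point of a compact set can be chosen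
    independently of the point. *)
Lemma compact_uniform_radius (K : set R) (Q : R -> R -> Prop) : compact K ->
  (forall x, K x -> exists2 r, 0 < r & forall x' d, `|x - x'| < r -> 0 < d -> d <= r ->
    Q d x') ->
  exists2 d, 0 < d & forall x, K x -> Q d x.
Proof.
move=> /compact_near_coveringP cK HQ.
have H : \forall d \near (0 : R)^'+, K `<=` Q d.
  apply: (cK R (0 : R)^'+ (fun d x => Q d x)) => x Kx; have [r r0 Hr] := HQ x Kx.
  exists (ball x r, [set d | 0 < d /\ d <= r]) => /=.
    split; first exact: nbhsx_ballx.
    by apply: filterI; [exact: nbhs_right_gt|exact: nbhs_right_le].
  by move=> [x' d] /= [xx' [d0 dr]]; exact: Hr.
near (0 : R)^'+ => d; exists d; first by near: d; exact: nbhs_right_gt.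
by near: d.
Unshelve. all: by end_near. Qed.

Lemma heine (u : R -> R) (a b e : R) : continuous u -> 0 < e ->
  exists2 d, 0 < d & forall x y, a <= x -> x <= b -> `|x - y| < d -> `|u x - u y| < e.
Proof.
move=> cu e0; have e2 : 0 < e / 2 by rewrite divr_gt0.
have [x _|d d0 Hd] := @compact_uniform_radius `[a, b]%classic
    (fun d x => forall y, `|x - y| < d -> `|u x - u y| < e) (@segment_compact R a b).
  have /cvgrPdist_lt/(_ _ e2)[r /= r0 Hr] := cu x.
  exists (r / 2); first by rewrite divr_gt0.
  move=> x' d xx' d0 dr y x'y.
  have h1 : `|u x - u x'| < e / 2.
    by apply: Hr => /=; apply: lt_trans xx' _; rewrite ltr_pdivrMr// ltr_pMr// ltr1n.
  have h2 : `|u x - u y| < e / 2.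
    apply: Hr => /=; rewrite -[x - y](subrKA x') [ltRHS]splitr.
    apply: le_lt_trans (ler_normD _ _) _; apply: ltrD => //; exact: lt_le_trans dr.
  rewrite -[u x' - u y](subrKA (u x)) [ltRHS]splitr.
  by apply: le_lt_trans (ler_normD _ _) _; apply: ltrD => //; rewrite distrC.
by exists d => // x y ax xb; apply: Hd; rewrite /= in_itv/= ax.
Qed.

(** The function max (0, 1 - dist (x, K) / d), where G contains all the points
    at distance less than d from K. *)
Lemma Cc_urysohn (K G : set R) : compact K -> open G -> compact (closure G) ->
  K `<=` G -> exists u : R -> R, [/\ Cc u, forall x, K x -> u x = 1 &
    forall x, ~ G x -> u x = 0].
Proof.
move=> cK oG cG KG; have [M [_ HM]] := compact_bounded cG.
pose A := `|M| + 1.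
have GA x : A < `|x| -> ~ G x.
  move=> Ax Gx; have : `|x| <= A.
    by apply: (HM A); [rewrite /A (le_lt_trans (ler_norm _))// ltrDl|exact: subset_closure].
  by rewrite leNgt Ax.
have [[k0 Kk0]|K0] := pselect (K !=set0); last first.
  exists (cst 0); split => // [|x Kx]; last by exfalso; apply: K0; exists x.
  by apply: (@Cc_intro _ _ 0) => //; exact: cst_continuous.
have [x Kx|d d0 Hd] := @compact_uniform_radius K
    (fun d x => forall y, `|x - y| < d -> G y) cK.
  have [r /= r0 Hr] := oG x (KG x Kx).
  exists (r / 2); first by rewrite divr_gt0.
  move=> x' d xx' d0 dr y x'y; apply: Hr => /=.
  rewrite -[x - y](subrKA x') [ltRHS]splitr.
  by apply: le_lt_trans (ler_normD _ _) _; apply: ltrD => //; exact: lt_le_trans dr.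
pose dist x := inf [set `|x - k| | k in K].
have hi x : has_inf [set `|x - k| | k in K].
  by split; [exists `|x - k0|, k0|exists 0 => _ [k _ <-]].
have dle x k : K k -> dist x <= `|x - k|.
  by move=> Kk; apply: ge_inf; [exact: (hi x).2|exists k].
have dge0 x : 0 <= dist x.
  by apply: lb_le_inf; [exact: (hi x).1|move=> _ [k _ <-]].
have dlip x y : dist x <= `|x - y| + dist y.
  rewrite -lerBlDl; apply: lb_le_inf; first exact: (hi y).1.
  move=> _ [k Kk <-]; rewrite lerBlDl; apply: le_trans (dle x k Kk) _.
  by rewrite -[x - k](subrKA y); exact: ler_normD.
have cdist : continuous dist.
  move=> x; apply/cvgrPdist_lt => e e0; exists e => // y /= xy.
  apply: le_lt_trans xy; rewrite ler_norml; apply/andP; split.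
    by have := dlip y x; rewrite distrC; lra.
  by have := dlip x y; lra.
exists (fun x => Num.max 0 (1 - d^-1 * dist x)); split.
- apply: (@Cc_intro _ _ (A + 1)).
    move=> x; apply: (@continuous_max _ _ (cst 0) (fun x => 1 - d^-1 * dist x)).
      exact: cvg_cst.
    apply: cvgB; first exact: cvg_cst.
    by apply: cvgM; [exact: cvg_cst|exact: cdist].
  move=> x Ax; apply/max_idPl; rewrite subr_le0 -[leLHS](mulVf (lt0r_neq0 d0)).
  rewrite ler_pM2l ?invr_gt0// leNgt; apply/negP => xd.
  have [_ [k Kk <-] xk] := inf_lt (hi x).1 xd.
  by apply: (GA x); [lra|apply: (Hd k) => //; rewrite distrC].
- move=> x Kx; have -> : dist x = 0.
    by apply/eqP; rewrite eq_le dge0 andbT; have := dle x x Kx; rewrite subrr normr0.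
  by rewrite mulr0 subr0 max_r.
- move=> x Gx; apply/max_idPl; rewrite subr_le0 -[leLHS](mulVf (lt0r_neq0 d0)).
  rewrite ler_pM2l ?invr_gt0// leNgt; apply/negP => xd.
  have [_ [k Kk <-] xk] := inf_lt (hi x).1 xd.
  by apply: Gx; apply: (Hd k) => //; rewrite distrC.
Qed.

End uniform_modulus.

(** * Smooth interpolation along an increasing function *)

Section increasing_functions.
Context {R : realType}.
Variable f : R -> R.
Hypotheses (incf : {homo f : x y / x < y}) (cf : continuous f).

Lemma incr_le x y : (f x <= f y) = (x <= y).
Proof.
apply/idP/idP; first by apply: contraTT; rewrite -!ltNge; exact: incf.
by rewrite le_eqVlt => /predU1P[->//|/incf/ltW].
Qed.

Lemma incr_inj x y : f x = f y -> x = y.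
Proof. by move=> fxy; apply/eqP; rewrite eq_le -(incr_le x y) -(incr_le y x) fxy lexx. Qed.

Lemma incr_IVT p q t : p <= q -> f p <= t -> t <= f q ->
  exists x, [/\ p <= x, x <= q & f x = t].
Proof.
move=> pq pt tq; have fpq : f p <= f q by rewrite incr_le.
have := @IVT _ f p q t pq (continuous_subspaceT cf).
rewrite min_l ?max_r// pt tq => /(_ isT)[x]; rewrite in_itv/= => /andP[px xq] fx.
by exists x.
Qed.

(** Uniform continuity of w with respect to the increments of f: by compactness
    f (x + d / 2) - f x has a positive minimum, so that a small increment of f
    comes from a small increment of the variable. *)
Lemma incr_modulus (w : R -> R) p q e : continuous w -> 0 < e -> p <= q ->
  exists2 d, 0 < d & forall x y, p <= x -> x <= y -> y <= q -> f y - f x < d ->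
    `|w x - w y| < e.
Proof.
move=> cw e0 pq; have [d d0 Hd] := heine p q cw e0.
have d2 : 0 < d / 2 by rewrite divr_gt0.
have cg : {within `[p, q], continuous (fun x => f (x + d / 2) - f x)}.
  apply: continuous_subspaceT => x; apply: cvgB; last exact: cf.
  apply: (@continuous_comp _ _ _ (fun x => x + d / 2) f); last exact: cf.
  by apply: cvgD; [exact: cvg_id|exact: cvg_cst].
have [c _ Hc] := EVT_min pq cg.
exists (f (c + d / 2) - f c); first by rewrite subr_gt0; apply: incf; rewrite ltrDl.
move=> x y px xy yq fxy; have xq := le_trans xy yq; apply: Hd => //.
rewrite distrC ger0_norm ?subr_ge0// ltNge; apply/negP => dyx.
have xpq : x \in `[p, q] by rewrite in_itv/= px xq.
have := Hc x xpq; apply/negP; rewrite -ltNge; apply: le_lt_trans fxy.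
rewrite lerD2r incr_le -lerBrDl; apply: le_trans dyx.
by rewrite ler_pdivrMr// ler_pMr// ler1n.
Qed.

End increasing_functions.

Section smooth_interpolation.
Context {R : realType}.

Lemma grid_cell (h t0 t : R) n : t0 <= t -> t <= t0 + h * n.+1%:R ->
  exists2 j, (j < n.+1)%N & t0 + h * j%:R <= t <= t0 + h * j.+1%:R.
Proof.
move=> tt; elim: n => [|n ih] tn; first by exists 0%N => //; rewrite mulr0 addr0 tt.
have [/ih[j jn Hj]|nt] := leP t (t0 + h * n.+1%:R); first by exists j => //; exact: ltnW.
by exists n.+1 => //; rewrite tn ltW.
Qed.

(** The ramps of length h cover an interval one after the other, so that the sum
    of their increments between two points is at most the distance of these. *)
Lemma sum_clamps (h t0 : R) n t : 0 < h ->
  \sum_(i < n) h * clamp 0 1 (h^-1 * (t - (t0 + h * i%:R))) = clamp 0 (h * n%:R) (t - t0).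
Proof.
move=> h0; have hc c d x : h * clamp c d x = clamp (h * c) (h * d) (h * x).
  by rewrite /clamp maxr_pMr ?minr_pMr// ltW.
elim: n => [|n ih].
  by rewrite big_ord0 mulr0 /clamp /Num.max /Num.min; do ![case: ifP => //]; lra.
rewrite big_ord_recr/= ih hc mulr0 mulr1 mulrA mulfV ?gt_eqF// mul1r -natr1 mulrDr mulr1.
have : 0 <= h * n%:R by rewrite mulr_ge0// ltW.
move: (h * n%:R) => a a0; rewrite /clamp /Num.max /Num.min.
by do ![case: ifP => //]; lra.
Qed.

(** The function phi goes by smooth steps, on a regular grid of range f, between
    the values of w at the preimages of the grid points. The error is the
    oscillation of w on a cell, and a step of width h has slope at most A / h.
    The constant A comes from the step alone: the Lipschitz constant does not
    deteriorate as e tends to 0. *)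
Lemma smooth_interpolation : exists2 A : R, 0 < A &
  forall (f w : R -> R) (p q e : R), {homo f : x y / x < y} -> continuous f ->
  continuous w -> p < q -> (forall x, x <= p -> w x = 0) ->
  (forall x, q <= x -> w x = 0) -> 0 < e ->
  exists phi : R -> R, [/\ Cc_smooth (range f) phi,
    forall x, x <= p \/ q <= x -> phi (f x) = 0,
    forall x, `|phi (f x) - w x| < e &
    forall C, 0 <= C -> (forall x y, x <= y -> `|w y - w x| <= C * (f y - f x)) ->
      forall x y, x <= y -> `|phi (f y) - phi (f x)| <= C * A * (f y - f x)].
Proof.
have [S [A [sS A0 S0 S1 Sinc]]] := @smooth_step R.
exists A => // f w p q e incf cf cw pq wp wq e0.
have e2 : 0 < e / 2 by rewrite divr_gt0.
have [d d0 Hd] := incr_modulus incf cf cw e2 (ltW pq).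
pose L := f q - f p; have L0 : 0 < L by rewrite subr_gt0 incf.
pose n := Num.bound (L / d); pose h := L / n.+1%:R.
have h0 : 0 < h by rewrite divr_gt0.
have hd : h < d.
  rewrite /h ltr_pdivrMr// mulrC -ltr_pdivrMr//.
  apply: lt_le_trans (archi_boundP _) _; first by rewrite divr_ge0// ltW.
  by rewrite ler_nat.
pose t i := f p + h * i%:R.
have tn : t n.+1 = f q by rewrite /t /h divfK ?pnatr_eq0// addrC subrK.
have tle i j : (i <= j)%N -> t i <= t j by move=> ij; rewrite lerD2l ler_pM2l// ler_nat.
have tp i : f p <= t i by rewrite lerDl mulr_ge0// ltW.
have tq i : (i <= n.+1)%N -> t i <= f q by move=> ?; rewrite -tn tle.
have /choice[X HX] i : exists x, (i <= n.+1)%N -> [/\ p <= x, x <= q & f x = t i].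
  have [i_n|_] := leqP i n.+1; last by exists 0.
  by have [x Hx] := incr_IVT incf cf (ltW pq) (tp i) (tq i i_n); exists x.
have X0 : X 0%N = p.
  by apply: (incr_inj incf); have [_ _ ->] := HX 0%N isT; rewrite /t mulr0 addr0.
have Xn : X n.+1 = q.
  by apply: (incr_inj incf); have [_ _ ->] := HX n.+1 (leqnn _).
pose W i := w (X i).
have W0 : W 0%N = 0 by rewrite /W X0 wp.
have Wn : W n.+1 = 0 by rewrite /W Xn wq.
have XX i : (i < n.+1)%N -> [/\ X i <= X i.+1, p <= X i, X i.+1 <= q & f (X i.+1) - f (X i) = h].
  move=> i_n; have [p1 q1 f1] := HX i (ltnW i_n); have [p2 q2 f2] := HX i.+1 i_n.
  split => //; first by rewrite -(incr_le incf) f1 f2 tle.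
  by rewrite f1 f2 /t -natr1; ring.
pose arg i (y : R) := h^-1 * y + - (h^-1 * t i).
have argE i y : arg i y = h^-1 * (y - t i) by rewrite /arg mulrBr.
have hi0 : 0 < h^-1 by rewrite invr_gt0.
have arg0 i y : y <= t i -> S (arg i y) = 0.
  by move=> yt; apply: S0; rewrite argE pmulr_rle0// subr_le0.
have arg1 i y : t i.+1 <= y -> S (arg i y) = 1.
  move=> yt; apply: S1; rewrite argE mulrC ler_pdivlMr// mul1r.
  by move: yt; rewrite /t -natr1; lra.
pose phi y := \sum_(i < n.+1) (W i.+1 - W i) * S (arg i y).
have sphi : smooth phi.
  apply: (@smooth_sum _ n.+1 (fun i y => (W i.+1 - W i) * S (arg i y))) => i.
  apply: (@smoothM _ (cst (W i.+1 - W i)) (S \o arg i)); first exact: smooth_cst.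
  by apply: smooth_comp => //; exact: smooth_affine.
have sumW k : \sum_(i < k) (W i.+1 - W i) = W k.
  by rewrite -(big_mkord xpredT (fun i => W i.+1 - W i)) telescope_sumr// W0 subr0.
have phil y : y <= f p -> phi y = 0.
  by move=> yp; rewrite /phi big1// => i _; rewrite arg0 ?mulr0// (le_trans yp).
have phir y : f q <= y -> phi y = 0.
  move=> qy; rewrite /phi (eq_bigr (fun i : 'I_n.+1 => W i.+1 - W i)) ?sumW//.
  by move=> i _; rewrite arg1 ?mulr1// (le_trans _ qy)// tq.
exists phi; split.
- apply: (@Cc_smooth_intro _ _ _ `[f p, f q]%classic) => //.
  + exact: segment_compact.
  + move=> y; rewrite /= in_itv/= => /andP[py yq].
    by have [x [_ _ <-]] := incr_IVT incf cf (ltW pq) py yq; exists x.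
  + move=> y; rewrite /= in_itv/= => /negP; rewrite negb_and -!ltNge => /orP[h1|h1].
      by rewrite phil// ltW.
    by rewrite phir// ltW.
- by move=> x [xp|qx]; [rewrite phil//|rewrite phir//]; rewrite incr_le.
- move=> x; have [xp|px] := leP x p; first by rewrite phil ?incr_le// wp// subrr normr0.
  have [qx|xq] := leP q x; first by rewrite phir ?incr_le// wq// subrr normr0.
  have [||j jn /andP[tj jt]] := @grid_cell h (f p) (f x) n.
  + by rewrite incr_le// ltW.
  + by rewrite -/(t n.+1) tn incr_le// ltW.
  rewrite -/(t j) in tj; rewrite -/(t j.+1) in jt.
  have -> : phi (f x) = W j + (W j.+1 - W j) * S (arg j (f x)).
    rewrite /phi -(big_mkord xpredT (fun i => (W i.+1 - W i) * S (arg i (f x)))).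
    rewrite (@big_cat_nat _ _ _ j.+1)//= big_nat_recr//=.
    have -> : \sum_(j.+1 <= i < n.+1) (W i.+1 - W i) * S (arg i (f x)) = 0.
      rewrite big_nat; apply: big1 => i /andP[ji _].
      by rewrite arg0 ?mulr0//; exact: le_trans jt (tle _ _ ji).
    rewrite addr0; congr (_ + _); rewrite -[RHS]sumW -(big_mkord xpredT (fun i => W i.+1 - W i)).
    rewrite !big_nat; apply: eq_bigr => i /andP[_ ij].
    by rewrite arg1 ?mulr1//; exact: le_trans (tle _ _ ij) tj.
  have [Xjj pX Xq fX] := XX j jn; have [_ _ fXj] := HX j (ltnW jn).
  have [_ _ fXj1] := HX j.+1 jn.
  have h1 : `|W j - w x| < e / 2.
    apply: Hd => //; first by rewrite -(incr_le incf) fXj.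
      exact: ltW.
    rewrite fXj; apply: le_lt_trans hd; move: fX; rewrite fXj fXj1.
    by move: jt; lra.
  have h2 : `|W j - W j.+1| < e / 2 by apply: Hd => //; rewrite fX.
  have S01 : 0 <= S (arg j (f x)) <= 1.
    rewrite argE; set z := _ * _.
    have z0 : 0 <= z by rewrite mulr_ge0 ?subr_ge0// ltW.
    have z1 : z <= 1.
      by rewrite /z mulrC ler_pdivrMr// mul1r; move: jt; rewrite /t -natr1; lra.
    have := Sinc 0 z z0; have := Sinc z 1 z1; rewrite (S0 0)// (S1 1)//; lra.
  have h3 : `|(W j.+1 - W j) * S (arg j (f x))| < e / 2.
    rewrite normrM; apply: le_lt_trans h2; rewrite distrC ler_piMr//.
    by rewrite ger0_norm; case/andP: S01.
  rewrite [X in `|X|](_ : _ = (W j - w x) + (W j.+1 - W j) * S (arg j (f x))); last by ring.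
  by rewrite [ltRHS]splitr; apply: le_lt_trans (ler_normD _ _) _; exact: ltrD.
- move=> C C0 wC x y xy; have fxy : f x <= f y by rewrite incr_le.
  have Sclamp z : S z = S (clamp 0 1 z).
    rewrite /clamp; have [z1|z1] := leP z 1; last by rewrite max_r// !S1// ltW.
    by have [z0|z0] := leP z 0; rewrite // !S0.
  pose c i y := clamp 0 1 (h^-1 * (y - (f p + h * i%:R))).
  have Sc i : 0 <= S (arg i (f y)) - S (arg i (f x)) <= A * (c i (f y) - c i (f x)).
    rewrite !argE (Sclamp (_ * (f y - _))) (Sclamp (_ * (f x - _))).
    by apply: Sinc; apply: clamp_le; rewrite ler_pM2l// lerD2r.
  rewrite /phi -sumrB.
  rewrite (eq_bigr (fun i : 'I_n.+1 => (W i.+1 - W i) *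
    (S (arg i (f y)) - S (arg i (f x))))); last by move=> i _; rewrite mulrBr.
  apply: le_trans (ler_norm_sum _ _ _) _.
  apply: (@le_trans _ _ (\sum_(i < n.+1) C * A * (h * c i (f y) - h * c i (f x)))).
    apply: ler_sum => i _; rewrite normrM.
    have [Xii _ _ fX] := XX i (ltn_ord i).
    have /andP[s0 s1] := Sc i; rewrite (ger0_norm s0).
    apply: (@le_trans _ _ (C * h * (A * (c i (f y) - c i (f x))))).
      by apply: ler_pM => //; have := wC _ _ Xii; rewrite fX.
    by rewrite le_eqVlt; apply/orP; left; apply/eqP; ring.
  rewrite -mulr_sumr sumrB !sum_clamps//.
  apply: ler_wpM2l; first by rewrite mulr_ge0// ltW.
  have xy' : f x - f p <= f y - f p by rewrite lerD2r.
  have /andP[_] := clamp_lip 0 (h * n.+1%:R) xy'.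
  by rewrite opprB addrA subrK.
Qed.

End smooth_interpolation.

(** * Approximation by differences of increasing functions *)

Section running_supremum.
Context {R : realType}.
Variables (u : R -> R) (p q : R).
Hypotheses (cu : continuous u) (pq : p <= q).

(** Up to this sign, u increases from p to q. *)
Definition cell_sign : R := if u p <= u q then 1 else - 1.
Local Notation sg := cell_sign.
Local Notation U t := (sg * u t).

Lemma cell_sign_le : U p <= U q.
Proof. by rewrite /sg; case: ifPn => [|/negP/negP]; rewrite -?ltNge; lra. Qed.

Lemma cell_sign_norm t t' : `|U t - U t'| = `|u t - u t'|.
Proof.
by rewrite -mulrBr normrM /sg; case: ifP => _; rewrite ?normrN normr1 mul1r.
Qed.

Lemma cell_sign2 : sg * sg = 1.
Proof. by rewrite /sg; case: ifPn => _; rewrite ?mulr1// mulrNN mulr1. Qed.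

Let w t := clamp (U p) (U q) (U t).
Let wset x := [set w t | t in `[p, clamp p q x]].

(** The running supremum of u over [p, x], u being clamped between its values at
    p and q: a nondecreasing function whose total increase over [p, q] is
    |u q - u p|. *)
Definition running_sup x := sup (wset x) - U p.
Local Notation theta := running_sup.

Let w_in t : U p <= w t /\ w t <= U q.
Proof. exact: (clamp_in _ cell_sign_le). Qed.

Let wp : w p = U p.
Proof. by rewrite /w clamp_id// cell_sign_le. Qed.

Let wq : w q = U q.
Proof. by rewrite /w clamp_id// cell_sign_le. Qed.

Let has_sup_wset x : has_sup (wset x).
Proof.
have [px xq] := clamp_in x pq.
split; first by exists (w p), p => //; rewrite /= in_itv/= lexx.
by exists (U q) => _ [t _ <-]; have [] := w_in t.
Qed.

Let w_le x t : p <= t -> t <= clamp p q x -> w t <= sup (wset x).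
Proof.
move=> pt tx; apply: ub_le_sup; first exact: (has_sup_wset x).2.
by exists t => //; rewrite /= in_itv/= pt.
Qed.

Let sup_le x B : (forall t, p <= t -> t <= clamp p q x -> w t <= B) -> sup (wset x) <= B.
Proof.
move=> H; apply: ge_sup; first exact: (has_sup_wset x).1.
by move=> _ [t + <-]; rewrite /= in_itv/= => /andP[]; exact: H.
Qed.

Lemma running_sup_left x : x <= p -> theta x = 0.
Proof.
move=> xp; have cx : clamp p q x = p.
  by rewrite /clamp min_l ?max_l//; exact: le_trans pq.
apply/eqP; rewrite subr_eq0 eq_le; apply/andP; split.
  apply: sup_le => t pt; rewrite cx => tp; have -> : t = p by apply/eqP; rewrite eq_le tp.
  by rewrite wp.
by rewrite -wp; apply: w_le => //; rewrite cx.
Qed.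

Lemma running_sup_right x : q <= x -> theta x = U q - U p.
Proof.
move=> qx; have cx : clamp p q x = q by rewrite /clamp min_r// max_r.
congr (_ - _); apply/eqP; rewrite eq_le; apply/andP; split.
  by apply: sup_le => t _ _; have [] := w_in t.
by rewrite -wq; apply: w_le => //; rewrite cx.
Qed.

Lemma running_sup_le : {homo theta : x y / x <= y}.
Proof.
move=> x y xy; rewrite lerD2r; apply: sup_le => t pt tx.
by apply: w_le => //; apply: le_trans tx _; exact: clamp_le.
Qed.

(** Only the values of u between y and z can raise the supremum. *)
Lemma running_sup_increment y z B : y <= z -> 0 <= B ->
  (forall t, clamp p q y <= t -> t <= clamp p q z -> `|u t - u (clamp p q y)| <= B) ->
  theta z - theta y <= B.
Proof.
move=> yz B0 HB; rewrite opprB addrA subrK lerBlDl; apply: sup_le => t pt tz.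
have [py yq] := clamp_in y pq.
have [ty|/ltW yt] := leP t (clamp p q y).
  by apply: (le_trans (w_le pt ty)); rewrite lerDl.
apply: (@le_trans _ _ (w (clamp p q y) + B)); last by rewrite lerD2r w_le.
have := HB t yt tz; rewrite -cell_sign_norm => hB.
have : `|w t - w (clamp p q y)| <= `|U t - U (clamp p q y)|.
  rewrite /w; have [h|/ltW h] := leP (U (clamp p q y)) (U t).
    by have := clamp_lip (U p) (U q) h; rewrite !ger0_norm ?subr_ge0// => [/andP[]//|]; exact: clamp_le.
  rewrite distrC [leRHS]distrC.
  by have := clamp_lip (U p) (U q) h; rewrite !ger0_norm ?subr_ge0// => [/andP[]//|]; exact: clamp_le.
by move=> /le_trans /(_ hB); rewrite ler_norml => /andP[_]; lra.
Qed.

Lemma running_sup_continuous : continuous theta.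
Proof.
move=> x; apply/cvgrPdist_lt => e e0; have e2 : 0 < e / 2 by rewrite divr_gt0.
have [d d0 Hd] := heine p q cu e2.
have key y z : y <= z -> z - y < d -> theta z - theta y < e.
  move=> yz zy; apply: (@le_lt_trans _ _ (e / 2)); last by rewrite ltr_pdivrMr// ltr_pMr// ltr1n.
  have [py yq] := clamp_in y pq.
  apply: running_sup_increment => //; first exact: ltW.
  move=> t yt tz; rewrite distrC; apply/ltW/Hd => //.
  rewrite distrC ger0_norm ?subr_ge0//; apply: le_lt_trans zy.
  apply: (@le_trans _ _ (clamp p q z - clamp p q y)); first by rewrite lerD2r.
  by have /andP[] := clamp_lip p q yz.
exists d => // y /= xyd; have [xy|/ltW yx] := leP x y.
  rewrite distrC ger0_norm ?subr_ge0 ?running_sup_le//; apply: key => //.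
  by move: xyd; rewrite distrC ger0_norm// subr_ge0.
rewrite ger0_norm ?subr_ge0 ?running_sup_le//; apply: key => //.
by move: xyd; rewrite ger0_norm// subr_ge0.
Qed.

End running_supremum.

Section energy_of_sums.
Context {R : realType}.
Variables (D : set nat) (I : nat -> interval R) (s : forall n, scale_function (I n)).
Variable N : R -> R.
Hypothesis ndN : {homo N : x y / x <= y}.
Local Notation energy := (energy_bound D s).

Let s_le n y z : y \in I n -> z \in I n -> y <= z -> s n y <= s n z.
Proof. exact: scale_le. Qed.

Lemma running_sup_energy (u : R -> R) p q : p <= q -> energy u N ->
  energy (running_sup u p q) N.
Proof.
move=> pq [_ uN]; split => // n y z Dn yI zI yz.
set th := running_sup u p q.
have Ege0 : 0 <= (s n z - s n y) * (N z - N y).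
  by rewrite mulr_ge0// subr_ge0; [exact: s_le|exact: ndN].
have [zp|pz] := leP z p.
  by rewrite /th !running_sup_left ?subrr ?expr0n//; exact: le_trans zp.
have [qy|yq] := leP q y.
  by rewrite /th !running_sup_right ?subrr ?expr0n//; exact: le_trans yz.
have thle : 0 <= th z - th y by rewrite subr_ge0 running_sup_le.
rewrite -[leRHS]sqr_sqrtr// ler_pXn2r ?nnegrE ?sqrtr_ge0//.
have ycl : y <= clamp p q y.
  by rewrite /clamp le_max (min_l (ltW yq)) lexx orbT.
have zcl : clamp p q z <= z.
  by rewrite /clamp ge_max ge_min lexx (ltW pz).
have cyz := clamp_le p q yz.
have sub t : y <= t -> t <= z -> t \in I n.
  by move=> yt tz; apply: (itv_sub yI zI); rewrite /= in_itv/= yt.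
apply: running_sup_increment => //.
move=> t yt tz; rewrite -sqrtr_sqr ler_wsqrtr//.
have y't : y <= clamp p q y by [].
have y'z := le_trans cyz zcl; have tz' := le_trans tz zcl.
have yt' := le_trans ycl yt.
apply: le_trans (uN n _ _ Dn (sub _ ycl y'z) (sub _ yt' tz') yt) _.
apply: ler_pM.
- by rewrite subr_ge0 s_le// sub.
- by rewrite subr_ge0 ndN.
- by apply: lerB; apply: s_le => //; apply: sub.
- by apply: lerB; exact: ndN.
Qed.

(** On each side of p one of the two functions is constant, so an increment
    across p splits into an increment of each. *)
Lemma energy_glue (F G : R -> R) p : energy F N -> energy G N ->
  (forall x, p <= x -> F x = F p) -> (forall x, x <= p -> G x = G p) ->
  energy (F \+ G) N.
Proof.
move=> [_ FN] [_ GN] Fp Gp; split => // n y z Dn yI zI yz /=.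
have [zp|/ltW pz] := leP z p.
  by rewrite (Gp z zp) (Gp y (le_trans yz zp)) opprD addrACA subrr addr0 FN.
have [py|/ltW yp] := leP p y.
  by rewrite (Fp y py) (Fp z (le_trans py yz)) opprD addrACA subrr add0r GN.
have pI : p \in I n by apply: (itv_sub yI zI); rewrite /= in_itv/= yp.
rewrite (Fp z pz) (Gp y yp).
have -> : F p + G z - (F y + G p) = (F p - F y) + (G z - G p) by ring.
have -> : s n z - s n y = (s n p - s n y) + (s n z - s n p) by ring.
have -> : N z - N y = (N p - N y) + (N z - N p) by ring.
apply: cauchy_schwarz2; rewrite ?subr_ge0 ?s_le ?ndN//; [exact: FN|exact: GN].
Qed.

(** On each cell of a fine grid, u is replaced by its running supremum, with the
    sign that makes the result v agree with u at the grid points; dropping the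
    signs gives f. A running supremum has no larger increments than u, so that N
    still bounds the energy, although u may have infinite variation. *)
Lemma monotone_approximation (u : R -> R) (A e : R) : continuous u -> energy u N ->
  0 < A -> (forall x, A <= `|x| -> u x = 0) -> 0 < e ->
  exists v f : R -> R, exists V : R,
    [/\ continuous v /\ (forall x, A <= `|x| -> v x = 0),
        forall x, `|v x - u x| < e,
        [/\ {homo f : x y / x <= y}, continuous f & forall x, 0 <= f x <= V],
        energy f N &
        forall x y, x <= y -> `|v y - v x| <= f y - f x].
Proof.
move=> cu uN A0 uA e0; have e2 : 0 < e / 2 by rewrite divr_gt0.
have [d d0 Hd] := heine (- A) A cu e2.
pose k := Num.bound (2 * A / d); pose h := 2 * A / k.+1%:R.
have A2 : 0 < 2 * A by rewrite mulr_gt0.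
have h0 : 0 < h by rewrite divr_gt0.
have hd : h < d.
  rewrite /h ltr_pdivrMr// [d * _]mulrC -ltr_pdivrMr//.
  apply: lt_le_trans (archi_boundP _) _; first by rewrite divr_ge0 ?ltW.
  by rewrite ler_nat.
pose a i := - A + h * i%:R.
have a0 : a 0%N = - A by rewrite /a mulr0 addr0.
have ak : a k.+1 = A by rewrite /a /h divfK ?pnatr_eq0//; lra.
have ale i j : (i <= j)%N -> a i <= a j by move=> ij; rewrite lerD2l ler_pM2l// ler_nat.
have aS i : a i.+1 - a i = h by rewrite /a -natr1; ring.
have aA i : - A <= a i by rewrite -a0 ale.
have aA' i : (i <= k.+1)%N -> a i <= A by move=> ?; rewrite -ak ale.
have ua0 : u (a 0%N) = 0 by rewrite uA// a0 normrN ger0_norm// ltW.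
have uak : u (a k.+1) = 0 by rewrite uA// ak ger0_norm// ltW.
pose th i := running_sup u (a i) (a i.+1).
pose sg i := cell_sign u (a i) (a i.+1).
have aSle i : a i <= a i.+1 by exact: ale.
have thl i x : x <= a i -> th i x = 0 by move=> xa; exact: running_sup_left.
have thr i x : a i.+1 <= x -> th i x = sg i * u (a i.+1) - sg i * u (a i).
  by move=> ax; exact: running_sup_right.
have thle i x y : x <= y -> th i x <= th i y by move=> xy; exact: running_sup_le.
have cth i : continuous (th i) by exact: running_sup_continuous.
pose f x := \sum_(i < k.+1) th i x.
pose v x := \sum_(i < k.+1) sg i * th i x.
have th0 i x : 0 <= th i x.
  have [xa|/ltW ax] := leP x (a i); first by rewrite thl.
  by rewrite -(thl i (a i))// thle.
have sg1 i : `|sg i| = 1 by rewrite /sg /cell_sign; case: ifP => _; rewrite ?normrN normr1.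
have sgr i : sg i * (sg i * u (a i.+1) - sg i * u (a i)) = u (a i.+1) - u (a i).
  by rewrite -mulrBr mulrA cell_sign2 mul1r.
have sumu j : \sum_(i < j) (u (a i.+1) - u (a i)) = u (a j).
  by rewrite -(big_mkord xpredT (fun i => u (a i.+1) - u (a i))) telescope_sumr// ua0 subr0.
have vl x : x <= - A -> v x = 0.
  by move=> xA; rewrite /v big1// => i _; rewrite thl ?mulr0// (le_trans xA).
have vr x : A <= x -> v x = 0.
  move=> Ax; rewrite /v (eq_bigr (fun i : 'I_k.+1 => u (a i.+1) - u (a i))) ?sumu//.
  by move=> i _; rewrite thr ?sgr// (le_trans _ Ax)// aA'.
have vA x : A <= `|x| -> v x = 0.
  by rewrite ler_normr => /orP[/vr//|Ax]; apply: vl; rewrite lerNr.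
have csum (c : nat -> R) n : continuous (fun x => \sum_(i < n) c i * th i x).
  elim: n => [|n ih].
    rewrite (_ : (fun _ => _) = cst 0); first exact: cst_continuous.
    by apply/funext => x; rewrite big_ord0.
  rewrite (_ : (fun _ => _) = (fun x => \sum_(i < n) c i * th i x + c n * th n x)); last first.
    by apply/funext => x; rewrite big_ord_recr.
  move=> x; apply: cvgD; first exact: ih.
  by apply: cvgM; [exact: cvg_cst|exact: cth].
exists v, f, (\sum_(i < k.+1) th i A); split.
- by split=> //; exact: csum.
- move=> x; have [xA|xA] := leP A `|x|; first by rewrite uA// vA// subrr normr0.
  have /andP[Ax xA'] : - A < x < A by rewrite -ltr_norml.
  have [||j jk /andP[jx xj]] := @grid_cell _ h (- A) x k; [exact: ltW|by rewrite -/(a k.+1) ak ltW|].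
  rewrite -/(a j) in jx; rewrite -/(a j.+1) in xj.
  have -> : v x = u (a j) + sg j * th j x.
    rewrite /v -(big_mkord xpredT (fun i => sg i * th i x)).
    rewrite (@big_cat_nat _ _ _ j.+1)//= big_nat_recr//=.
    have -> : \sum_(j.+1 <= i < k.+1) sg i * th i x = 0.
      rewrite big_nat; apply: big1 => i /andP[ji _].
      by rewrite thl ?mulr0//; exact: le_trans xj (ale _ _ ji).
    rewrite addr0; congr (_ + _); rewrite -sumu -(big_mkord xpredT (fun i => u (a i.+1) - u (a i))).
    rewrite !big_nat; apply: eq_bigr => i /andP[_ ij].
    by rewrite thr ?sgr//; exact: le_trans (ale _ _ ij) jx.
  have ajA : a j <= A := aA' _ (ltnW jk).
  have h1 : `|u (a j) - u x| < e / 2.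
    apply: Hd => //; rewrite distrC ger0_norm ?subr_ge0//; apply: le_lt_trans hd.
    by rewrite -(aS j) lerD2r.
  have h2 : `|u (a j) - u (a j.+1)| < e / 2.
    by apply: Hd => //; rewrite distrC ger0_norm ?subr_ge0// aS.
  have h3 : `|sg j * th j x| < e / 2.
    rewrite normrM sg1 mul1r ger0_norm//; apply: le_lt_trans h2.
    apply: (le_trans (thle j _ _ xj)); rewrite thr// distrC.
    by rewrite -(cell_sign_norm u (a j) (a j.+1)) ler_norm.
  rewrite addrAC [ltRHS]splitr; apply: le_lt_trans (ler_normD _ _) _; exact: ltrD.
- split.
  + by move=> x y xy; apply: ler_sum => i _; exact: thle.
  + rewrite (_ : f = fun x => \sum_(i < k.+1) 1 * th i x); first exact: (csum (fun=> 1)). 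
    by apply/funext => x; apply: eq_bigr => i _; rewrite mul1r.
  + move=> x; rewrite /f sumr_ge0//=; apply: ler_sum => i _.
    have [xA|/ltW Ax] := leP x A; first exact: (thle i _ _ xA).
    by have aiA := aA' _ (ltn_ord i); rewrite (thr _ _ aiA) (thr _ _ (le_trans aiA Ax)).
- rewrite /f; elim: k.+1 => [|n ih].
    split=> // n y z Dn yI zI yz; rewrite !big_ord0 subrr expr0n.
    by rewrite mulr_ge0// subr_ge0 ?s_le ?ndN.
  rewrite (_ : (fun _ => _) = (fun x => \sum_(i < n) th i x) \+ th n); last first.
    by apply/funext => x; rewrite big_ord_recr.
  apply: (@energy_glue _ _ (a n)) => //.
  + exact: running_sup_energy.
  + move=> x ax; apply: eq_bigr => i _.
    by rewrite !thr//; [exact: ale|exact: le_trans (ale _ _ _) ax].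
  + by move=> x xa; rewrite !thl.
- move=> x y xy; rewrite /v /f -!sumrB; apply: le_trans (ler_norm_sum _ _ _) _.
  apply: ler_sum => i _; rewrite -mulrBr normrM sg1 mul1r ger0_norm//.
  by rewrite subr_ge0 thle.
Qed.

End energy_of_sums.

(** * Dyadic series *)

Section dyadic_series.
Context {R : realType}.
Implicit Types (g : nat -> R -> R).

Definition dyadic_sum g n x := \sum_(0 <= j < n) 2 ^- j.+1 * g j x.

Lemma half_pow_gt0 n : 0 < 2 ^- n :> R.
Proof. by rewrite invr_gt0 exprn_gt0. Qed.

Lemma half_powS n : 2 ^- n.+1 + 2 ^- n.+1 = 2 ^- n :> R.
Proof. by rewrite exprS invfM; have := half_pow_gt0 n; lra. Qed.

Lemma half_pow_sum n : \sum_(0 <= j < n) 2 ^- j.+1 <= 1 :> R.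
Proof.
suff -> : \sum_(0 <= j < n) 2 ^- j.+1 = 1 - 2 ^- n :> R.
  by rewrite gerBl ltW// half_pow_gt0.
elim: n => [|n ih]; first by rewrite big_nil expr0 invr1 subrr.
by rewrite big_nat_recr//= ih -(half_powS n); ring.
Qed.

Lemma half_pow_small (e : R) : 0 < e -> exists n, 2 ^- n < e.
Proof.
move=> e0; have := @cvg_expr R 2^-1 _; rewrite ger0_norm// invf_lt1// ltr1n => /(_ isT).
move=> /cvgrPdist_lt/(_ _ e0)[n _ /(_ n (leqnn n))] /=.
by rewrite sub0r normrN exprVn ger0_norm ?(ltW (half_pow_gt0 n))//; exists n.
Qed.

(** The partial sums increase, while the partial sums plus 2^-n decrease. *)
Lemma dyadic_series g : (forall j x, 0 <= g j x <= 1) ->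
  exists G, forall x, dyadic_sum g n x @[n --> \oo] --> G x /\
    forall n, dyadic_sum g n x <= G x <= dyadic_sum g n x + 2 ^- n.
Proof.
move=> g01; pose S x n := dyadic_sum g n x.
have SS x n : S x n.+1 = S x n + 2 ^- n.+1 * g n x by rewrite /S /dyadic_sum big_nat_recr.
have S_le x : {homo S x : n k / (n <= k)%N >-> n <= k}.
  apply: homo_leq; [exact: lexx|move=> ? ? ?; exact: le_trans|move=> n].
  by rewrite SS lerDl mulr_ge0 ?(ltW (half_pow_gt0 _))//; have /andP[] := g01 n x.
have T_le x : {homo (fun n => S x n + 2 ^- n) : n k / (n <= k)%N >-> k <= n}.
  apply: homo_leq => [//|b a c ab bc|n]; first exact: le_trans ab.
  have /andP[_ g1] := g01 n x; rewrite SS -(half_powS n) addrA lerD2r lerD2l.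
  by rewrite ler_piMr// ltW// half_pow_gt0.
have ST x n k : S x n <= S x k + 2 ^- k.
  have [nk|/ltnW kn] := leqP n k.
    by rewrite (le_trans (S_le x _ _ nk))// lerDl ltW// half_pow_gt0.
  by apply: le_trans (T_le x _ _ kn); rewrite lerDl ltW// half_pow_gt0.
have ub x : has_ubound (range (S x)) by exists (S x 0%N + 2 ^- 0) => _ [n _ <-].
exists (fun x => sup (range (S x))) => x; split; first exact: (nondecreasing_cvgn (S_le x) (ub x)).
move=> n; apply/andP; split; first by apply: ub_le_sup => //; exists n.
by apply: ge_sup => [|_ [k _ <-]]; [exists (S x 0%N), 0%N|exact: ST].
Qed.

Lemma dyadic_sum_continuous g n : (forall j, continuous (g j)) -> continuous (dyadic_sum g n).
Proof.
move=> cg; elim: n => [|n ih].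
  rewrite (_ : dyadic_sum g 0 = cst 0); first exact: cst_continuous.
  by apply/funext => x; rewrite /dyadic_sum big_nil.
rewrite (_ : dyadic_sum g n.+1 = fun x => dyadic_sum g n x + 2 ^- n.+1 * g n x); last first.
  by apply/funext => x; rewrite /dyadic_sum big_nat_recr.
move=> x; apply: cvgD; first exact: ih.
by apply: cvgM; [exact: cvg_cst|exact: cg].
Qed.

Lemma dyadic_series_continuous g G : (forall j, continuous (g j)) ->
  (forall x n, dyadic_sum g n x <= G x <= dyadic_sum g n x + 2 ^- n) -> continuous G.
Proof.
move=> cg SG x; apply/cvgrPdist_lt => e e0; have e3 : 0 < e / 3 by rewrite divr_gt0.
have [n en] := half_pow_small e3.
have /cvgrPdist_lt/(_ _ e3) := @dyadic_sum_continuous g n cg x.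
apply: filterS => y Sxy; have := SG x n; have := SG y n.
by move: Sxy; rewrite !ltr_norml => /andP[? ?] /andP[? ?] /andP[? ?]; apply/andP; split; lra.
Qed.

End dyadic_series.

(** * Tame functions *)

Section tame_functions.
Context {R : realType}.
Local Notation RR := (measurableTypeR R).
Variables (D : set nat) (I : nat -> interval R) (s : forall n, scale_function (I n)).
Local Notation energy := (energy_bound D s).

Let s_le n y z : y \in I n -> z \in I n -> y <= z -> s n y <= s n z.
Proof. exact: scale_le. Qed.

Lemma energy_bound_lipschitz (f N v : R -> R) (C : R) : energy f N -> 0 <= C ->
  (forall x y, x <= y -> `|v y - v x| <= C * (f y - f x)) ->
  energy v (fun x => C ^+ 2 * N x).
Proof.
move=> [ndN fN] C0 vf; split=> [x y xy|n y z Dn yI zI yz].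
  by rewrite ler_wpM2l ?sqr_ge0// ndN.
rewrite -mulrBr mulrCA; apply: le_trans (ler_wpM2l (sqr_ge0 C) (fN n y z Dn yI zI yz)).
rewrite -exprMn -real_normK ?num_real// lerXn2r ?nnegrE ?vf//.
by apply: le_trans (vf y z yz); exact: normr_ge0.
Qed.

(** The bounds on f and N are normalized so that dyadic series of such functions
    converge. *)
Variant dominates (f N : R -> R) (C : R) (v : R -> R) : Prop := Dominates of
  {homo f : x y / x <= y} & continuous f & (forall x, 0 <= f x <= 1) &
  energy f N & (forall x, 0 <= N x <= 1) &
  0 <= C & (forall x y, x <= y -> `|v y - v x| <= C * (f y - f x)).

Definition tame v := Cc v /\ exists f N C, dominates f N C v.

Lemma Cc_midpoint (v w : R -> R) : Cc v -> Cc w -> Cc (fun x => (v x + w x) / 2).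
Proof.
move=> Cv Cw; have [A A0 vA] := Cc_support Cv; have [B B0 wB] := Cc_support Cw.
apply: (@Cc_intro _ _ (Num.max A B)).
  move=> x; apply: cvgM; last exact: cvg_cst.
  by apply: cvgD; [exact: Cv.1|exact: Cw.1].
by move=> x; rewrite ge_max => /andP[/vA -> /wB ->]; rewrite addr0 mul0r.
Qed.

Lemma tame_midpoint v w : tame v -> tame w -> tame (fun x => (v x + w x) / 2).
Proof.
move=> [Cv [f [N [C [ndf cf f1 [ndN fN] N1 C0 vf]]]]] [Cw [g [M [B [ndg cg g1 [ndM gM] M1 B0 wg]]]]].
split; first exact: Cc_midpoint.
exists (fun x => (f x + g x) / 2), (fun x => (N x + M x) / 2), (C + B); split.
- by move=> x y xy; have := ndf x y xy; have := ndg x y xy; lra.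
- move=> x; apply: cvgM; last exact: cvg_cst.
  by apply: cvgD; [exact: cf|exact: cg].
- by move=> x; have := f1 x; have := g1 x; lra.
- split=> [x y xy|n y z Dn yI zI yz]; first by have := ndN x y xy; have := ndM x y xy; lra.
  have := fN n y z Dn yI zI yz; have := gM n y z Dn yI zI yz.
  move: (s n z - s n y) (f y) (f z) (g y) (g z) (N y) (N z) (M y) (M z) => sn a b c d p q r t h1 h2.
  have h3 := sqr_ge0 ((b - a) - (d - c)).
  have -> : ((b + d) / 2 - (a + c) / 2) = ((b - a) + (d - c)) / 2 by lra.
  have -> : sn * ((q + t) / 2 - (p + r) / 2) = (sn * (q - p) + sn * (t - r)) / 2 by lra.
  move: h1 h2 h3; move: (b - a) (d - c) (sn * (q - p)) (sn * (t - r)) => x1 x2 X1 X2 h1 h2 h3.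
  by move: h1 h2 h3; rewrite !expr2; nra.
- by move=> x; have := N1 x; have := M1 x; lra.
- exact: addr_ge0.
- move=> x y xy; have g0 : 0 <= g y - g x by rewrite subr_ge0 ndg.
  have f0 : 0 <= f y - f x by rewrite subr_ge0 ndf.
  rewrite (_ : _ - _ = ((v y - v x) + (w y - w x)) / 2); last by lra.
  rewrite normrM [X in _ * X]ger0_norm ?invr_ge0//.
  have h1 := vf x y xy; have h2 := wg x y xy; have h3 := ler_normD (v y - v x) (w y - w x).
  have h4 := mulr_ge0 C0 g0; have h5 := mulr_ge0 B0 f0.
  rewrite (_ : (C + B) * _ = (C * (f y - f x) + B * (g y - g x) + C * (g y - g x) + B * (f y - f x)) / 2).
    by rewrite ler_pM2r ?invr_gt0//; lra.
  by field.
Qed.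

Lemma tame0 : tame (cst 0).
Proof.
split; first by apply: (@Cc_intro _ _ 0) => //; exact: cst_continuous.
exists (cst 0), (cst 0), 0; split=> //=.
- exact: cst_continuous.
- by move=> x; rewrite lexx ler01.
- by split=> // n y z Dn yI zI yz /=; rewrite !subrr expr0n mulr0.
- by move=> x; rewrite lexx ler01.
- by move=> x y xy; rewrite subrr normr0 mul0r.
Qed.

(** The dyadic series of the functions f_j and N_j attached to the v_j. The energy
    bound passes to the series by the Cauchy-Schwarz inequality, because the
    weights add up to at most 1. *)
Lemma tame_series (v : nat -> R -> R) : (forall j, tame (v j)) ->
  exists f N, [/\ {homo f : x y / x <= y}, continuous f, energy f N,
    forall x, 0 <= N x <= 1 &
    forall j, exists2 C, 0 <= C & forall x y, x <= y -> `|v j y - v j x| <= C * (f y - f x)].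
Proof.
move=> tv.
have /choice[g /choice[M /choice[C dom]]] j : exists f N C, dominates f N C (v j) := (tv j).2.
have g1 j x : 0 <= g j x <= 1 by case: (dom j).
have M1 j x : 0 <= M j x <= 1 by case: (dom j).
have ndg j : {homo g j : x y / x <= y} by case: (dom j).
have ndM j : {homo M j : x y / x <= y} by case: (dom j) => _ _ _ [].
have wge0 j : 0 <= 2 ^- j :> R by rewrite ltW// half_pow_gt0.
have nds (h : nat -> R -> R) n x y : (forall j, {homo h j : x y / x <= y}) -> x <= y ->
    dyadic_sum h n x <= dyadic_sum h n y.
  by move=> ndh xy; apply: ler_sum => j _; rewrite ler_wpM2l// ndh.
have [f Hf] := dyadic_series g1; have [N HN] := dyadic_series M1.
have cvgf x y : dyadic_sum g n y - dyadic_sum g n x @[n --> \oo] --> f y - f x.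
  by apply: cvgB; [exact: (Hf y).1|exact: (Hf x).1].
have cvgN x y : dyadic_sum M n y - dyadic_sum M n x @[n --> \oo] --> N y - N x.
  by apply: cvgB; [exact: (HN y).1|exact: (HN x).1].
exists f, N; split.
- move=> x y xy; apply: (ler_cvg_to (Hf x).1 (Hf y).1); near=> n; exact: nds.
- apply: (@dyadic_series_continuous _ g); first by move=> j; case: (dom j).
  by move=> x n; exact: (Hf x).2.
- split=> [x y xy|n y z Dn yI zI yz].
    apply: (ler_cvg_to (HN x).1 (HN y).1); near=> n; exact: nds.
  rewrite expr2; apply: (ler_cvg_to (cvgM (cvgf y z) (cvgf y z))
    (cvgM (cvg_cst (s n z - s n y)) (cvgN y z))).
  near=> k; rewrite /= -[leLHS]expr2 /dyadic_sum -!sumrB.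
  pose a j : R := 2 ^- j.+1 * (s n z - s n y); pose b j := 2 ^- j.+1 * (M j z - M j y).
    have s0 : 0 <= s n z - s n y by rewrite subr_ge0 s_le.
    apply: le_trans (@cauchy_schwarz_seq R nat (index_iota 0 k)
      (fun j => 2 ^- j.+1 * g j z - 2 ^- j.+1 * g j y) a b _) _.
      move=> j _; have gM : energy (g j) (M j) by case: (dom j).
      have Mj : 0 <= M j z - M j y by rewrite subr_ge0 ndM.
      split; [exact: mulr_ge0|exact: mulr_ge0|].
      rewrite /a /b -mulrBr exprMn [leRHS]mulrACA -expr2.
      apply: ler_wpM2l; first exact: sqr_ge0.
      exact: gM.2.
    rewrite [X in _ <= _ * X](_ : _ = \sum_(0 <= i < k) b i); last first.
      by apply: eq_bigr => i _; rewrite /b mulrBr.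
    rewrite /a -mulr_suml ler_wpM2r//.
      by apply: sumr_ge0 => j _; rewrite /b mulr_ge0// subr_ge0 ndM.
    rewrite ler_piMl//.
    exact: half_pow_sum.
- move=> x; have /andP[h1 h2] := (HN x).2 0%N; move: h1 h2.
  by rewrite /dyadic_sum big_nil add0r expr0 invr1 => -> ->.
- move=> j; have [_ _ _ _ _ C0 vg] := dom j.
  exists (C j * 2 ^+ j.+1) => [|x y xy]; first by rewrite mulr_ge0// exprn_ge0.
  apply: le_trans (vg x y xy) _; rewrite -mulrA ler_wpM2l// -ler_pdivrMl ?exprn_gt0//.
  apply: (ler_cvg_to (cvg_cst _) (cvgf x y)); near=> n.
  have jn : (j < n)%N by near: n; exact: nbhs_infty_gt.
  rewrite /dyadic_sum -sumrB (bigD1_seq j)/= ?mem_index_iota ?iota_uniq// -mulrBr lerDl.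
  by apply: sumr_ge0 => i _; rewrite -mulrBr mulr_ge0// subr_ge0 ndg.
Unshelve. all: by end_near. Qed.

Variables (m : {measure set RR -> \bar R}) (F : set (R -> R)) (E : (R -> R) -> (R -> R) -> R).
Hypotheses (rm : radon m) (fs : full_support m) (dF : dirichlet_form m F E).
Hypotheses (eI : effective_intervals D s) (rep : represents m D s F E).

Lemma dominated_domain f N C v : Cc v -> energy f N -> (forall x, 0 <= N x <= 1) -> 0 <= C ->
  (forall x y, x <= y -> `|v y - v x| <= C * (f y - f x)) ->
  F v /\ E v v <= C ^+ 2 / 2.
Proof.
move=> Cv fN N1 C0 vf.
apply: (energy_bound_domain rm eI rep Cv (energy_bound_lipschitz fN C0 vf)) => x.
by have /andP[N0 N1'] := N1 x; rewrite mulr_ge0 ?sqr_ge0//= ler_piMr// sqr_ge0.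
Qed.

Lemma tame_domain v : tame v -> F v.
Proof.
move=> [Cv [f [N [C [_ _ _ fN N1 C0 vf]]]]].
by have [] := dominated_domain Cv fN N1 C0 vf.
Qed.

Lemma tame_approximation (u : R -> R) (A e : R) : F u -> continuous u -> 0 < A ->
  (forall x, A <= `|x| -> u x = 0) -> 0 < e ->
  exists v, [/\ tame v, forall x, A <= `|x| -> v x = 0, forall x, `|v x - u x| < e &
    E v v <= E u u].
Proof.
move=> Fu cu A0 uA e0.
have [N [uN N2]] := domain_energy_bound fs dF eI rep Fu cu.
have ndN := uN.1.
have [v [f [V [[cv vA] vu [ndf cf fV] fN vf]]]] := monotone_approximation ndN cu uN A0 uA e0.
have Cv : Cc v := Cc_intro cv vA.
exists v; split => //; last first.
  have vN : energy v N.
    rewrite (_ : N = fun x => 1 ^+ 2 * N x); last by apply/funext => x; rewrite expr1n mul1r.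
    by apply: (energy_bound_lipschitz fN) => // x y xy; rewrite mul1r vf.
  have [_] := energy_bound_domain rm eI rep Cv vN N2.
  by rewrite mulrAC divff// mul1r.
split=> //.
(* dividing f by k and N by k ^ 2 brings both into [0, 1], as V and 2 E u u
   bound f and N *)
pose k := 1 + V + 2 * E u u.
have V0 : 0 <= V by have /andP[h1 h2] := fV 0; exact: le_trans h2.
have Eu0 : 0 <= E u u := df_E_ge0 dF Fu.
have k1 : 1 <= k by rewrite /k; lra.
have k0 : 0 < k by exact: lt_le_trans k1.
have kk : k <= k ^+ 2 by rewrite expr2 ler_pMr.
exists (fun x => k^-1 * f x), (fun x => k^-1 ^+ 2 * N x), k; split => //.
- by move=> x y xy; rewrite ler_pM2l ?invr_gt0// ndf.
- by move=> x; apply: cvgM; [exact: cvg_cst|exact: cf].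
- move=> x; have /andP[f0 fle] := fV x; rewrite mulr_ge0 ?invr_ge0 ?(ltW k0)//=.
  by rewrite ler_pdivrMl// mulr1; apply: le_trans fle _; rewrite /k; lra.
- apply: (energy_bound_lipschitz fN); first by rewrite invr_ge0 ltW.
  move=> x y xy; rewrite -mulrBr ger0_norm//.
  by rewrite mulr_ge0 ?invr_ge0 ?(ltW k0)// subr_ge0 ndf.
- move=> x; have /andP[N0 Nle] := N2 x; rewrite mulr_ge0 ?sqr_ge0//=.
  rewrite exprVn ler_pdivrMl ?exprn_gt0// mulr1; apply: le_trans kk.
  by apply: le_trans Nle _; rewrite /k; lra.
- exact: ltW.
- by move=> x y xy; rewrite -mulrBr mulrA divff ?gt_eqF// mul1r vf.
Qed.

End tame_functions.

(** * Convergence of near-minimizers of the energy *)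

Section square_integrable.
Context {R : realType}.
Local Notation RR := (measurableTypeR R).
Variables (m : {measure set RR -> \bar R}).
Implicit Types u v w : R -> R.

Definition norm2 u : R := \int[m]_x (u x * u x).

Lemma Lfun2_sub u v : u \in Lfun m 2%:E -> v \in Lfun m 2%:E -> u \- v \in Lfun m 2%:E.
Proof.
move=> u2 v2; have p1 : (1 <= 2%:E :> \bar R)%E by rewrite lee_fin ler1n.
have [_ addm] := Lfun_addr_closed m p1; have oppm := @Lfun_oppr_closed _ _ _ m 2%:E.
exact: (addm _ _ u2 (oppm _ v2)).
Qed.

Lemma norm2_ge0 u : 0 <= norm2 u.
Proof. by apply: Rintegral_ge0 => x _; rewrite -expr2 sqr_ge0. Qed.

Lemma norm2_sym u v : norm2 (u \- v) = norm2 (v \- u).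
Proof. by congr Rintegral; apply/funext => x /=; rewrite -mulrNN !opprB. Qed.

Lemma norm2_integrable u : u \in Lfun m 2%:E ->
  m.-integrable setT (EFin \o (fun x => u x * u x)).
Proof. by move=> u2; apply/Lfun1_integrable; exact: Lfun2_mul_Lfun1. Qed.

Lemma norm2_triangle u v w : u \in Lfun m 2%:E -> v \in Lfun m 2%:E -> w \in Lfun m 2%:E ->
  norm2 (u \- w) <= 2 * norm2 (u \- v) + 2 * norm2 (v \- w).
Proof.
move=> u2 v2 w2.
have iuv := norm2_integrable (Lfun2_sub u2 v2).
have ivw := norm2_integrable (Lfun2_sub v2 w2).
have iuw := norm2_integrable (Lfun2_sub u2 w2).
have iZ f : m.-integrable setT (EFin \o f) -> m.-integrable setT (EFin \o (fun x => 2 * f x)).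
  by move=> fi; exact: (@integrableZl _ _ _ m setT measurableT 2 (EFin \o f) fi).
rewrite /norm2 -!RintegralZl// -RintegralD//; [|exact: iZ|exact: iZ].
apply: le_Rintegral => //.
  exact: (@integrableD _ _ _ m setT measurableT _ _ (iZ _ iuv) (iZ _ ivw)).
move=> x _ /=; have := sqr_ge0 ((u x - v x) - (v x - w x)).
rewrite (_ : u x - w x = (u x - v x) + (v x - w x)); last by rewrite addrA subrK.
by move: (u x - v x) (v x - w x) => a b; rewrite expr2; nra.
Qed.

Lemma norm2_eq0 u v : u \in Lfun m 2%:E -> v \in Lfun m 2%:E -> norm2 (u \- v) = 0 ->
  u = v %[ae m].
Proof.
move=> u2 v2 uv0; have iuv := norm2_integrable (Lfun2_sub u2 v2).
have /integrableP[muv _] := iuv.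
have int0 : (\int[m]_x `|((u \- v) x * (u \- v) x)%:E| = 0)%E.
  rewrite (_ : (fun x => _) = (fun x => ((u \- v) x * (u \- v) x)%:E)); last first.
    by apply/funext => x; rewrite gee0_abs// lee_fin -expr2 sqr_ge0.
  by rewrite -[LHS]fineK ?(integrable_fin_num _ iuv)//; exact: (congr1 EFin uv0).
have := (ae_eq_integral_abs m measurableT muv).1 int0.
apply: filterS.
by move=> x /(_ I) /= [] /eqP; rewrite mulf_eq0 orbb subr_eq0 => /eqP.
Qed.

Lemma norm2_small (u : R -> R) (A e : R) : radon m -> continuous u ->
  (forall x, A <= `|x| -> u x = 0) -> (forall x, `|u x| <= e) ->
  norm2 u <= fine (m `[- A, A]%classic) * e ^+ 2.
Proof.
move=> rm cu uA ue.
have e0 : 0 <= e by apply: le_trans (ue 0); exact: normr_ge0.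
have mA : measurable (`[- A, A]%classic : set RR) by exact: measurable_itv.
have mAoo : (m `[(- A)%R, A]%classic < +oo)%E by apply: rm; exact: segment_compact.
have mAfin : m `[(- A)%R, A]%classic \is a fin_num by rewrite ge0_fin_numE.
have mu_ : measurable_fun (setT : set RR) u by exact: continuous_measurable_fun.
have key : (\int[m]_x (u x * u x)%:E <= (fine (m `[(- A)%R, A]%classic) * e ^+ 2)%:E)%E.
  have -> : (\int[m]_x (u x * u x)%:E = \int[m]_(x in `[(- A)%R, A]) (u x * u x)%:E)%E.
    rewrite [RHS]integral_mkcond; apply: eq_integral => x _.
    rewrite !patchE; case: (boolP (x \in (`[(- A)%R, A]%classic : set R))) => //.
    rewrite notin_setE /= in_itv/= -ler_norml => /negP; rewrite -ltNge => Ax.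
    by rewrite (uA x (ltW Ax)) mulr0.
  apply: (@le_trans _ _ (\int[m]_(x in `[(- A)%R, A]) (cst (e ^+ 2)%:E) x)%E).
    apply: ge0_le_integral => //=.
    - by move=> x _; rewrite lee_fin -expr2 sqr_ge0.
    - by apply/measurable_EFinP; apply: measurable_funM; exact: measurable_funTS.
    - move=> x _; rewrite lee_fin -expr2 -real_normK ?num_real// lerXn2r ?nnegrE//.
  by rewrite integral_cst// [leRHS]EFinM fineK// muleC.
rewrite /norm2 /Rintegral -lee_fin fineK// ge0_fin_numE.
  by apply: le_lt_trans key _; rewrite ltry.
by apply: integral_ge0 => x _; rewrite lee_fin -expr2 sqr_ge0.
Qed.

End square_integrable.

Section energy_form.
Context {R : realType}.
Local Notation RR := (measurableTypeR R).
Variables (m : {measure set RR -> \bar R}).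
Variables (F : set (R -> R)) (E : (R -> R) -> (R -> R) -> R).
Hypothesis dF : dirichlet_form m F E.
Implicit Types u v w : R -> R.

Lemma form_lin (a : R) u v : F u -> F v ->
  E (fun x => a * u x + v x) (fun x => a * u x + v x) =
  a ^+ 2 * E u u + 2 * a * E u v + E v v.
Proof.
move=> Fu Fv; have Fw := df_lin dF a Fu Fv.
rewrite (df_E_lin dF) // (df_E_sym dF Fu Fw) (df_E_sym dF Fv Fw) !(df_E_lin dF)//.
by rewrite (df_E_sym dF Fv Fu); ring.
Qed.

Lemma form_sub_closed u v : F u -> F v -> F (u \- v).
Proof.
move=> Fu Fv; rewrite (_ : u \- v = fun x => - 1 * v x + u x); first exact: (df_lin dF).
by apply/funext => x; rewrite mulN1r addrC.
Qed.

Lemma form_parallelogram u v : F u -> F v ->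
  E (u \- v) (u \- v) =
  2 * E u u + 2 * E v v - 4 * E (fun x => (u x + v x) / 2) (fun x => (u x + v x) / 2).
Proof.
move=> Fu Fv; have Fd := form_sub_closed Fu Fv.
rewrite (_ : (fun x => (u x + v x) / 2) = fun x => 2^-1 * (u \- v) x + v x); last first.
  by apply/funext => x /=; lra.
rewrite form_lin//; have := form_lin 1 Fd Fv.
rewrite (_ : (fun x => 1 * (u \- v) x + v x) = u); last by apply/funext => x /=; lra.
by move=> ->; field.
Qed.

Lemma form_sub_sym u v : F u -> F v -> E (u \- v) (u \- v) = E (v \- u) (v \- u).
Proof.
move=> Fu Fv; rewrite !form_parallelogram//.
have -> : (fun x => (u x + v x) / 2) = (fun x => (v x + u x) / 2).
  by apply/funext => x; rewrite [u x + _]addrC.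
by lra.
Qed.

Lemma E1_sub_sym u v : F u -> F v ->
  E1 m E (u \- v) (u \- v) = E1 m E (v \- u) (v \- u).
Proof.
by move=> Fu Fv; rewrite /E1 -!/(norm2 m _) norm2_sym form_sub_sym.
Qed.

Lemma form_triangle u v w : F u -> F v -> F w ->
  E1 m E (u \- w) (u \- w) <= 2 * E1 m E (u \- v) (u \- v) + 2 * E1 m E (v \- w) (v \- w).
Proof.
move=> Fu Fv Fw; have h := norm2_triangle (df_L2 dF Fu) (df_L2 dF Fv) (df_L2 dF Fw).
have Fa := form_sub_closed Fu Fv; have Fb := form_sub_closed Fv Fw.
have := form_parallelogram Fa Fb; have := df_E_ge0 dF (form_sub_closed Fa Fb).
have := form_lin 1 (form_sub_closed Fa Fb) Fb.
have := form_lin 2 Fb (form_sub_closed Fa Fb).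
rewrite (_ : (fun x => 2 * (v \- w) x + ((u \- v) \- (v \- w)) x) = u \- w); last first.
  by apply/funext => x /=; lra.
rewrite (_ : (fun x => 1 * ((u \- v) \- (v \- w)) x + (v \- w) x) = u \- v); last first.
  by apply/funext => x /=; lra.
rewrite /E1 -!/(norm2 m _) (df_E_sym dF Fb (form_sub_closed Fa Fb)) => h1 h2 h3 h4.
by rewrite h1 h2; move: h h3; lra.
Qed.

Definition midpoint_convex (B : set (R -> R)) :=
  forall u v, B u -> B v -> B (fun x => (u x + v x) / 2).

Definition near_minimizer (B : set (R -> R)) (d : R) v :=
  B v /\ forall w, B w -> E v v <= E w w + d.

Lemma near_minimizer_exists (B : set (R -> R)) (d : R) :
  B `<=` F -> B !=set0 -> 0 < d -> exists v, near_minimizer B d v.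
Proof.
move=> BF [w0 Bw0] d0; pose S := [set E w w | w in B].
have hS : has_inf S.
  split; first by exists (E w0 w0), w0.
  by exists 0 => _ [w Bw <-]; exact: (df_E_ge0 dF (BF _ Bw)).
have [_ [v Bv <-] vd] := inf_adherent d0 hS.
exists v; split=> // w Bw; apply: (le_trans (ltW vd)).
by rewrite lerD2r; apply: ge_inf; [exact: hS.2|exists w].
Qed.

(** A form of the Banach-Saks theorem that avoids weak convergence. The infima
    r_k of the energy over B_k are nondecreasing and bounded, hence converge.
    For p <= q the midpoint of v_p and v_q lies in B_p, so that its energy is at
    least r_p, and the parallelogram identity makes E (v_p - v_q) small. So
    (v_k) is a Cauchy sequence for E1, and its limit is u because v_k tends to u
    in L^2. *)
Lemma near_minimizers_converge (B : nat -> set (R -> R)) (v : nat -> R -> R)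
    (u : R -> R) (A C : R) :
  radon m -> Cc u -> (forall x, A <= `|x| -> u x = 0) ->
  (forall k, B k `<=` F) -> (forall k, B k.+1 `<=` B k) ->
  (forall k, midpoint_convex (B k)) ->
  (forall k, exists2 w, B k w & E w w <= C) ->
  (forall k w, B k w -> [/\ continuous w, forall x, A <= `|x| -> w x = 0 &
     forall x, `|w x - u x| <= k.+1%:R^-1]) ->
  (forall k, near_minimizer (B k) k.+1%:R^-1 (v k)) ->
  forall e, 0 < e -> exists n, forall k, (n <= k)%N -> E1 m E (v k \- u) (v k \- u) < e.
Proof.
move=> rm Cu uA BF Bdec Bmid Bbd Bcl vmin.
have BV k : B k (v k) := (vmin k).1.
have Fv k : F (v k) := BF _ _ (BV k).
have sub p q : (p <= q)%N -> B q `<=` B p.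
  by move=> /subnK <-; elim: (q - p)%N => // n ih; apply: subset_trans ih; exact: Bdec.
pose S k := [set E w w | w in B k]; pose r k := inf (S k).
have hS k : has_inf (S k).
  split; first by exists (E (v k) (v k)), (v k).
  by exists 0 => _ [w Bw <-]; exact: (df_E_ge0 dF (BF _ _ Bw)).
have r_le k w : B k w -> r k <= E w w.
  by move=> Bw; apply: ge_inf; [exact: (hS k).2|exists w].
have rv k : E (v k) (v k) <= r k + k.+1%:R^-1.
  rewrite -lerBlDr; apply: lb_le_inf; first exact: (hS k).1.
  by move=> _ [w Bw <-]; rewrite lerBlDr; exact: (vmin k).2.
have ndr : {homo r : p q / (p <= q)%N >-> p <= q}.
  move=> p q pq; apply: lb_le_inf; first exact: (hS q).1.
  by move=> _ [w Bw <-]; apply: r_le; exact: (sub p q pq).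
have ubr : has_ubound (range r).
  exists C => _ [k _ <-]; have [w Bw wC] := Bbd k; exact: le_trans (r_le k w Bw) wC.
have close e : 0 < e -> exists n, forall p q, (n <= p)%N -> (p <= q)%N ->
    E (v p \- v q) (v p \- v q) < e.
  move=> e0; have e8 : 0 < e / 8 by rewrite divr_gt0.
  have /cvgrPdist_lt/(_ _ e8)[n1 _ Hn1] := nondecreasing_cvgn ndr ubr.
  have [n2 Hn2] := inv_succ_lt e8; exists (maxn n1 n2) => p q; rewrite geq_max => /andP[n1p n2p] pq.
  have rp : `|sup (range r) - r p| < e / 8 := Hn1 p n1p.
  have rq : `|sup (range r) - r q| < e / 8 := Hn1 q (leq_trans n1p pq).
  have dp := Hn2 p n2p; have dq := Hn2 q (leq_trans n2p pq).
  have Bm := Bmid p _ _ (BV p) (sub _ _ pq _ (BV q)).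
  rewrite form_parallelogram//; have := r_le p _ Bm; have := rv p; have := rv q.
  move: rp rq dp dq; rewrite !ltr_norml.
  move: (E _ _) (E _ _) (E _ _) (r p) (r q) (sup _) (p.+1%:R^-1) (q.+1%:R^-1).
  by move=> a1 a2 a3 a4 a5 a6 a7 a8 /andP[? ?] /andP[? ?]; lra.
have u2 : u \in Lfun m 2%:E.
  by have := Cc_Lfun2 rm Cu (@measurableT _ RR); rewrite patch_setT.
pose K := fine (m `[- A, A]%classic).
have K0 : 0 <= K by rewrite fine_ge0.
have Q k : norm2 m (v k \- u) <= K * k.+1%:R^-1.
  have [cv vA vu] := Bcl k _ (BV k).
  apply: (@le_trans _ _ (K * k.+1%:R^-1 ^+ 2)).
    apply: norm2_small => //.
      by move=> x; apply: cvgB; [exact: cv|exact: Cu.1].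
    by move=> x Ax /=; rewrite vA// uA// subrr.
  by rewrite ler_wpM2l// expr2 ler_piMr ?invr_ge0// invf_le1// ler1n.
have Qsmall e : 0 < e -> exists n, forall k, (n <= k)%N -> norm2 m (v k \- u) < e.
  move=> e0; have eK : 0 < e / (K + 1) by rewrite divr_gt0// ltr_wpDl.
  have [n Hn] := inv_succ_lt eK; exists n => k nk; apply: le_lt_trans (Q k) _.
  have := Hn k nk; rewrite ltr_pdivlMr ?ltr_wpDl// => h.
  apply: le_lt_trans h; rewrite mulrC ler_wpM2l ?invr_ge0// lerDl//.
have [e e0|u' Fu' Hu'] := df_closed dF Fv.
  have e2 : 0 < e / 2 by rewrite divr_gt0.
  have e8 : 0 < e / 8 by rewrite divr_gt0.
  have [n1 H1] := close _ e2; have [n2 H2] := Qsmall _ e8.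
  exists (maxn n1 n2) => p q; rewrite !geq_max => /andP[n1p n2p] /andP[n1q n2q].
  rewrite /E1 -/(norm2 m _) [ltRHS]splitr; apply: ltrD.
    have [pq|/ltnW qp] := leqP p q; first exact: H1.
    by rewrite form_sub_sym//; exact: H1.
  apply: le_lt_trans (norm2_triangle (df_L2 dF (Fv p)) u2 (df_L2 dF (Fv q))) _.
  have := H2 p n2p; have := H2 q n2q; rewrite (norm2_sym m u). lra.
have E1v k : norm2 m (v k \- u') <= E1 m E (v k \- u') (v k \- u').
  by rewrite /E1 -/(norm2 m _) lerDr; apply: (df_E_ge0 dF); exact: form_sub_closed.
have u'2 := df_L2 dF Fu'.
have uu' : u = u' %[ae m].
  apply: norm2_eq0 => //; apply/eqP; rewrite eq_le norm2_ge0 andbT.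
  apply/ler_addgt0Pr => e e0; rewrite add0r.
  have e4 : 0 < e / 4 by rewrite divr_gt0.
  have /cvgrPdist_lt/(_ _ e4)[n1 _ H1] := Hu'; have [n2 H2] := Qsmall _ e4.
  pose n := maxn n1 n2.
  have := H1 n (leq_maxl _ _); have := H2 n (leq_maxr _ _) => /= h2.
  rewrite sub0r normrN => h1.
  have h3 := le_lt_trans (ler_norm _) h1; have h4 := E1v n.
  apply: le_trans (norm2_triangle u2 (df_L2 dF (Fv n)) u'2) _.
  by rewrite (norm2_sym m u); lra.
have Fu : F u.
  apply: (df_ae dF Fu' u2); move: uu'; apply: filterS; first exact: (ae_filter_ringOfSetsType m).
  by move=> x /(_ I) ->.
have Eeq k : E (v k \- u) (v k \- u) = E (v k \- u') (v k \- u').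
  have ae : (v k \- u) = (v k \- u') %[ae m].
    move: uu'; apply: filterS; first exact: (ae_filter_ringOfSetsType m).
    by move=> x /(_ I) /= ->.
  have Fd := form_sub_closed (Fv k) Fu; have Fd' := form_sub_closed (Fv k) Fu'.
  by rewrite (df_E_ae dF Fd Fd' Fd ae) (df_E_sym dF Fd' Fd) (df_E_ae dF Fd Fd' Fd' ae).
move=> e e0; have e2 : 0 < e / 2 by rewrite divr_gt0.
have /cvgrPdist_lt/(_ _ e2)[n1 _ H1] := Hu'; have [n2 H2] := Qsmall _ e2.
exists (maxn n1 n2) => k; rewrite geq_max => /andP[n1k n2k].
rewrite /E1 -/(norm2 m _) [ltRHS]splitr Eeq ltrD ?H2//.
have := H1 k n1k; rewrite /= sub0r normrN; apply: le_lt_trans.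
by apply: le_trans (ler_norm _); rewrite /E1 lerDl norm2_ge0.
Qed.

End energy_form.

(** * A countable family of tame functions *)

Section rational_tubes.
Context {R : realType}.
Implicit Types (v u : R -> R) (L : seq (rat * rat * rat * rat)).

(** A condition on the graph of v with rational data. There are countably many
    such conditions, and they separate continuous functions. *)
Definition in_tube L v := forall a b p q, (a, b, p, q) \in L ->
  forall x : R, ratr a <= x <= ratr b -> ratr p < v x < ratr q.

Lemma in_tube_midpoint L : midpoint_convex (in_tube L).
Proof.
move=> u v Lu Lv a b p q abpq x xab.
by have := Lu _ _ _ _ abpq x xab; have := Lv _ _ _ _ abpq x xab; lra.
Qed.

Lemma in_tube_flatten (L : nat -> seq (rat * rat * rat * rat)) k v :
  in_tube (flatten [seq L i | i <- iota 0 k]) v <-> forall i, (i < k)%N -> in_tube (L i) v.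
Proof.
split=> [H i ik a b p q abpq|H a b p q /flattenP[_ /mapP[i + ->]]].
  apply: H; apply/flattenP; exists (L i) => //; apply: map_f.
  by rewrite mem_iota add0n.
by rewrite mem_iota add0n => /= ik; exact: H.
Qed.

(** The interval [- A, A] is cut into cells on which u oscillates by less than
    e / 4; around u, the rational bounds leave a margin of e / 8. *)
Lemma rational_tube u (A : nat) (e : R) : continuous u -> 0 < e ->
  exists L, exists2 d, 0 < d &
    (forall v, in_tube L v -> forall x, `|x| <= A%:R -> `|v x - u x| < e) /\
    (forall v, (forall x, `|v x - u x| < d) -> in_tube L v).
Proof.
move=> cu e0; have e4 : 0 < e / 4 by rewrite divr_gt0.
have [d d0 Hd] := heine (- A%:R) A%:R cu e4.
have [n /(_ n (leqnn n)) nd] := inv_succ_lt d0.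
pose k := (2 * A * n.+1)%N.
pose a (i : nat) : rat := - A%:R + n.+1%:R^-1 * i%:R.
pose a' i : R := - A%:R + n.+1%:R^-1 * i%:R.
have aE i : ratr (a i) = a' i.
  by rewrite /a /a' rmorphD rmorphN rmorphM fmorphV !rmorph_nat.
have n0 : 0 < n.+1%:R^-1 :> R by rewrite invr_gt0.
have aS i : a' i.+1 - a' i = n.+1%:R^-1 by rewrite /a' -[i.+1%:R]natr1; ring.
have aA i : - A%:R <= a' i by rewrite lerDl mulr_ge0// ltW.
have aA' i : (i < k.+1)%N -> a' i <= A%:R.
  move=> ik; rewrite /a' addrC lerBlDr ler_pdivrMl//.
  by rewrite -!natrD -natrM ler_nat; move: ik; rewrite /k ltnS; lia.
have /choice[P HP] i : exists p : rat, u (a' i) - e / 2 < ratr p < u (a' i) - 3 * e / 8.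
  have /rat_in_itvoo[p] : u (a' i) - e / 2 < u (a' i) - 3 * e / 8 by lra.
  by rewrite in_itv/=; exists p.
have /choice[Q HQ] i : exists q : rat, u (a' i) + 3 * e / 8 < ratr q < u (a' i) + e / 2.
  have /rat_in_itvoo[p] : u (a' i) + 3 * e / 8 < u (a' i) + e / 2 by lra.
  by rewrite in_itv/=; exists p.
have cell i x : (i < k.+1)%N -> a' i <= x -> x <= a' i.+1 -> `|u (a' i) - u x| < e / 4.
  move=> ik ax xa; apply: Hd => //; first exact: aA'.
  rewrite distrC ger0_norm ?subr_ge0//; apply: le_lt_trans nd.
  by rewrite -(aS i) lerD2r.
exists [seq (a i, a i.+1, P i, Q i) | i <- iota 0 k.+1], (e / 8); first by rewrite divr_gt0.
split=> v Hv.
  move=> x; rewrite ler_norml => /andP[Ax xA].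
  have [//||i ik /andP[ax xa]] := @grid_cell _ n.+1%:R^-1 (- A%:R) x k.
    apply: (le_trans xA); rewrite -lerBlDl opprK ler_pdivlMl//.
    by rewrite -natrD -natrM ler_nat /k; lia.
  have := Hv (a i) (a i.+1) (P i) (Q i); rewrite !aE => /(_ _ x).
  rewrite map_f ?mem_iota//= => /(_ isT); rewrite ax xa => /(_ isT).
  have := cell i x ik ax xa; have := HP i; have := HQ i.
  by rewrite !ltr_norml; lra.
move=> b c p q /mapP[i]; rewrite mem_iota add0n => /= ik [-> -> -> ->] x.
rewrite !aE => /andP[ax xa].
have := cell i x ik ax xa; have := HP i; have := HQ i; have := Hv x.
by rewrite !ltr_norml; lra.
Qed.

End rational_tubes.

Section countable_selection.
Context {R : realType}.
Local Notation RR := (measurableTypeR R).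
Variables (D : set nat) (I : nat -> interval R) (s : forall n, scale_function (I n)).
Variables (m : {measure set RR -> \bar R}) (F : set (R -> R)) (E : (R -> R) -> (R -> R) -> R).
Hypotheses (rm : radon m) (fs : full_support m) (dF : dirichlet_form m F E).
Hypotheses (eI : effective_intervals D s) (rep : represents m D s F E).

Definition tame_tube (A : nat) (L : seq (rat * rat * rat * rat)) : set (R -> R) :=
  [set v | [/\ tame D s v, forall x, A%:R <= `|x| -> v x = 0 & in_tube L v]].

Lemma tame_tube_midpoint A L : midpoint_convex (tame_tube A L).
Proof.
move=> v w [tv vA Lv] [tw wA Lw]; split; [exact: tame_midpoint| |exact: in_tube_midpoint].
by move=> x Ax; rewrite vA// wA// addr0 mul0r.
Qed.

(** For each tube and each precision, a near-minimizer of the energy among the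
    tame functions of the tube is selected. Tubes shrinking to u can be taken
    decreasing; they contain tame functions of energy at most E u u, so that
    [near_minimizers_converge] applies to them. *)
Lemma countable_selection : exists v : nat -> R -> R, (forall j, tame D s (v j)) /\
  forall u, F u -> Cc u -> forall e, 0 < e -> exists2 j,
    forall x, `|v j x - u x| < e & E1 m E (v j \- u) (v j \- u) < e.
Proof.
have tF A L : tame_tube A L `<=` F by move=> v [tv _ _]; exact: (tame_domain rm eI rep tv).
have /choice[w Hw] (c : nat * seq (rat * rat * rat * rat) * nat) :
    exists w, tame D s w /\ (tame_tube c.1.1 c.1.2 !=set0 ->
      near_minimizer E (tame_tube c.1.1 c.1.2) c.2.+1%:R^-1 w).
  have [ne|ne] := pselect (tame_tube c.1.1 c.1.2 !=set0); last first.
    by exists (cst 0); split; [exact: tame0|].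
  have k0 : 0 < c.2.+1%:R^-1 :> R by rewrite invr_gt0.
  have [w nw] := near_minimizer_exists dF (@tF _ _) ne k0.
  by exists w; split => //; have [[]] := nw.
exists (fun j => w (odflt (0%N, [::], 0%N) (unpickle j))); split=> [j|u Fu Cu e e0].
  exact: (Hw _).1.
have [A0 A00 uA0] := Cc_support Cu; pose A := (Num.bound A0).+1.
have A0A : A0 <= A%:R.
  by apply/ltW; apply: lt_le_trans (archi_boundP (ltW A00)) _; rewrite ler_nat.
have uA x : A%:R <= `|x| -> u x = 0 by move=> Ax; apply: uA0; exact: le_trans Ax.
have ki0 k : 0 < k.+1%:R^-1 :> R by rewrite invr_gt0.
have /choice[L HL0] k := rational_tube A Cu.1 (ki0 k).
have /choice[d0 Hd] k : exists d : R, 0 < d /\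
    (forall v, in_tube (L k) v -> forall x, `|x| <= A%:R -> `|v x - u x| < k.+1%:R^-1) /\
    (forall v, (forall x, `|v x - u x| < d) -> in_tube (L k) v).
  by have [d d1 d2] := HL0 k; exists d.
have HL k v : in_tube (L k) v -> forall x, `|x| <= A%:R -> `|v x - u x| < k.+1%:R^-1.
  by have [_ [H _]] := Hd k; exact: H.
pose LL k := flatten [seq L i | i <- iota 0 k.+1].
pose B k := tame_tube A (LL k).
have Bne k : exists2 w, B k w & E w w <= E u u.
  have [eta eta0 Heta] : exists2 eta, 0 < eta & forall i, (i < k.+1)%N -> eta <= d0 i.
    elim: k.+1 => [|j [eta eta0 Heta]]; first by exists 1.
    exists (Num.min eta (d0 j)); first by rewrite lt_min eta0; have [] := Hd j.
    by move=> i; rewrite ltnS leq_eqVlt ge_min => /predU1P[->|/Heta->//]; rewrite lexx orbT.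
  have AR : 0 < A%:R :> R by rewrite ltr0n.
  have [v [tv vA vu Ev]] := tame_approximation rm fs dF eI rep Fu Cu.1 AR uA eta0.
  exists v => //; split => //; apply/in_tube_flatten => i ik.
  have [_ [_]] := Hd i; apply => x; exact: lt_le_trans (vu x) (Heta i ik).
have Bcl k v : B k v -> [/\ continuous v, forall x, A%:R <= `|x| -> v x = 0 &
     forall x, `|v x - u x| <= k.+1%:R^-1].
  move=> [[[cv _] _] vA /in_tube_flatten vL]; split => // x.
  have [xA|/ltW Ax] := leP `|x| A%:R; first exact/ltW/(HL k)/xA/vL.
  by rewrite vA// uA// subrr normr0 ltW.
have Bdec k : B k.+1 `<=` B k.
  move=> v [tv vA /in_tube_flatten vL]; split => //; apply/in_tube_flatten => i ik.
  by apply: vL; exact: ltnW.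
have [n Hn] := @near_minimizers_converge _ _ _ _ dF B (fun k => w (A, LL k, k)) u A%:R (E u u)
  rm Cu uA (fun k => @tF A (LL k)) Bdec (fun k => @tame_tube_midpoint A (LL k)) Bne Bcl
  (fun k => (Hw (A, LL k, k)).2 (let: ex_intro2 w Bw _ := Bne k in ex_intro _ w Bw)) e e0.
have [n' Hn'] := inv_succ_lt e0; pose k := maxn n n'.
have ke : k.+1%:R^-1 < e by apply: Hn'; exact: leq_maxr.
exists (pickle (A, LL k, k)); rewrite pickleK/=; last by apply: Hn; exact: leq_maxl.
have [v Bv _] := Bne k; have [Bw _] := (Hw (A, LL k, k)).2 (ex_intro _ v Bv).
by move=> x; apply: le_lt_trans ke; have [_ _] := Bcl k _ Bw; exact.
Qed.

End countable_selection.

(** * The core of a scale *)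

Section scale_cores.
Context {R : realType}.
Local Notation RR := (measurableTypeR R).
Variable f : R -> R.
Hypotheses (incf : {homo f : x y / x < y}) (cf : continuous f).

Let f_le x y : (f x <= f y) = (x <= y).
Proof. exact: incr_le. Qed.

(** The open intervals ]f (- n), f n[ increase to range f, so one of them
    contains K. *)
Lemma increasing_proper (K : set R) : compact K -> K `<=` range f ->
  exists2 A, 0 < A & forall x, A <= `|x| -> ~ K (f x).
Proof.
move=> /compact_near_coveringP cK Kf.
have H : \forall n \near \oo, K `<=` (fun y => f (- n%:R) < y < f n%:R).
  apply: (cK nat \oo (fun n y => f (- n%:R) < y < f n%:R)) => y Ky.
  have [x _ fx] := Kf y Ky; pose n := Num.bound `|x|.
  have : `|x| < n%:R by exact: archi_boundP.
  rewrite ltr_norml => /andP[nx xn].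
  exists (`]f (- n%:R), f n%:R[%classic, [set k | (n <= k)%N]) => /=.
    split; last by exists n.
    apply: (@near_in_itvoo R (f (- n%:R)) (f n%:R) y).
    by rewrite in_itv/= -fx !incf.
  move=> [y' k] /= [+ nk]; rewrite in_itv/= => /andP[h1 h2]; apply/andP; split.
    by apply: le_lt_trans h1; rewrite f_le lerN2 ler_nat.
  by apply: lt_le_trans h2 _; rewrite f_le ler_nat.
have [n _ /(_ n (leqnn n)) Kn] := H.
exists n.+1%:R; first by rewrite ltr0n.
move=> x nx /Kn /andP[]; rewrite !ltNge !f_le => h1 h2.
have : `|x| <= n%:R by rewrite ler_norml; move: h1 h2; rewrite -!ltNge => /ltW -> /ltW ->.
by rewrite leNgt => /negP; apply; apply: lt_le_trans nx; rewrite ltr_nat.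
Qed.

Lemma scale_core_Cc u : scale_core f u -> Cc u.
Proof.
move=> [phi /Cc_smooth_elim[K [sphi cK KU phi0]] ->].
have [A A0 KA] := increasing_proper cK KU.
apply: (@Cc_intro _ _ A).
  by move=> x; apply: continuous_comp; [exact: cf|exact: smooth_continuous].
by move=> x Ax; rewrite /= phi0//; exact: KA.
Qed.

Lemma scale_core_lipschitz u : scale_core f u -> exists2 C : R, 0 <= C &
  forall x y, x <= y -> `|u y - u x| <= C * (f y - f x).
Proof.
move=> [phi /Cc_smooth_lipschitz[C C0 HC] ->]; exists C; first exact: ltW.
by move=> x y xy; apply: HC; rewrite f_le.
Qed.

Lemma scale_core_lin a u v : scale_core f u -> scale_core f v ->
  scale_core f (fun x => a * u x + v x).
Proof.
move=> [phi sphi ->] [psi spsi ->].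
by exists (fun t => a * phi t + psi t); first exact: Cc_smooth_lin.
Qed.

Lemma scale_core_mul u v : scale_core f u -> scale_core f v -> scale_core f (u \* v).
Proof.
by move=> [phi sphi ->] [psi spsi ->]; exists (phi \* psi); first exact: Cc_smooth_mul.
Qed.

Lemma scale_core_comp psi u : smooth psi -> psi 0 = 0 -> scale_core f u ->
  scale_core f (psi \o u).
Proof.
by move=> spsi psi0 [phi sphi ->]; exists (psi \o phi); first exact: Cc_smooth_comp.
Qed.

Lemma scale_core_midpoint : midpoint_convex (scale_core f).
Proof.
move=> u v cu cv; have c0 : scale_core f (cst 0).
  exists (cst 0) => //; apply: (@Cc_smooth_intro _ _ _ set0) => //.
  - exact: (@smooth_cst R 0).
  - exact: compact0.
have := scale_core_lin 2^-1 cu (scale_core_lin 2^-1 cv c0).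
by congr (scale_core f _); apply/funext => x /=; lra.
Qed.

Lemma scale_core_approximation : exists2 a : R, 0 < a &
  forall w A e, continuous w -> 0 < A -> (forall x, A <= `|x| -> w x = 0) -> 0 < e ->
  exists u, [/\ scale_core f u, forall x, A <= `|x| -> u x = 0,
    forall x, `|u x - w x| < e &
    forall C, 0 <= C -> (forall x y, x <= y -> `|w y - w x| <= C * (f y - f x)) ->
      forall x y, x <= y -> `|u y - u x| <= C * a * (f y - f x)].
Proof.
have [a a0 Ha] := @smooth_interpolation R; exists a => // w A e cw A0 wA e0.
have [|x xA|x Ax|phi [sphi phi0 phiw philip]] := Ha f w (- A) A e incf cf cw _ _ _ e0.
- by lra.
- by apply: wA; rewrite ler_normr lerNr xA orbT.
- by apply: wA; rewrite ler_normr Ax.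
exists (phi \o f); split => //; first by exists phi.
by move=> x; rewrite ler_normr => /orP[Ax|Ax]; apply: phi0; [right|left; rewrite lerNr].
Qed.

Lemma scale_core_dense : uniformly_dense_Cc (scale_core f).
Proof.
move=> u Cu e e0; have [A A0 uA] := Cc_support Cu.
have [a _ Ha] := scale_core_approximation.
have [v [cv _ vu _]] := Ha u A e Cu.1 A0 uA e0.
by exists v => // x; rewrite distrC.
Qed.

Lemma scale_core_contraction eps : 0 < eps -> exists phi : R -> R,
  [/\ forall t, - eps <= phi t <= 1 + eps,
      forall t, 0 <= t <= 1 -> phi t = t,
      forall t t', t < t' -> 0 <= phi t' - phi t <= t' - t &
      forall u, scale_core f u -> scale_core f (phi \o u)].
Proof.
move=> /smooth_contraction[phi [sphi phib phi1 philip]]; exists phi; split => // u.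
by apply: scale_core_comp => //; rewrite phi1// lexx ler01.
Qed.

Lemma scale_core_urysohn (K G : set R) :
  compact K -> open G -> compact (closure G) -> K `<=` G ->
  exists u, [/\ scale_core f u, forall x, 0 <= u x, forall x, K x -> u x = 1 &
                forall x, ~ G x -> u x = 0].
Proof.
move=> cK oG cG KG; have [g [Cg gK gG]] := Cc_urysohn cK oG cG KG.
have [S [a [sS a0 S0 S1 Sinc]]] := @smooth_step R.
have e0 : 0 < 3^-1 :> R by rewrite invr_gt0.
have [v cv gv] := scale_core_dense Cg e0.
(* t |-> S (3 t - 1) sends t <= 1 / 3 to 0 and t >= 2 / 3 to 1 *)
pose psi t := S (3 * t + (- 1)).
exists (psi \o v); split.
- apply: scale_core_comp => //; first by apply: (@smooth_comp _ S) => //; exact: smooth_affine.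
  by rewrite /psi mulr0 add0r S0// lerN10.
- move=> x /=; rewrite /psi; move: (_ + _) => t; have [t0|/ltW t0] := leP t 0; first by rewrite S0.
  by have /andP[] := Sinc _ _ t0; rewrite (S0 0)// subr0.
- move=> x Kx; rewrite /= /psi S1//; have := gv x; rewrite gK// ltr_norml; lra.
- move=> x Gx; rewrite /= /psi S0//; have := gv x; rewrite gG// ltr_norml; lra.
Qed.

Variables (D : set nat) (I : nat -> interval R) (s : forall n, scale_function (I n)).
Variables (m : {measure set RR -> \bar R}) (F : set (R -> R)) (E : (R -> R) -> (R -> R) -> R).
Hypotheses (rm : radon m) (dF : dirichlet_form m F E).
Hypotheses (eI : effective_intervals D s) (rep : represents m D s F E).
Variable N : R -> R.
Hypotheses (fN : energy_bound D s f N) (N1 : forall x, 0 <= N x <= 1).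

Lemma scale_core_domain u : scale_core f u -> F u.
Proof.
move=> cu; have [C C0 uC] := scale_core_lipschitz cu.
by have [] := dominated_domain rm eI rep (scale_core_Cc cu) fN N1 C0 uC.
Qed.

(** By [scale_core_approximation], the functions of the core close to w can be
    chosen of bounded energy; then near-minimizers converge not only uniformly
    but for E1. *)
Lemma scale_core_E1_approximation w C e : Cc w -> 0 <= C ->
  (forall x y, x <= y -> `|w y - w x| <= C * (f y - f x)) -> 0 < e ->
  exists2 u, scale_core f u & E1 m E (u \- w) (u \- w) < e.
Proof.
move=> Cw C0 wf e0; have [A A0 wA] := Cc_support Cw.
have [a a0 Ha] := scale_core_approximation.
pose B k : set (R -> R) := [set u | [/\ scale_core f u, forall x, A <= `|x| -> u x = 0 &
  forall x, `|u x - w x| <= k.+1%:R^-1]].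
have ki0 k : 0 < k.+1%:R^-1 :> R by rewrite invr_gt0.
have BF k : B k `<=` F by move=> u [cu _ _]; exact: scale_core_domain.
have Bbd k : exists2 u, B k u & E u u <= (C * a) ^+ 2 / 2.
  have [u [cu uA uw uC]] := Ha w A k.+1%:R^-1 Cw.1 A0 wA (ki0 k).
  exists u; first by split => // x; exact/ltW.
  have Ca0 : 0 <= C * a by rewrite mulr_ge0// ltW.
  by have [] := dominated_domain rm eI rep (scale_core_Cc cu) fN N1 Ca0 (uC C C0 wf).
have Bdec k : B k.+1 `<=` B k.
  move=> u [cu uA uw]; split => // x; apply: le_trans (uw x) _.
  by rewrite lef_pV2 ?posrE// ler_nat.
have Bmid k : midpoint_convex (B k).
  move=> u v [cu uA uw] [cv vA vw]; split; first exact: scale_core_midpoint.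
    by move=> x Ax; rewrite uA// vA// addr0 mul0r.
  by move=> x; have := uw x; have := vw x; rewrite !ler_norml; move: (_^-1) => d; lra.
have Bcl k u : B k u -> [/\ continuous u, forall x, A <= `|x| -> u x = 0 &
    forall x, `|u x - w x| <= k.+1%:R^-1].
  by move=> [cu uA uw]; split => //; have [] := scale_core_Cc cu.
have /choice[v Hv] k : exists v, near_minimizer E (B k) k.+1%:R^-1 v.
  apply: (near_minimizer_exists dF (BF k)) => //.
  by have [u Bu _] := Bbd k; exists u.
have [n Hn] := near_minimizers_converge dF rm Cw wA BF Bdec Bmid Bbd Bcl Hv e0.
by exists (v n); [have [[]] := Hv n|exact: Hn].
Qed.

End scale_cores.

Theorem theorem5p11 (R : realType)
    (m : {measure set (measurableTypeR R) -> \bar R})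
    (F : set (R -> R)) (E : (R -> R) -> (R -> R) -> R)
    (D : set nat) (I : nat -> interval R)
    (s : forall n, scale_function (I n)) :
  radon m -> full_support m ->
  dirichlet_form m F E -> regular_form m F E -> strongly_local m F E ->
  effective_intervals D s -> represents m D s F E ->
  exists f : R -> R,
    [/\ {homo f : x y / x < y}, continuous f, f 0 = 0 &
        special_standard_core m F E (scale_core f)].
Proof.
move=> rm fs dF [denseE denseU] _ eI rep.
have [v [tv Hv]] := countable_selection rm fs dF eI rep.
have [g [N [ndg cg gN N1 vg]]] := tame_series tv.
pose f x := g x - g 0.
have df x y : f y - f x = g y - g x by rewrite /f opprB addrA subrK.
have cf : continuous f by move=> x; apply: cvgB; [exact: cg|exact: cvg_cst].
have fN : energy_bound D s f N by case: gN => ? H; split=> // n y z; rewrite df; exact: H.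
have vf j : exists2 C, 0 <= C & forall x y, x <= y -> `|v j y - v j x| <= C * (f y - f x).
  by have [C C0 HC] := vg j; exists C => // x y xy; rewrite df HC.
(* if g were constant on [x, y], each v_j would take the same value at x and y,
   whereas the v_j approximate uniformly every function of Cc *)
have incf : {homo f : x y / x < y}.
  move=> x y xy; rewrite -subr_gt0 lt_neqAle df subr_ge0 ndg ?(ltW xy)// andbT.
  apply/eqP => gxy.
  have veq j : v j y = v j x.
    have [C _ /(_ x y (ltW xy))] := vg j; rewrite -gxy mulr0 normr_le0 subr_eq0 => /eqP//.
  have [||||h [Ch hy hx]] := @Cc_urysohn R [set y] `]x, y + 1[%classic.
  - exact: compact_set1.
  - exact: itv_open.
  - apply: (@subclosed_compact _ _ `[x, y + 1]%classic).
    + exact: closed_closure.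
    + exact: segment_compact.
    + have /closure_id -> : closed (`[x, y + 1]%classic : set R) by exact: itv_closed.
      apply: closure_subset => z /=; rewrite !in_itv/= => /andP[xz zy].
      by rewrite !ltW.
  - by move=> z /= ->; rewrite in_itv/= xy ltrDl ltr01.
  have e0 : 0 < 4^-1 :> R by rewrite invr_gt0.
  have [u [Fu Cu] hu] := denseU h Ch _ e0.
  have [j vu _] := Hv u Fu Cu _ e0.
  have := hu x; have := hu y; have := vu x; have := vu y.
  rewrite (hy y)// (hx x) /= ?in_itv/= ?ltxx// veq !ltr_norml.
  by move: (u x) (u y) (v j x) => a b c; lra.
exists f; split => //; first by rewrite /f subrr.
have coreF := scale_core_domain incf cf rm eI rep fN N1.
split.
- by move=> u cu; split; [exact: coreF|exact: (scale_core_Cc incf cf cu)].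
- move=> u Fu e e0; have e8 : 0 < e / 16 by rewrite divr_gt0.
  have [u1 [Fu1 Cu1] uu1] := denseE u Fu _ e8.
  have [j _ ju1] := Hv u1 Fu1 Cu1 _ e8.
  have [C C0 vC] := vf j.
  have [w cw wj] := scale_core_E1_approximation incf cf rm dF eI rep fN N1 (tv j).1 C0 vC e8.
  have Fv := tame_domain rm eI rep (tv j); have Fw := coreF w cw.
  exists w => //; have := form_triangle dF Fu Fu1 Fw; have := form_triangle dF Fu1 Fv Fw.
  move: ju1 wj uu1; rewrite (E1_sub_sym dF Fv Fu1) (E1_sub_sym dF Fw Fv).
  by move: (E1 _ _ _ _) (E1 _ _ _ _) (E1 _ _ _ _) (E1 _ _ _ _) (E1 _ _ _ _) => *; lra.
- exact: (scale_core_dense incf cf).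
- by move=> a u w; exact: scale_core_lin.
- by move=> u w; exact: scale_core_mul.
- exact: scale_core_contraction.
- exact: (scale_core_urysohn incf cf).
Qed.
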